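(* Let $\mathcal{A}$ be a tensor cellular tower category. Suppose that $A_{m+n}$ is a two-sided projective $A_m\otimes A_n$-module for all $m,n\in\mathbb{N}$. Then $(G_0(\mathcal{A}),\pi,\mu)$ is an algebra and $(G_0(\mathcal{A}),\Delta,\epsilon)$ is a coalgebra (over $\mathbb{Z}$; that is, $\pi$ is associative with unit $\mu$, and $\Delta$ is coassociative with counit $\epsilon$).
   Context: **Conventions.** $K$ is a field. All algebras are finite-dimensional $K$-algebras and all modules are finitely generated unitary left modules unless stated otherwise. $\mathcal{A}$ is a small $K$-linear category with finite-dimensional Hom-spaces and bilinear composition. Morphisms are composed from left to right: for $a\in\mathrm{Hom}_{\mathcal{A}}(p,m)$ and $b\in\mathrm{Hom}_{\mathcal{A}}(m,n)$ the composite is $ab\in\mathrm{Hom}_{\mathcal{A}}(p,n)$. Write $A_n=\mathrm{End}_{\mathcal{A}}(n)$; thus $\mathrm{Hom}_{\mathcal{A}}(m,n)$ is an $A_m$-$A_n$-bimodule. $\mathbb{N}$ contains $0$. **Cellular category.** $\mathcal{A}$ is cellular if it has a $K$-linear contravariant functor $*$, identity on objects, with $(-)^{**}=\mathrm{id}_{\mathcal{A}}$, a partially ordered set $\Lambda$, a finite set $M(n,\lambda)$ for each object $n$ and $\lambda\in\Lambda$, and for all objects $m,n$ and $\lambda\in\Lambda$ an injection $M(m,\lambda)\times M(n,\lambda)\to\mathrm{Hom}_{\mathcal{A}}(m,n)$, $(S,T)\mapsto C^\lambda_{S,T}$, such that: (C1) for all $m,n$ the induced map $\coprod_{\lambda\in\Lambda}M(m,\lambda)\times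 M(n,\lambda)\to\mathrm{Hom}_{\mathcal{A}}(m,n)$ is injective with image a $K$-basis; (C2) $(C^\lambda_{S,T})^*=C^\lambda_{T,S}$; (C3) for all objects $p,m,n$, all $\lambda\in\Lambda$, $a\in\mathrm{Hom}_{\mathcal{A}}(p,m)$, $S\in M(m,\lambda)$, $T\in M(n,\lambda)$, $$aC^\lambda_{S,T}\equiv\sum_{S'\in M(p,\lambda)}r_a(S',S)\,C^\lambda_{S',T}\pmod{\mathcal{A}(<\lambda)},$$ where $r_a(S',S)\in K$ is independent of $T$ and $\mathcal{A}(<\lambda)$ is the $K$-span of $\{C^\mu_{S,T}\mid\mu<\lambda,\ S\in M(p,\mu),\ T\in M(n,\mu)\}$. Put $\Lambda_n=\{\lambda\in\Lambda\mid M(n,\lambda)\neq\emptyset\}$ with the induced order, and $\Lambda_k=\emptyset$ for $k<0$. For $\lambda\in\Lambda_n$ the cell module $\Delta_n(\lambda)$ is the left $A_n$-module with $K$-basis $\{C^{(n,\lambda)}_X\mid X\in M(n,\lambda)\}$ and action $aC^{(n,\lambda)}_X=\sum_{Y\in M(n,\lambda)}r_a(Y,X)\,C^{(n,\lambda)}_Y$ for $a\in A_n$. **Hereditary cellular category.** A cellular category $\mathcal{A}$ such that (1) its object set is $\mathbb{N}$; (2) for all $m\le n$ in $\mathbb{N}$ with $\mathrm{Hom}_{\mathcal{A}}(m,n)\neq0$, $\Lambda_m$ is a saturated ordered subset of $\Lambda_n$, i.e. $\Lambda_m\subset\Lambda_n$ (preserving order), and if $\lambda<\mu$ with $\mu\in\Lambda_m$,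 $\lambda\in\Lambda_n$, then $\lambda\in\Lambda_m$; (3) each $A_n$ is quasi-hereditary. **Tensor cellular tower category.** A hereditary cellular category satisfying (A1′), (A2), (A3), (A4): (A1′) $A_0\cong K$, $A_1\cong K$, and there is an external multiplication $\rho_{m,n}:A_m\otimes A_n\to A_{m+n}$ for all $m,n\ge0$ such that (a) each $\rho_{m,n}$ is an injective algebra homomorphism sending $1_m\otimes1_n$ to $1_{m+n}$; (b) $\rho$ is associative: $\rho_{l+m,n}\circ(\rho_{l,m}\otimes\mathrm{id}_{A_n})=\rho_{l,m+n}\circ(\mathrm{id}_{A_l}\otimes\rho_{m,n})$ for all $l,m,n$. In particular $A_n$ is identified with a unital subalgebra of $A_{n+1}$ via $a\mapsto\rho_{1,n}(1_1\otimes a)$, giving functors $\mathrm{Res}_{n+1}$ (restriction from $A_{n+1}$ to $A_n$) and $\mathrm{Ind}_n=A_{n+1}\otimes_{A_n}-$. (A2) For all $n\ge2$ there is an isomorphism of $A_{n-1}$-$A_{n-2}$-bimodules $\mathrm{Hom}_{\mathcal{A}}(n,n-2)\simeq A_{n-1}$. If an $A_n$-module $M$ has a $\Delta_n$-filtration, i.e. a filtration with successive quotients isomorphic to cell modules $\Delta_n(\lambda)$, then $\mathrm{supp}_n(M)$ denotes the set of labels $\lambda$ for which $\Delta_n(\lambda)$ occurs in this filtration. (A3) For all $m\le n$ with $n\ge1$ and $n-m$ even, and all $\lambda\in\Lambda_m\setminus\Lambda_{m-2}$, the module $\mathrm{Res}_n(\Delta_n(\lambda))$ has a $\Delta_{n-1}$-filtration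 and $\mathrm{supp}_{n-1}(\mathrm{Res}_n(\Delta_n(\lambda)))\subseteq\big((\Lambda_{m-1}\setminus\Lambda_{m-3})\cup(\Lambda_{m+1}\setminus\Lambda_{m-1})\big)\cap\Lambda_{n-1}$. (It follows that $\mathrm{Ind}_n(\Delta_n(\lambda))$ has a $\Delta_{n+1}$-filtration.) (A4) For each $n\ge1$ and $\lambda\in\Lambda_n\setminus\Lambda_{n-2}$ there exists $\mu\in\Lambda_{n-1}\setminus\Lambda_{n-3}$ with $\lambda\in\mathrm{supp}_n(\mathrm{Ind}_{n-1}(\Delta_{n-1}(\mu)))$. **Projectivity.** $A_{m+n}$ is a right and a left $A_m\otimes A_n$-module by $a\cdot(b\otimes c)=a\rho_{m,n}(b\otimes c)$ and $(b\otimes c)\cdot a=\rho_{m,n}(b\otimes c)a$; ''two-sided projective'' means projective both as a left and as a right module. **Structure maps.** $G_0(A_n)$ is the Grothendieck group of finitely generated $A_n$-modules, $G_0(\mathcal{A})=\bigoplus_{n\ge0}G_0(A_n)$. Define $i_{m,n}:G_0(A_m)\otimes_{\mathbb{Z}}G_0(A_n)\to G_0(A_{m+n})$ by $[M]\otimes[N]\mapsto[A_{m+n}\otimes_{A_m\otimes A_n}(M\otimes_KN)]$. For $k+l=n$ define $r_{k,l}:G_0(A_n)\to G_0(A_k)\otimes_{\mathbb{Z}}G_0(A_l)$ by sending $[N]$ to the class of $N$ restricted to $A_k\otimes A_l$ along $\rho_{k,l}$, where $G_0(A_k\otimes A_l)$ is identified with $G_0(A_k)\otimes_{\mathbb{Z}}G_0(A_l)$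 via $[M\otimes_K M']\leftrightarrow[M]\otimes[M']$. Then - $\pi:G_0(\mathcal{A})\otimes_{\mathbb{Z}}G_0(\mathcal{A})\to G_0(\mathcal{A})$ is given by $\pi|_{G_0(A_k)\otimes G_0(A_l)}=i_{k,l}$; - $\Delta:G_0(\mathcal{A})\to G_0(\mathcal{A})\otimes_{\mathbb{Z}}G_0(\mathcal{A})$ is given by $\Delta|_{G_0(A_n)}=\sum_{k+l=n}r_{k,l}$; - $\mu:\mathbb{Z}\to G_0(\mathcal{A})$, $\mu(a)=a[K]\in G_0(A_0)$; - $\epsilon:G_0(\mathcal{A})\to\mathbb{Z}$ is the additive map with $\epsilon(a[K])=a$ on $G_0(A_0)=\mathbb{Z}[K]$ and $\epsilon=0$ on $G_0(A_n)$ for $n\ge1$. *)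

(* Defs.v *)
From HB Require Import structures.
From mathcomp Require Import all_boot all_order all_algebra.
From mathcomp Require Import boolp.
From mathcomp.multinomials Require Import freeg.

Set Implicit Arguments.
Unset Strict Implicit.
Unset Printing Implicit Defensive.

Import GRing.Theory.
Local Open Scope ring_scope.

Definition bilin (K : fieldType) (U V W : lmodType K) (f : U -> V -> W) : Prop :=
  (forall v, linear (f^~ v)) /\ (forall u, linear (f u)).

(* U (x) V is modelled by coordinate matrices in fixed bases of U and V; it is
   used only through [tpure], [tlift], and their universal property
   ([tlift_pure], [tens_ind]). *)
Definition tens (K : fieldType) (U V : vectType K) : Type :=
  'M[K]_(\dim {:U}, \dim {:V}).
HB.instance Definition _ (K : fieldType) (U V : vectType K) :=
  Vector.on (tens U V).

Section Tens.
Variables (K : fieldType) (U V : vectType K).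

Definition tpure (u : U) (v : V) : tens U V :=
  \matrix_(i, j) (coord (vbasis {:U}) i u * coord (vbasis {:V}) j v).

Definition tlift (W : lmodType K) (b : U -> V -> W) (t : tens U V) : W :=
  \sum_i \sum_j (t : 'M[K]_(_, _)) i j *: b (vbasis {:U})`_i (vbasis {:V})`_j.

Fact tlift_linear (W : lmodType K) (b : U -> V -> W) : linear (tlift b).
Proof.
move=> c s t; rewrite /tlift scaler_sumr -big_split /=; apply: eq_bigr => i _.
rewrite scaler_sumr -big_split /=; apply: eq_bigr => j _.
by rewrite !mxE scalerDl scalerA.
Qed.
HB.instance Definition _ (W : lmodType K) (b : U -> V -> W) :=
  GRing.isLinear.Build K (tens U V) W _ (tlift b) (tlift_linear b).

Lemma tpure_bilin : bilin tpure.
Proof.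
split=> w c x y; apply/matrixP => i j.
  by rewrite !mxE linearP /= mulrDl mulrA.
by rewrite !mxE linearP /= mulrDr mulrCA.
Qed.

Lemma tens_sum (t : tens U V) :
  t = \sum_i \sum_j (t : 'M[K]_(_, _)) i j *:
        tpure (vbasis {:U})`_i (vbasis {:V})`_j.
Proof.
apply/matrixP => i j; rewrite !summxE (bigD1 i) //= [X in _ + X]big1 ?addr0.
  rewrite !summxE (bigD1 j) //= [X in _ + X]big1 ?addr0.
    by rewrite !mxE !coord_free ?(basis_free (vbasisP _)) // !eqxx !mulr1.
  move=> k /negPf nkj; rewrite !mxE !coord_free ?(basis_free (vbasisP _)) //.
  by rewrite nkj mulr0 mulr0.
move=> k /negPf nki; rewrite summxE big1 // => l _.
rewrite !mxE !coord_free ?(basis_free (vbasisP _)) //.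
by rewrite nki mul0r mulr0.
Qed.

Lemma bilin_sum (W : lmodType K) (b : U -> V -> W) : bilin b -> forall u v,
  b u v = \sum_i \sum_j
    (coord (vbasis {:U}) i u * coord (vbasis {:V}) j v) *:
      b (vbasis {:U})`_i (vbasis {:V})`_j.
Proof.
move=> [bl br] u v.
pose bu v' : {linear U -> W} := HB.pack (b^~ v') (GRing.isLinear.Build K U W _ _ (bl v')).
pose bv u' : {linear V -> W} := HB.pack (b u') (GRing.isLinear.Build K V W _ _ (br u')).
transitivity (bu v (\sum_i coord (vbasis {:U}) i u *: (vbasis {:U})`_i)).
  by rewrite -(coord_vbasis (memvf u)).
rewrite linear_sum; apply: eq_bigr => i _; rewrite linearZ /=.
transitivity (coord (vbasis {:U}) i u *:
    bv (vbasis {:U})`_i (\sum_j coord (vbasis {:V}) j v *: (vbasis {:V})`_j)).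
  by rewrite -(coord_vbasis (memvf v)).
rewrite linear_sum scaler_sumr.
by apply: eq_bigr => j _; rewrite linearZ /= scalerA.
Qed.

Lemma tlift_pure (W : lmodType K) (b : U -> V -> W) u v :
  bilin b -> tlift b (tpure u v) = b u v.
Proof.
move=> bb; rewrite (bilin_sum bb u v) /tlift.
by apply: eq_bigr => i _; apply: eq_bigr => j _; rewrite mxE.
Qed.

Lemma tens_ind (P : tens U V -> Prop) :
  (forall u v, P (tpure u v)) ->
  (forall c x y, P x -> P y -> P (c *: x + y)) -> forall t, P t.
Proof.
move=> Pp Pl t.
have P0 : P 0.
  rewrite (_ : 0 = tpure 0 0) //; apply/matrixP => i j.
  by rewrite !mxE !linear0 mul0r.
rewrite (tens_sum t); elim/big_ind: _ => //.
  by move=> x y Px Py; rewrite -[x]scale1r; apply: Pl.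
move=> i _; elim/big_ind: _ => //.
  by move=> x y Px Py; rewrite -[x]scale1r; apply: Pl.
by move=> j _; rewrite -[X in P X]addr0; apply: Pl.
Qed.

Lemma tens_ext (W : lmodType K) (f g : tens U V -> W) :
  linear f -> linear g -> (forall u v, f (tpure u v) = g (tpure u v)) ->
  forall t, f t = g t.
Proof.
move=> fl gl fg t.
pose f' : {linear tens U V -> W} := HB.pack f (GRing.isLinear.Build K _ _ _ _ fl).
pose g' : {linear tens U V -> W} := HB.pack g (GRing.isLinear.Build K _ _ _ _ gl).
transitivity (f' t) => //; transitivity (g' t) => //.
rewrite (tens_sum t) !linear_sum; apply: eq_bigr => i _.
rewrite !linear_sum; apply: eq_bigr => j _.
by rewrite !linearZ /= fg.
Qed.

Lemma tlift_param (X W : lmodType K) (b : X -> U -> V -> W) :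
  (forall u v, linear (fun x => b x u v)) ->
  forall t, linear (fun x => tlift (b x) t).
Proof.
move=> bl t c x y; rewrite /tlift scaler_sumr -big_split /=.
apply: eq_bigr => i _; rewrite scaler_sumr -big_split /=.
by apply: eq_bigr => j _; rewrite bl scalerDr !scalerA mulrC.
Qed.

End Tens.

Notation "u ⊗ v" := (tpure u v) (at level 40, left associativity) : ring_scope.

(* The library's [algType] and [falgType] exclude the zero ring, which does
   occur here (as an endomorphism algebra of a zero object and as a quotient). *)
HB.mixin Record isFdAlg (K : fieldType) (A : Type) of Vector K A := {
  aone : A;
  amul : A -> A -> A;
  amul_bilin : bilin amul;
  amulA : associative amul;
  amul1l : left_id aone amul;
  amul1r : right_id aone amul
}.
#[short(type="fdAlgType")]
HB.structure Definition FdAlg (K : fieldType) := { A of Vector K A & isFdAlg K A }.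

Notation "x ⋅ y" := (amul x y) (at level 40, left associativity) : ring_scope.

Fact regular_mul_bilin (K : fieldType) : bilin (fun x y : K^o => x * y : K^o).
Proof. split=> w c x y; first by rewrite mulrDl -[c *: x]/(c * x) -mulrA.
by rewrite mulrDr -[c *: x]/(c * x) mulrCA. Qed.
HB.instance Definition _ (K : fieldType) :=
  isFdAlg.Build K K^o (@regular_mul_bilin K) (@mulrA K) (@mul1r K) (@mulr1 K).

Definition opalg (K : fieldType) (A : fdAlgType K) : Type := A.
Section Opposite.
Variables (K : fieldType) (A : fdAlgType K).
HB.instance Definition _ := Vector.on (opalg A).
Let opmul (x y : opalg A) : opalg A := (y : A) ⋅ (x : A).
Fact opmulA : associative opmul.
Proof. by move=> x y z; rewrite /opmul amulA. Qed.
HB.instance Definition _ := isFdAlg.Build K (opalg A)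
  (conj (amul_bilin (s := A)).2 (amul_bilin (s := A)).1)
  opmulA (@amul1r K A) (@amul1l K A).
End Opposite.

Section FdAlgTheory.
Variables (K : fieldType) (A : fdAlgType K).
Lemma amul_linl (y : A) : linear (amul^~ y). Proof. exact: (amul_bilin (s := A)).1. Qed.
Lemma amul_linr (x : A) : linear (amul x). Proof. exact: (amul_bilin (s := A)).2. Qed.
End FdAlgTheory.

Section TensAlg.
Variables (K : fieldType) (A B : fdAlgType K).

Definition tens_mul (x y : tens A B) : tens A B :=
  tlift (fun a b => tlift (fun a' b' => (a ⋅ a') ⊗ (b ⋅ b')) y) x.
Definition tens_one : tens A B := (aone : A) ⊗ (aone : B).

Let pureL (v : B) : linear (fun u : A => u ⊗ v) := (tpure_bilin A B).1 v.
Let pureR (u : A) : linear (fun v : B => u ⊗ v) := (tpure_bilin A B).2 u.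

Fact tens_mul_bilin : bilin tens_mul.
Proof.
split=> [y|x]; first by move=> c x x'; rewrite /tens_mul linearP.
by apply: tlift_param => a b c y y'; rewrite linearP.
Qed.

Lemma tens_mul_pure a b a' b' :
  tens_mul (a ⊗ b) (a' ⊗ b') = (a ⋅ a') ⊗ (b ⋅ b').
Proof.
rewrite /tens_mul tlift_pure; first rewrite tlift_pure //.
  by split=> [v|u] c x y; rewrite amul_linr ?pureL ?pureR.
by split=> [v|u]; apply: tlift_param => u' v' d z z';
  rewrite amul_linl ?pureL ?pureR.
Qed.

Fact tens_mulA : associative tens_mul.
Proof.
have ml y : linear (tens_mul^~ y) := tens_mul_bilin.1 y.
have mr x : linear (tens_mul x) := tens_mul_bilin.2 x.
move=> x y z.
elim/tens_ind: x => [a b|c x x' hx hx']; last by rewrite !ml hx hx'.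
elim/tens_ind: y => [a' b'|c x x' hx hx']; last by rewrite !(ml, mr) hx hx'.
elim/tens_ind: z => [a'' b''|c x x' hx hx']; last by rewrite !mr hx hx'.
by rewrite !tens_mul_pure !amulA.
Qed.

Fact tens_mul1l : left_id tens_one tens_mul.
Proof.
have mr x : linear (tens_mul x) := tens_mul_bilin.2 x.
elim/tens_ind => [a b|c x x' hx hx']; last by rewrite mr hx hx'.
by rewrite tens_mul_pure !amul1l.
Qed.

Fact tens_mul1r : right_id tens_one tens_mul.
Proof.
have ml y : linear (tens_mul^~ y) := tens_mul_bilin.1 y.
elim/tens_ind => [a b|c x x' hx hx']; last by rewrite ml hx hx'.
by rewrite tens_mul_pure !amul1r.
Qed.

HB.instance Definition _ := isFdAlg.Build K (tens A B)
  tens_mul_bilin tens_mulA tens_mul1l tens_mul1r.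
End TensAlg.

Section Modules.
Variable K : fieldType.

Record alghom (A B : fdAlgType K) := AlgHom {
  alghom_fun :> 'Hom(A, B);
  alghom1 : alghom_fun aone = aone;
  alghomM : {morph alghom_fun : x y / x ⋅ y}
}.

(* Finitely generated left modules over a finite-dimensional algebra, i.e.
   finite-dimensional ones. *)
Record fdMod (A : fdAlgType K) := FdMod {
  mod_car :> vectType K;
  mact : A -> mod_car -> mod_car;
  mact_bilin : bilin mact;
  mactM : forall a b v, mact (a ⋅ b) v = mact a (mact b v);
  mact1 : forall v, mact aone v = v
}.

Section OverA.
Variable A : fdAlgType K.
Implicit Types L M N P X Y : fdMod A.

Definition modhom M N (f : 'Hom(M, N)) : Prop :=
  forall a v, f (mact a v) = mact a (f v).

Definition short_exact L M N : Prop :=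
  exists (f : 'Hom(L, M)) (g : 'Hom(M, N)),
    [/\ modhom f, modhom g & [/\ lker f = 0%VS, limg f = lker g & limg g = fullv]].

Definition projective P : Prop :=
  forall X Y (g : 'Hom(X, Y)) (h : 'Hom(P, Y)),
    modhom g -> modhom h -> limg g = fullv ->
    exists2 k : 'Hom(P, X), modhom k & (g \o k)%VF = h.

Definition submod M (U : {vspace M}) : Prop :=
  forall a v, v \in U -> mact a v \in U.

Definition simple_mod M : Prop :=
  ({:M} <> 0)%VS /\ forall U : {vspace M}, submod U -> U = 0%VS \/ U = fullv.

Definition regmod : fdMod A :=
  @FdMod A A amul (amul_bilin (s := A)) (fun a b c => esym (amulA a b c))
    (@amul1l K A).
End OverA.
Arguments regmod A : clear implicits.

Section Restriction.
Variables (A B : fdAlgType K) (f : alghom B A) (M : fdMod A).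
Let ract (b : B) (v : M) : M := mact (f b) v.
Fact resmod_bilin : bilin ract.
Proof.
split=> [v|b] c x y; rewrite /ract ?linearP /=.
  exact: (mact_bilin M).1.
exact: (mact_bilin M).2.
Qed.
Fact resmodM a b v : ract (a ⋅ b) v = ract a (ract b v).
Proof. by rewrite /ract alghomM mactM. Qed.
Fact resmod1 v : ract aone v = v.
Proof. by rewrite /ract alghom1 mact1. Qed.
Definition resmod : fdMod B := FdMod resmod_bilin resmodM resmod1.
End Restriction.

Section TensMod.
Variables (A B : fdAlgType K) (M : fdMod A) (N : fdMod B).
Definition tens_act (x : tens A B) (t : tens M N) : tens M N :=
  tlift (fun a b => tlift (fun m n => mact a m ⊗ mact b n) t) x.
Let pureL (v : N) : linear (fun u : M => u ⊗ v) := (tpure_bilin M N).1 v.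
Let pureR (u : M) : linear (fun v : N => u ⊗ v) := (tpure_bilin M N).2 u.

Fact tens_act_bilin : bilin tens_act.
Proof.
split=> [y|x]; first by move=> c x x'; rewrite /tens_act linearP.
by apply: tlift_param => a b c y y'; rewrite linearP.
Qed.

Lemma tens_act_pure a b m n :
  tens_act (a ⊗ b) (m ⊗ n) = mact a m ⊗ mact b n.
Proof.
rewrite /tens_act tlift_pure; first rewrite tlift_pure //.
  by split=> [v|u] c x y; rewrite (mact_bilin _).2 ?pureL ?pureR.
by split=> [v|u]; apply: tlift_param => u' v' d z z';
  rewrite (mact_bilin _).1 ?pureL ?pureR.
Qed.

Fact tens_actM x y t : tens_act (x ⋅ y) t = tens_act x (tens_act y t).
Proof.
have ml t' : linear (tens_act^~ t') := tens_act_bilin.1 t'.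
have mr x' : linear (tens_act x') := tens_act_bilin.2 x'.
elim/tens_ind: x => [a b|c x x' hx hx'].
  elim/tens_ind: y => [a' b'|c x x' hx hx'].
    elim/tens_ind: t => [m n|c x x' hx hx']; last by rewrite !mr hx hx'.
    by rewrite [_ ⋅ _]tens_mul_pure !tens_act_pure !mactM.
  by rewrite amul_linr !ml mr hx hx'.
by rewrite amul_linl !ml hx hx'.
Qed.

Fact tens_act1 t : tens_act aone t = t.
Proof.
have mr x' : linear (tens_act x') := tens_act_bilin.2 x'.
elim/tens_ind: t => [m n|c x x' hx hx']; last by rewrite mr hx hx'.
by rewrite [aone]/(tens_one A B) tens_act_pure !mact1.
Qed.

Definition tensmod : fdMod (tens A B) := FdMod tens_act_bilin tens_actM tens_act1.
End TensMod.

Section Quotient.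
Variables (V : vectType K) (W : {vspace V}).
(* V / W, realised on the complement W^C; the quotient map is the projection
   along W. *)
Definition quotv : vectType K := subvs_of (W^C)%VS.
Definition quotv_pi : 'Hom(V, quotv) :=
  (linfun (vsproj (W^C)%VS) \o daddv_pi (W^C) W)%VF.

Lemma quotv_piK (x : quotv) : quotv_pi (vsval x) = x.
Proof.
rewrite comp_lfunE lfunE /= daddv_pi_id ?subvsP ?vsvalK //.
by rewrite capvC capv_compl.
Qed.

Lemma limg_quotv_pi : limg quotv_pi = fullv.
Proof.
apply/eqP; rewrite eqEsubv subvf; apply/subvP => x _.
by rewrite -[x]quotv_piK memv_img // memvf.
Qed.

Lemma quotv_decomp v : v - vsval (quotv_pi v) \in W.
Proof.
rewrite comp_lfunE lfunE /= vsprojK ?memv_pi //.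
have dW : (W :&: W^C = 0)%VS by rewrite capv_compl.
have := daddv_pi_add dW (w := v); rewrite addv_complf memvf => /(_ isT) e.
by rewrite -{1}e addrK memv_pi.
Qed.

Lemma lker_quotv_pi : lker quotv_pi = W.
Proof.
apply/eqP; rewrite eqEsubv; apply/andP; split; apply/subvP => v.
  rewrite memv_ker => /eqP v0; have := quotv_decomp v.
  by rewrite v0 [vsval 0]linear0 subr0.
move=> vW; rewrite memv_ker comp_lfunE lfunE /=.
have dW : (W :&: W^C = 0)%VS by rewrite capv_compl.
have := daddv_pi_add dW (w := v); rewrite addv_complf memvf => /(_ isT).
rewrite [X in X + _]daddv_pi_id // => /eqP; rewrite -subr_eq0 addrAC subrr add0r.
by move/eqP ->; rewrite linear0.
Qed.
End Quotient.

Section Induction.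
Variables (A B : fdAlgType K) (f : alghom B A) (M : fdMod B).

(* a (x) b (x) m |-> a f(b) (x) m - a (x) b m; its image is the subspace of
   balancing relations, so that [indmod] below is A (x)_B M, where A is a right
   B-module through f. *)
Definition ind_rel : tens (tens A B) M -> tens A M :=
  tlift (fun x m => tlift (fun a b => (a ⋅ f b) ⊗ m - a ⊗ mact b m) x).
Fact ind_rel_linear : linear ind_rel.
Proof. by move=> c x y; rewrite /ind_rel linearP. Qed.
HB.instance Definition _ := GRing.isLinear.Build K _ _ _ ind_rel ind_rel_linear.
Definition ind_relspace : {vspace tens A M} := limg (linfun ind_rel).

Let pureL (v : M) : linear (fun u : A => u ⊗ v) := (tpure_bilin A M).1 v.
Let pureR (u : A) : linear (fun v : M => u ⊗ v) := (tpure_bilin A M).2 u.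

Lemma ind_rel_pure a b m :
  ind_rel ((a ⊗ b) ⊗ m) = (a ⋅ f b) ⊗ m - a ⊗ mact b m.
Proof.
rewrite /ind_rel tlift_pure; first rewrite tlift_pure //.
  split=> [v|u] c x y.
    by rewrite amul_linl !pureL scalerBr opprD addrACA.
  rewrite linearP amul_linr (mact_bilin _).1 pureL pureR.
  by rewrite scalerBr opprD addrACA.
split=> [v|u]; first by move=> c x y; rewrite linearP.
apply: tlift_param => u' v' d z z'.
by rewrite (mact_bilin _).2 !pureR scalerBr opprD addrACA.
Qed.

Definition ind_lmul (a : A) : tens A M -> tens A M :=
  tlift (fun a' m => (a ⋅ a') ⊗ m).

Fact ind_lmul_bilin : bilin ind_lmul.
Proof.
split=> [t|a]; last by move=> c x y; rewrite /ind_lmul linearP.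
by apply: tlift_param => u v c x y; rewrite amul_linl pureL.
Qed.

Lemma ind_lmul_pure a a' m : ind_lmul a (a' ⊗ m) = (a ⋅ a') ⊗ m.
Proof.
rewrite /ind_lmul tlift_pure //.
by split=> [v|u] c x y; rewrite ?amul_linr ?pureL ?pureR.
Qed.

Fact ind_lmulM a b t : ind_lmul (a ⋅ b) t = ind_lmul a (ind_lmul b t).
Proof.
have mr x : linear (ind_lmul x) := ind_lmul_bilin.2 x.
elim/tens_ind: t => [u v|c x y hx hy]; last by rewrite !mr hx hy.
by rewrite !ind_lmul_pure amulA.
Qed.

Fact ind_lmul1 t : ind_lmul aone t = t.
Proof.
have mr x : linear (ind_lmul x) := ind_lmul_bilin.2 x.
elim/tens_ind: t => [u v|c x y hx hy]; last by rewrite !mr hx hy.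
by rewrite !ind_lmul_pure amul1l.
Qed.

Fact ind_lmul_rel a t : t \in ind_relspace -> ind_lmul a t \in ind_relspace.
Proof.
have mr : linear (ind_lmul a) := ind_lmul_bilin.2 a.
case/memv_imgP => z _ ->; rewrite lfunE /=.
have rl := ind_rel_linear.
elim/tens_ind: z => [z m|c x y hx hy]; last by rewrite rl mr memvD ?memvZ.
elim/tens_ind: z => [b c|c x y hx hy]; last first.
  by rewrite (tpure_bilin _ _).1 rl mr memvD ?memvZ.
rewrite ind_rel_pure -[X in ind_lmul a X]addrC -scaleN1r mr !ind_lmul_pure.
rewrite scaleN1r addrC amulA -ind_rel_pure -[ind_rel _]lfunE.
by rewrite memv_img // memvf.
Qed.

Let ind_car : vectType K := quotv ind_relspace.
Definition ind_act (a : A) (x : ind_car) : ind_car :=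
  quotv_pi ind_relspace (ind_lmul a (vsval x)).

Fact ind_act_bilin : bilin ind_act.
Proof.
split=> [t|a] c x y; rewrite /ind_act.
  by rewrite ind_lmul_bilin.1 linearP.
by rewrite linearP ind_lmul_bilin.2 linearP.
Qed.

Lemma ind_act_pi a t :
  ind_act a (quotv_pi ind_relspace t) = quotv_pi ind_relspace (ind_lmul a t).
Proof.
have mr : linear (ind_lmul a) := ind_lmul_bilin.2 a.
have := ind_lmul_rel a (quotv_decomp ind_relspace t).
rewrite -[X in pred_of_vspace X]lker_quotv_pi memv_ker -scaleN1r addrC mr scaleN1r addrC.
by rewrite linearB subr_eq0 => /eqP ->.
Qed.

Fact ind_actM a b x : ind_act (a ⋅ b) x = ind_act a (ind_act b x).
Proof. by rewrite [ind_act b x]/ind_act ind_act_pi -ind_lmulM. Qed.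

Fact ind_act1 x : ind_act aone x = x.
Proof. by rewrite /ind_act ind_lmul1 quotv_piK. Qed.

Definition indmod : fdMod A := FdMod ind_act_bilin ind_actM ind_act1.
End Induction.

Section AlgHoms.
Variables A B C : fdAlgType K.
Fact alghom_comp1 (g : alghom B C) (f : alghom A B) : (g \o f)%VF aone = aone.
Proof. by rewrite comp_lfunE !alghom1. Qed.
Fact alghom_compM (g : alghom B C) (f : alghom A B) :
  {morph (g \o f)%VF : x y / x ⋅ y}.
Proof. by move=> x y; rewrite !comp_lfunE !alghomM. Qed.
Definition alghom_comp (g : alghom B C) (f : alghom A B) : alghom A C :=
  AlgHom (alghom_comp1 g f) (alghom_compM g f).

Fact alghom_op1 (f : alghom A B) :
  ((f : 'Hom(A, B)) : 'Hom(opalg A, opalg B)) aone = aone.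
Proof. exact: (alghom1 f). Qed.
Fact alghom_opM (f : alghom A B) :
  {morph ((f : 'Hom(A, B)) : 'Hom(opalg A, opalg B)) : x y / x ⋅ y}.
Proof. by move=> x y; exact: (alghomM f y x). Qed.
Definition alghom_op (f : alghom A B) : alghom (opalg A) (opalg B) :=
  AlgHom (alghom_op1 f) (@alghom_opM f).

Let inr (b : B) : tens A B := aone ⊗ b.
Fact tens_inr_linear : linear inr. Proof. exact: (tpure_bilin A B).2. Qed.
HB.instance Definition _ := GRing.isLinear.Build K B (tens A B) _ inr tens_inr_linear.
Fact tens_inr1 : linfun inr aone = aone. Proof. by rewrite lfunE. Qed.
Fact tens_inrM : {morph linfun inr : x y / x ⋅ y}.
Proof. by move=> x y; rewrite !lfunE /= [RHS]tens_mul_pure amul1l. Qed.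
Definition tens_inr : alghom B (tens A B) := AlgHom tens_inr1 tens_inrM.
End AlgHoms.

Section QuasiHereditary.

Definition jacobson (A : fdAlgType K) (r : A) : Prop :=
  forall (S : fdMod A) (v : S), simple_mod S -> mact r v = 0.

Definition ideal_prod (A : fdAlgType K) (I J : {vspace A}) : {vspace A} :=
  <<[seq x ⋅ y | x <- vbasis I, y <- vbasis J]>>%VS.

Definition heredity_ideal (A : fdAlgType K) (J : {vspace A}) : Prop :=
  [/\ forall a x, x \in J -> a ⋅ x \in J /\ x ⋅ a \in J,
      ideal_prod J J = J,
      forall x r y, x \in J -> jacobson r -> y \in J -> x ⋅ r ⋅ y = 0 &
      exists (P : fdMod A) (i : 'Hom(P, regmod A)),
        [/\ projective P, modhom i, lker i = 0%VS & limg i = J]].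

(* A' is the quotient algebra A / J. *)
Inductive quasi_hereditary : fdAlgType K -> Prop :=
| QH_zero (A : fdAlgType K) : ({:A} = 0)%VS -> quasi_hereditary A
| QH_step (A A' : fdAlgType K) (J : {vspace A}) (f : alghom A A') :
    heredity_ideal J -> limg f = fullv -> lker f = J ->
    quasi_hereditary A' -> quasi_hereditary A.

End QuasiHereditary.
End Modules.
Arguments regmod {K} A.
Section ZSpan.
Variables (F : zmodType) (R : F -> Prop).
(* The subgroup generated by R. *)
Definition zspan : {pred F} := [pred x | `[< forall S : zmodClosed F,
  (forall r, R r -> r \in (S : {pred F})) -> x \in (S : {pred F}) >]].
Fact zspan_closed : zmod_closed zspan.
Proof.
split; first by apply/asboolP => S _; exact: rpred0.
move=> x y /asboolP hx /asboolP hy; apply/asboolP => S hS.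
by rewrite rpredB ?hx ?hy.
Qed.
HB.instance Definition _ := GRing.isZmodClosed.Build F zspan zspan_closed.
Lemma mem_zspan r : R r -> r \in zspan.
Proof. by move=> Rr; apply/asboolP => S; apply. Qed.
End ZSpan.

Section Presented.
Variables (X : Type) (R : {freeg {classic X}} -> Prop).

Definition presented : zmodType := Quotient.quot (zspan R).
Definition pgen (x : X) : presented :=
  \pi_(Quotient.quot (zspan R))%qT << (x : {classic X}) >>.

Section Lift.
Variables (L : zmodType) (f : X -> L).
Definition free_lift (D : {freeg {classic X}}) : L :=
  fglift (f : {classic X} -> zmodule L) D.
Fact free_lift_additive : zmod_morphism free_lift.
Proof. move=> x y; exact: (lift_is_additive (f : {classic X} -> zmodule L) x y). Qed.
HB.instance Definition _ :=
  GRing.isZmodMorphism.Build _ _ free_lift free_lift_additive.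
Lemma free_lift_gen x : free_lift << x >> = f x.
Proof. by rewrite /free_lift liftU scalezrE. Qed.

Hypothesis fR : forall r, R r -> free_lift r = 0.
Definition presented_lift (x : presented) : L := free_lift (repr x).
Let kerP : {pred {freeg {classic X}}} := [pred D | free_lift D == 0].
Fact kerP_closed : zmod_closed kerP.
Proof.
split; first by rewrite inE raddf0.
by move=> x y; rewrite !inE raddfB /= => /eqP -> /eqP ->; rewrite subrr.
Qed.
HB.instance Definition _ := GRing.isZmodClosed.Build _ kerP kerP_closed.
Lemma presented_lift_pi D :
  presented_lift (\pi_(Quotient.quot (zspan R))%qT D) = free_lift D.
Proof.
apply/eqP; rewrite -subr_eq0 -raddfB.
have : (repr (\pi_(Quotient.quot (zspan R)) D) - D)%qT \in zspan R.
  by rewrite Quotient.idealrBE reprK.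
by move=> /asboolP /(_ kerP) h; apply: h => r Rr; rewrite inE fR.
Qed.
Fact presented_lift_additive : zmod_morphism presented_lift.
Proof.
move=> x y; rewrite -[x]reprK -[y]reprK -raddfB !presented_lift_pi.
by rewrite raddfB.
Qed.
Lemma presented_lift_gen x : presented_lift (pgen x) = f x.
Proof. by rewrite presented_lift_pi free_lift_gen. Qed.
End Lift.

End Presented.

Lemma presented_ext (X : Type) (R : {freeg {classic X}} -> Prop) (L : zmodType)
    (f g : presented R -> L) :
  zmod_morphism f -> zmod_morphism g -> (forall x, f (pgen R x) = g (pgen R x)) ->
  f =1 g.
Proof.
move=> fa ga fg t.
pose f' : {additive presented R -> L} :=
  HB.pack f (GRing.isZmodMorphism.Build _ _ f fa).
pose g' : {additive presented R -> L} :=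
  HB.pack g (GRing.isZmodMorphism.Build _ _ g ga).
rewrite -[f]/(f' : _ -> _) -[g]/(g' : _ -> _) -[t]reprK.
rewrite -(freeg_sumE (repr t)) !raddf_sum; apply: eq_bigr => x _.
rewrite -[coeff _ _]intz -freegU_mulz !raddfMz.
by congr (_ *~ _); exact: fg.
Qed.

Section ZTens.
Variables G H : zmodType.

Inductive ztens_rel : {freeg {classic (G * H)%type}} -> Prop :=
| ZTens_l x x' y : ztens_rel
    (<< ((x + x', y) : {classic _}) >> - << ((x, y) : {classic _}) >>
       - << ((x', y) : {classic _}) >>)
| ZTens_r x y y' : ztens_rel
    (<< ((x, y + y') : {classic _}) >> - << ((x, y) : {classic _}) >>
       - << ((x, y') : {classic _}) >>).

Definition ztens : zmodType := presented ztens_rel.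
Definition zpure (x : G) (y : H) : ztens := pgen ztens_rel (x, y).

Definition biadditive (L : zmodType) (b : G -> H -> L) : Prop :=
  (forall y, {morph b^~ y : x x' / x + x'}) /\
  (forall x, {morph b x : y y' / y + y'}).

Lemma zpure_biadditive : biadditive zpure.
Proof.
split=> [y x x'|x y y'].
- have /mem_zspan := ZTens_l x x' y.
  rewrite -addrA -opprD Quotient.idealrBE => /eqP.
  by rewrite raddfD.
- have /mem_zspan := ZTens_r x y y'.
  rewrite -addrA -opprD Quotient.idealrBE => /eqP.
  by rewrite raddfD.
Qed.

Section Lift.
Variables (L : zmodType) (b : G -> H -> L) (bb : biadditive b).
Fact ztens_lift_rel r : ztens_rel r -> free_lift (fun p => b p.1 p.2) r = 0.
Proof.
by case=> *; rewrite !raddfB /= !free_lift_gen /= ?bb.1 ?bb.2 addrAC addrK subrr.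
Qed.
Let lift_fun : ztens -> L := @presented_lift _ ztens_rel L (fun p => b p.1 p.2).
Definition ztens_lift : {additive ztens -> L} :=
  HB.pack lift_fun (GRing.isZmodMorphism.Build _ _ lift_fun
    (presented_lift_additive ztens_lift_rel)).
Lemma ztens_lift_pure x y : ztens_lift (zpure x y) = b x y.
Proof. exact: (presented_lift_gen ztens_lift_rel). Qed.
End Lift.

Lemma ztens_ext (L : zmodType) (f g : {additive ztens -> L}) :
  (forall x y, f (zpure x y) = g (zpure x y)) -> f =1 g.
Proof.
move=> fg; apply: presented_ext; [exact: raddfB | exact: raddfB |].
by case=> x y; exact: fg.
Qed.
End ZTens.

Notation "x ⊠ y" := (zpure x y) (at level 40, left associativity) : ring_scope.

Section ZTensMap.
Variables (G G' H H' : zmodType) (f : {additive G -> G'}) (g : {additive H -> H'}).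
Fact ztens_map_subproof : biadditive (fun x y => f x ⊠ g y).
Proof.
by split=> [y x x'|x y y']; rewrite raddfD ?(zpure_biadditive _ _).1
  ?(zpure_biadditive _ _).2.
Qed.
Definition ztens_map : {additive ztens G H -> ztens G' H'} :=
  ztens_lift ztens_map_subproof.
End ZTensMap.

Section ZTensAssoc.
Variables G H L : zmodType.
Let bR (z : L) : biadditive (fun (x : G) (y : H) => x ⊠ (y ⊠ z)).
Proof.
by split=> [y x x'|x y y']; rewrite ?(zpure_biadditive _ _).1 //
  (zpure_biadditive _ _).2.
Qed.
Fact ztens_assoc_subproof : biadditive (fun t z => ztens_lift (bR z) t).
Proof.
split=> [z t t'|t z z']; first by rewrite raddfD.
pose h : {additive ztens G H -> ztens G (ztens H L)} :=
  (ztens_lift (bR z) \+ ztens_lift (bR z'))%R.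
rewrite -[RHS]/(h t); apply: ztens_ext => x y.
rewrite -[RHS]/(ztens_lift (bR z) (x ⊠ y) + ztens_lift (bR z') (x ⊠ y)).
by rewrite !ztens_lift_pure !(zpure_biadditive _ _).2.
Qed.
Definition ztens_assoc : {additive ztens (ztens G H) L -> ztens G (ztens H L)} :=
  ztens_lift ztens_assoc_subproof.
End ZTensAssoc.

Section ZTensUnit.
Variable G : zmodType.
Fact ztens_unitl_subproof : biadditive (fun (a : int) (x : G) => x *~ a).
Proof. by split=> [x a b|a x y]; rewrite ?mulrzDr ?mulrzDl. Qed.
Fact ztens_unitr_subproof : biadditive (fun (x : G) (a : int) => x *~ a).
Proof. by split=> [a x y|x a b]; rewrite ?mulrzDr ?mulrzDl. Qed.
Definition ztens_unitl : {additive ztens int G -> G} :=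
  ztens_lift ztens_unitl_subproof.
Definition ztens_unitr : {additive ztens G int -> G} :=
  ztens_lift ztens_unitr_subproof.
End ZTensUnit.

Section ZAlgebra.
Variable G : zmodType.

Record is_zalgebra (m : {additive ztens G G -> G}) (u : {additive int -> G}) : Prop := {
  zalg_assoc : forall t : ztens (ztens G G) G,
    m (ztens_map m idfun t) = m (ztens_map idfun m (ztens_assoc _ _ _ t));
  zalg_unitl : forall t : ztens int G, m (ztens_map u idfun t) = ztens_unitl G t;
  zalg_unitr : forall t : ztens G int, m (ztens_map idfun u t) = ztens_unitr G t
}.

Record is_zcoalgebra (d : {additive G -> ztens G G}) (e : {additive G -> int}) : Prop := {
  zcoalg_assoc : forall x,
    ztens_assoc _ _ _ (ztens_map d idfun (d x)) = ztens_map idfun d (d x);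
  zcoalg_unitl : forall x, ztens_unitl G (ztens_map e idfun (d x)) = x;
  zcoalg_unitr : forall x, ztens_unitr G (ztens_map idfun e (d x)) = x
}.
End ZAlgebra.

Section DirectSum.
Variable G : nat -> zmodType.

Record dsum := DSum {
  dsum_fun :> forall n, G n;
  dsum_fin : exists N, forall n, (N <= n)%N -> dsum_fun n = 0
}.

Lemma dsumP (x y : dsum) : (forall n, x n = y n) -> x = y.
Proof.
case: x y => [x hx] [y hy] /= exy.
have e : x = y by apply: functional_extensionality_dep.
by case: _ / e hy => hy; congr DSum; exact: Prop_irrelevance.
Qed.

HB.instance Definition _ := gen_eqMixin dsum.
HB.instance Definition _ := gen_choiceMixin dsum.

Fact dsum0_subproof : exists N, forall n, (N <= n)%N -> (0 : G n) = 0.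
Proof. by exists 0%N. Qed.
Fact dsumN_subproof (x : dsum) : exists N, forall n, (N <= n)%N -> - x n = 0.
Proof. by case: (dsum_fin x) => N hN; exists N => n /hN ->; rewrite oppr0. Qed.
Fact dsumD_subproof (x y : dsum) :
  exists N, forall n, (N <= n)%N -> x n + y n = 0.
Proof.
case: (dsum_fin x) (dsum_fin y) => [N hN] [N' hN']; exists (maxn N N') => n.
by rewrite geq_max => /andP[/hN -> /hN' ->]; rewrite addr0.
Qed.
Let dsum0 : dsum := DSum dsum0_subproof.
Let dsumN (x : dsum) : dsum := DSum (dsumN_subproof x).
Let dsumD (x y : dsum) : dsum := DSum (dsumD_subproof x y).
Fact dsumDA : associative dsumD. Proof. by move=> x y z; apply: dsumP => n /=; rewrite addrA. Qed.
Fact dsumDC : commutative dsumD. Proof. by move=> x y; apply: dsumP => n /=; rewrite addrC. Qed.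
Fact dsum0D : left_id dsum0 dsumD. Proof. by move=> x; apply: dsumP => n /=; rewrite add0r. Qed.
Fact dsumND : left_inverse dsum0 dsumN dsumD.
Proof. by move=> x; apply: dsumP => n /=; rewrite addNr. Qed.
HB.instance Definition _ := GRing.isZmodule.Build dsum dsumDA dsumDC dsum0D dsumND.

Fact dsum_in_subproof n (x : G n) :
  exists N, forall k, (N <= k)%N -> dfwith (fun k => 0 : G k) x k = 0.
Proof.
exists n.+1 => k nk; rewrite dfwith_out //.
by apply/eqP => e; rewrite e ltnn in nk.
Qed.
Let in_fun n (x : G n) : dsum := DSum (dsum_in_subproof x).
Fact dsum_in_additive n : zmod_morphism (@in_fun n).
Proof.
move=> x y; apply: dsumP => k.
rewrite -[RHS]/(in_fun x k - in_fun y k) /=.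
have [<-|nk] := eqVneq n k; first by rewrite !dfwith_in.
by rewrite !dfwith_out // subr0.
Qed.
Definition dsum_in n : {additive G n -> dsum} :=
  HB.pack (@in_fun n) (GRing.isZmodMorphism.Build _ _ _ (@dsum_in_additive n)).
End DirectSum.
Arguments dsum_in G n : clear implicits.

(* The modules over A with carrier some 'rV[K]_d: a small skeleton of the
   category of finite-dimensional A-modules, which itself is too large to be the
   carrier of a [zmodType]. *)
Record rowMod (K : fieldType) (A : fdAlgType K) := RowMod {
  row_dim : nat;
  row_act : A -> 'rV[K]_row_dim -> 'rV[K]_row_dim;
  row_act_bilin : bilin row_act;
  row_actM : forall a b v, row_act (a ⋅ b) v = row_act a (row_act b v);
  row_act1 : forall v, row_act aone v = v
}.

Section Grothendieck.
Variables (K : fieldType) (A : fdAlgType K).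

Definition mod_of_row (M : rowMod A) : fdMod A :=
  @FdMod K A 'rV[K]_(row_dim M) (@row_act _ _ M) (row_act_bilin M)
    (@row_actM _ _ M) (@row_act1 _ _ M).

Section RowOfMod.
Variable M : fdMod A.
Let d := \dim {:M}.
Let row_of (v : M) : 'rV[K]_d := \row_i coord (vbasis {:M}) i v.
Let of_row (x : 'rV[K]_d) : M := \sum_i x 0 i *: (vbasis {:M})`_i.
Let ract (a : A) (x : 'rV[K]_d) := row_of (mact a (of_row x)).
Fact row_of_linear : linear row_of.
Proof. by move=> c x y; apply/rowP => i; rewrite !mxE linearP. Qed.
HB.instance Definition _ := GRing.isLinear.Build K M 'rV[K]_d _ row_of row_of_linear.
Let of_row_linear : linear of_row.
Proof.
move=> c x y; rewrite /of_row scaler_sumr -big_split /=.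
by apply: eq_bigr => i _; rewrite !mxE scalerDl scalerA.
Qed.
Let row_ofK v : of_row (row_of v) = v.
Proof.
rewrite [RHS](coord_vbasis (memvf v)).
by apply: eq_bigr => i _; rewrite mxE.
Qed.
Let of_rowK x : row_of (of_row x) = x.
Proof.
by apply/rowP => i; rewrite mxE coord_sum_free // (basis_free (vbasisP _)).
Qed.
Fact row_of_mod_bilin : bilin ract.
Proof.
split=> [x|a] c y z; rewrite /ract.
  by rewrite (mact_bilin M).1 row_of_linear.
by rewrite of_row_linear (mact_bilin M).2 row_of_linear.
Qed.
Fact row_of_modM a b x : ract (a ⋅ b) x = ract a (ract b x).
Proof. by rewrite /ract row_ofK mactM. Qed.
Fact row_of_mod1 x : ract aone x = x.
Proof. by rewrite /ract mact1 of_rowK. Qed.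
Definition row_of_mod : rowMod A := RowMod row_of_mod_bilin row_of_modM row_of_mod1.

Lemma row_of_mod_iso :
  exists f : 'Hom(M, mod_of_row row_of_mod), modhom f /\ bijective f.
Proof.
exists (linfun row_of); split.
  by move=> a v; rewrite !lfunE /= /ract row_ofK.
by exists of_row => x; rewrite lfunE; [exact: row_ofK | exact: of_rowK].
Qed.
End RowOfMod.

Inductive G0_rel : {freeg {classic (rowMod A)}} -> Prop :=
| G0_exact (L M N : rowMod A) :
    short_exact (mod_of_row L) (mod_of_row M) (mod_of_row N) ->
    G0_rel (<< (M : {classic _}) >> - << (L : {classic _}) >>
              - << (N : {classic _}) >>).

Definition G0 : zmodType := presented G0_rel.
Definition G0_class (M : fdMod A) : G0 := pgen G0_rel (row_of_mod M).
End Grothendieck.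


(* Morphisms are composed from left to right. *)
Record klincat (K : fieldType) (Ob : Type) := KLinCat {
  hom : Ob -> Ob -> vectType K;
  idc : forall n, hom n n;
  comp : forall p m n, hom p m -> hom m n -> hom p n;
  comp_bilin : forall p m n, bilin (@comp p m n);
  compA : forall p q m n (a : hom p q) (b : hom q m) (c : hom m n),
    comp a (comp b c) = comp (comp a b) c;
  comp1l : forall m n (a : hom m n), comp (idc m) a = a;
  comp1r : forall m n (a : hom m n), comp a (idc n) = a
}.
Arguments hom {K Ob} C m n : rename.
Arguments idc {K Ob} C n : rename.
Arguments comp {K Ob} C {p m n} a b : rename.

Definition endalg (K : fieldType) (Ob : Type) (C : klincat K Ob) (n : Ob) : Type :=
  hom C n n.
HB.instance Definition _ (K : fieldType) (Ob : Type) (C : klincat K Ob) (n : Ob) :=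
  Vector.on (endalg C n).
HB.instance Definition _ (K : fieldType) (Ob : Type) (C : klincat K Ob) (n : Ob) :=
  isFdAlg.Build K (endalg C n) (@comp_bilin K Ob C n n n) (@compA K Ob C n n n n)
    (@comp1l K Ob C n n) (@comp1r K Ob C n n).

Definition in_span (K : fieldType) (V : vectType K) (P : V -> Prop) (v : V) : Prop :=
  exists2 s : seq V, (forall x, x \in s -> P x) & v \in <<s>>%VS.

Record cell_datum (K : fieldType) (Ob : Type) (C : klincat K Ob) := CellDatum {
  star : forall m n, 'Hom(hom C m n, hom C n m);
  star_id : forall n, star n n (idc C n) = idc C n;
  star_comp : forall p m n (a : hom C p m) (b : hom C m n),
    star p n (comp C a b) = comp C (star m n b) (star p m a);
  starK : forall m n (a : hom C m n), star n m (star m n a) = a;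
  cell_disp : Order.disp_t;
  Lam : porderType cell_disp;
  tab : Ob -> Lam -> finType;
  cbas : forall m n (lam : Lam), tab m lam -> tab n lam -> hom C m n;
  cell_inj : forall m n,
    injective (fun u : {lam : Lam & (tab m lam * tab n lam)%type} =>
                 cbas (tagged u).1 (tagged u).2);
  cell_basis : forall m n, exists2 X : seq (hom C m n),
    basis_of fullv X &
    forall x, x \in X <-> exists lam (S : tab m lam) (T : tab n lam), x = cbas S T;
  cell_star : forall m n (lam : Lam) (S : tab m lam) (T : tab n lam),
    star m n (cbas S T) = cbas T S;
  cell_r : forall p m (lam : Lam), hom C p m -> tab p lam -> tab m lam -> K;
  cell_mul : forall p m n (lam : Lam) (a : hom C p m)
      (S : tab m lam) (T : tab n lam),
    in_span (fun x : hom C p n => exists mu (S' : tab p mu) (T' : tab n mu),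
               (mu < lam)%O /\ x = cbas S' T')
      (comp C a (cbas S T) - \sum_(S' : tab p lam) cell_r a S' S *: cbas S' T)
}.
Arguments star {K Ob C} D {m n} : rename.
Arguments Lam {K Ob C} D : rename.
Arguments tab {K Ob C} D n lam : rename.
Arguments cbas {K Ob C} D {m n lam} S T : rename.
Arguments cell_mul {K Ob C} D {p m n lam} a S T : rename.
Arguments cell_r {K Ob C} D {p m lam} a S' S : rename.

Section CellModule.
Variables (K : fieldType) (Ob : Type) (C : klincat K Ob) (D : cell_datum C).

(* The span A(< lam) in Hom(p, n). *)
Definition lower_span p n (lam : Lam D) : hom C p n -> Prop :=
  in_span (fun x : hom C p n => exists mu (S' : tab D p mu) (T' : tab D n mu),
               (mu < lam)%O /\ x = cbas D S' T').

Lemma in_span0 (V : vectType K) (P : V -> Prop) : in_span P 0.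
Proof. by exists [::] => //; exact: mem0v. Qed.

Lemma in_span_lin (V : vectType K) (P : V -> Prop) c x y :
  in_span P x -> in_span P y -> in_span P (c *: x + y).
Proof.
case=> s sP xs [t tP yt]; exists (s ++ t).
  by move=> z; rewrite mem_cat => /orP[/sP|/tP].
by rewrite span_cat memv_add ?memvZ.
Qed.

Lemma in_span_map (V W : vectType K) (P : V -> Prop) (Q : W -> Prop) (f : V -> W) :
  linear f -> (forall x, P x -> in_span Q (f x)) ->
  forall x, in_span P x -> in_span Q (f x).
Proof.
move=> fl fP x [s sP].
have f0 : f 0 = 0.
  by have := fl (-1) 0 0; rewrite scaler0 addr0 scaleN1r addNr.
elim: s sP x => [|y s IHs] sP x.
  by rewrite span_nil memv0 => /eqP ->; rewrite f0; exact: in_span0.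
rewrite span_cons => /memv_addP[u /vlineP[c ->] [v vs ->]].
rewrite fl; apply: in_span_lin; first by apply/fP/sP; rewrite mem_head.
by apply: IHs => // z zs; apply: sP; rewrite in_cons zs orbT.
Qed.

Lemma lower_span_mul p m n (lam : Lam D) (a : hom C p m) x :
  @lower_span m n lam x -> @lower_span p n lam (comp C a x).
Proof.
apply: in_span_map => [c y z|_ [mu [S [T [mulam ->]]]]].
  by rewrite (comp_bilin C _ _ _).2.
rewrite -[comp _ _ _](subrK (\sum_(S' : tab D p mu) cell_r D a S' S *: cbas D S' T)).
rewrite -[X in in_span _ (X + _)]scale1r; apply: in_span_lin.
  apply: (in_span_map (f := idfun)) (cell_mul D a S T) => // _ [nu [S' [T' [numu ->]]]].
  exists [:: cbas D S' T'] => [z|]; last by rewrite span_seq1 memv_line.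
  rewrite inE => /eqP ->; exists nu, S', T'; split=> //.
  exact: Order.POrderTheory.lt_trans numu mulam.
elim/big_ind: _ => [|x1 x2 h1 h2|S' _]; first exact: in_span0.
  by rewrite -[x1]scale1r; exact: in_span_lin.
exists [:: cbas D S' T] => [z|]; last by rewrite span_seq1 memvZ ?memv_line.
by rewrite inE => /eqP ->; exists mu, S', T.
Qed.

(* Coefficients at the layer lam are determined modulo A(< lam). *)
Lemma lower_span_free p n (lam : Lam D) (c : tab D p lam -> K) (T : tab D n lam) :
  lower_span lam (\sum_(S : tab D p lam) c S *: cbas D S T) -> forall S, c S = 0.
Proof.
move=> low S0; case: (cell_basis D p n) => X bX XP.
have X0 : cbas D S0 T \in X by apply/XP; exists lam, S0, T.
pose i0 : 'I_(size X) := Ordinal (etrans (index_mem _ _) X0).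
pose X' := in_tuple X.
have phiX x : x \in X -> coord X' i0 x = (x == cbas D S0 T)%:R.
  move=> xX; rewrite -[in LHS](nth_index 0 xX) -{1}[X]/(tval X').
  rewrite (coord_free (Ordinal (etrans (index_mem _ _) xX)) i0) ?(basis_free bX) //.
  congr (_%:R); congr (nat_of_bool _).
  apply/eqP/eqP => [/(congr1 val) /= e|e]; last by apply: val_inj; rewrite /= e.
  by rewrite -(nth_index 0 xX) e nth_index.
have lphi : coord X' i0 (\sum_S c S *: cbas D S T) = 0.
  case: low => s sP; elim: s sP (\sum_S _) => [|y s IHs] sP v.
    by rewrite span_nil memv0 => /eqP ->; rewrite linear0.
  rewrite span_cons => /memv_addP[u /vlineP[d ->] [w ws ->]].
  rewrite linearP /= (IHs _ w) //; last by move=> z zs; apply: sP; rewrite in_cons zs orbT.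
  case: (sP y (mem_head _ _)) => mu [S' [T' [mulam ey]]].
  rewrite phiX; last by apply/XP; rewrite ey; exists mu, S', T'.
  rewrite ey; case: eqP => [e|_]; last by rewrite /= mulr0n addr0 ?scaler0 ?mulr0.
  have /(congr1 (@tag _ _)) /= emu := @cell_inj _ _ _ D p n
    (Tagged (fun lam => tab D p lam * tab D n lam)%type (S', T'))
    (Tagged (fun lam => tab D p lam * tab D n lam)%type (S0, T)) e.
  by move: mulam; rewrite emu Order.POrderTheory.ltxx.
rewrite -lphi linear_sum (bigD1 S0) //= linearZ /= phiX // eqxx.
rewrite [X in _ + X]big1 ?addr0 => [|S nS]; first by rewrite /GRing.scale /= mulr1.
rewrite linearZ /= phiX; last by apply/XP; exists lam, S, T.
case: eqP => [e|_]; last by rewrite /= mulr0n ?scaler0 ?mulr0.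
have := @cell_inj _ _ _ D p n
    (Tagged (fun lam => tab D p lam * tab D n lam)%type (S, T))
    (Tagged (fun lam => tab D p lam * tab D n lam)%type (S0, T)) e.
move/eqP; rewrite -tag_eqE /tag_eq eqxx /= tagged_asE => /eqP [eS].
by rewrite eS eqxx in nS.
Qed.

Lemma lower_span_sum p n lam (I : finType) (F : I -> hom C p n) :
  (forall i, lower_span lam (F i)) -> lower_span lam (\sum_i F i).
Proof.
move=> hF; elim/big_ind: _ => [|x y hx hy|i _]; [exact: in_span0| |exact: hF].
by rewrite -[x]scale1r; exact: in_span_lin.
Qed.

Lemma cell_r_uniq p m n (lam : Lam D) (a : hom C p m) (S : tab D m lam)
    (T : tab D n lam) (c : tab D p lam -> K) :
  lower_span lam (comp C a (cbas D S T) - \sum_S' c S' *: cbas D S' T) ->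
  forall S', c S' = cell_r D a S' S.
Proof.
move=> hc S'; apply/eqP; rewrite -subr_eq0; apply/eqP.
pose d S' := c S' - cell_r D a S' S; rewrite -[LHS]/(d S'); move: S'.
apply: (lower_span_free (T := T)).
have := in_span_lin (-1) hc (cell_mul D a S T).
rewrite scaleN1r opprB addrA subrK.
rewrite -sumrB -/(lower_span _ _); congr (lower_span _ _).
by apply: eq_bigr => S' _; rewrite scalerBl.
Qed.

Fact cell_r_linear m (lam : Lam D) (Y X : tab D m lam) :
  linear (fun a : endalg C m => cell_r D a Y X : K^o).
Proof.
move=> c a b; symmetry; move: Y.
apply: (cell_r_uniq (T := X)).
have := in_span_lin c (cell_mul D a X X) (cell_mul D b X X).
rewrite -/(lower_span _ _); congr (lower_span _ _).
rewrite (comp_bilin C _ _ _).1 scalerBr addrACA -opprD; congr (_ - _).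
rewrite scaler_sumr -big_split /=; apply: eq_bigr => S' _.
by rewrite scalerDl scalerA.
Qed.

Fact cell_r_comp m (lam : Lam D) (a b : endalg C m) (Y X : tab D m lam) :
  cell_r D (a ⋅ b) Y X = \sum_Z cell_r D a Y Z * cell_r D b Z X.
Proof.
symmetry; move: Y; apply: (cell_r_uniq (T := X)).
pose lowb := lower_span_mul a (cell_mul D b X X).
pose lowa := lower_span_sum (fun Z => in_span_lin (cell_r D b Z X)
  (cell_mul D a Z X) (in_span0 _)).
have := in_span_lin 1 lowb lowa.
rewrite -/(lower_span _ _); congr (lower_span _ _).
have cr : linear (comp C a) := (comp_bilin C _ _ _).2 a.
pose ca : {linear hom C m m -> hom C m m} :=
  HB.pack (comp C a : hom C m m -> hom C m m) (GRing.isLinear.Build K _ _ _ _ (cr m)).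
rewrite scale1r -[comp C a (_ - _)]/(ca _) raddfB /= -[comp C a (\sum_ _ _)]/(ca _).
rewrite raddf_sum compA -addrA; congr (_ + _).
rewrite addrC -sumrB /=.
have -> : \sum_Y (\sum_Z cell_r D a Y Z * cell_r D b Z X) *: cbas D Y X =
    \sum_Z cell_r D b Z X *: \sum_Y cell_r D a Y Z *: cbas D Y X.
  under eq_bigr do rewrite scaler_suml.
  rewrite exchange_big; apply: eq_bigr => Z _; rewrite scaler_sumr.
  by apply: eq_bigr => Y _; rewrite scalerA mulrC.
rewrite -sumrN; apply: eq_bigr => Z _; rewrite addr0.
rewrite -[X in _ - X]/(ca (_ *: _)) linearZ /=.
by rewrite scalerBr addrAC subrr add0r.
Qed.

Fact cell_r_id m (lam : Lam D) (Y X : tab D m lam) :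
  cell_r D (idc C m) Y X = (Y == X)%:R.
Proof.
symmetry; move: Y; apply: (cell_r_uniq (T := X)).
rewrite comp1l (bigD1 X) //= eqxx scale1r big1 ?addr0 ?subrr.
  exact: in_span0.
by move=> Y /negPf ->; rewrite scale0r.
Qed.

Definition cell_car (m : Ob) (lam : Lam D) : vectType K :=
  {ffun tab D m lam -> K^o}.

Definition cell_act m lam (a : endalg C m) (f : cell_car m lam) : cell_car m lam :=
  [ffun Y => \sum_X cell_r D a Y X * f X].

Fact cell_act_bilin m lam : bilin (@cell_act m lam).
Proof.
split=> [f|a] c x y; apply/ffunP => Y; rewrite !ffunE.
  rewrite scaler_sumr -big_split /=; apply: eq_bigr => X _.
  by rewrite cell_r_linear mulrDl /GRing.scale /= mulrA.
rewrite scaler_sumr -big_split /=; apply: eq_bigr => X _.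
by rewrite !ffunE mulrDr /GRing.scale /= mulrCA.
Qed.

Fact cell_actM m lam (a b : endalg C m) (f : cell_car m lam) :
  cell_act (a ⋅ b) f = cell_act a (cell_act b f).
Proof.
apply/ffunP => Y; rewrite !ffunE.
under eq_bigr do rewrite cell_r_comp mulr_suml.
rewrite exchange_big; apply: eq_bigr => Z _; rewrite ffunE mulr_sumr.
by apply: eq_bigr => X _; rewrite mulrA.
Qed.

Fact cell_act1 m lam (f : cell_car m lam) : cell_act aone f = f.
Proof.
apply/ffunP => Y; rewrite ffunE (bigD1 Y) //= cell_r_id eqxx mul1r.
by rewrite big1 ?addr0 // => X nX; rewrite cell_r_id eq_sym (negPf nX) mul0r.
Qed.

(* The cell module Delta_m(lam); the basis vector C_X is the indicator function
   of X. *)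
Definition cellmod (m : Ob) (lam : Lam D) : fdMod (endalg C m) :=
  FdMod (@cell_act_bilin m lam) (@cell_actM m lam) (@cell_act1 m lam).

(* [cell_filtered M s]: M has a Delta_n-filtration whose successive quotients,
   from top to bottom, are the cell modules with labels s. *)
Inductive cell_filtered (n : Ob) : fdMod (endalg C n) -> seq (Lam D) -> Prop :=
| Cell_filtered0 (M : fdMod (endalg C n)) : ({:M} = 0)%VS -> cell_filtered M [::]
| Cell_filteredS (L M : fdMod (endalg C n)) lam s : (0 < #|tab D n lam|)%N ->
    cell_filtered L s -> short_exact L M (cellmod n lam) ->
    cell_filtered M (lam :: s).

Definition has_cell_filtration n (M : fdMod (endalg C n)) : Prop :=
  exists s, cell_filtered M s.
Definition cell_supp n (M : fdMod (endalg C n)) (lam : Lam D) : Prop :=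
  exists2 s, cell_filtered M s & lam \in s.

End CellModule.
Arguments cellmod {K Ob C} D m lam.

Section Towers.
Variables (K : fieldType) (C : klincat K nat).
Notation A := (endalg C).

Section Labels.
Variable D : cell_datum C.

(* Lambda_k, which is empty for k < 0. *)
Definition Lam_at (k : int) : {pred Lam D} :=
  [pred lam | if k is Posz n then (0 < #|tab D n lam|)%N else false].
(* Lambda_k \ Lambda_(k-2) *)
Definition Lam_new (k : int) : {pred Lam D} :=
  [pred lam | (lam \in Lam_at k) && (lam \notin Lam_at (k - 2))].

Definition hereditary : Prop :=
  (forall m n : nat, (m <= n)%N -> ({:hom C m n} <> 0)%VS ->
     {subset Lam_at m <= Lam_at n} /\
     forall lam mu, (lam < mu)%O -> mu \in Lam_at m -> lam \in Lam_at n ->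
       lam \in Lam_at m) /\
  (forall n, quasi_hereditary (A n)).
End Labels.

Definition end_cast (m n : nat) (e : m = n) (a : A m) : A n := ecast k (A k) e a.

Record ext_mul := ExtMul {
  rho :> forall m n, alghom (tens (A m) (A n)) (A (m + n)%N);
  rho_inj : forall m n, injective (rho m n);
  rho_assoc : forall l m n (a : A l) (b : A m) (c : A n),
    rho (l + m)%N n (rho l m (a ⊗ b) ⊗ c) =
      end_cast (addnA l m n) (rho l (m + n)%N (a ⊗ rho m n (b ⊗ c)))
}.

Section Embedding.
Variable R : ext_mul.

(* rho_(k,l) with values in A_n, for k + l = n *)
Definition rho_at k l n (e : (k + l = n)%N) : alghom (tens (A k) (A l)) (A n) :=
  ecast n (alghom (tens (A k) (A l)) (A n)) e (R k l).

Definition emb n : alghom (A n) (A n.+1) :=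
  alghom_comp (R 1%N n) (tens_inr (A 1%N) (A n)).

Definition Res n (M : fdMod (A n.+1)) : fdMod (A n) := resmod (emb n) M.
Definition Ind n (M : fdMod (A n)) : fdMod (A n.+1) := indmod (emb n) M.
End Embedding.
End Towers.
Arguments Lam_at {K C} D k.
Arguments Lam_new {K C} D k.

Record tensor_tower (K : fieldType) := TensorTower {
  tw_cat :> klincat K nat;
  tw_cell : cell_datum tw_cat;
  tw_hereditary : hereditary tw_cell;
  tw_iso0 : alghom (endalg tw_cat 0%N) K^o;
  tw_iso0_bij : bijective tw_iso0;
  tw_iso1 : exists f : alghom (endalg tw_cat 1%N) K^o, bijective f;
  tw_rho : ext_mul tw_cat;
  (* Hom(n, n-2) and A_(n-1) as A_(n-1)-A_(n-2)-bimodules, with n = k + 2 *)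
  tw_A2 : forall k : nat,
    exists2 f : 'Hom(hom tw_cat k.+2 k, hom tw_cat k.+1 k.+1), bijective f &
      forall (a : endalg tw_cat k.+1) (x : hom tw_cat k.+2 k)
             (b : endalg tw_cat k),
        f (comp tw_cat (comp tw_cat (emb tw_rho k.+1 a) x) b) =
          comp tw_cat (comp tw_cat a (f x)) (emb tw_rho k b);
  (* restriction from A_n to A_(n-1), with n = k + 1 *)
  tw_A3 : forall (m k : nat) (lam : Lam tw_cell),
    (m <= k.+1)%N -> ~~ odd (k.+1 - m) -> lam \in Lam_new tw_cell m ->
    has_cell_filtration tw_cell (Res tw_rho (cellmod tw_cell k.+1 lam)) /\
    forall nu, cell_supp (Res tw_rho (cellmod tw_cell k.+1 lam)) nu ->
      (nu \in Lam_new tw_cell (m%:Z - 1) \/ nu \in Lam_new tw_cell (m%:Z + 1)) /\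
      nu \in Lam_at tw_cell k;
  (* induction from A_(n-1) to A_n, with n = k + 1 *)
  tw_A4 : forall (k : nat) (lam : Lam tw_cell), lam \in Lam_new tw_cell k.+1 ->
    exists2 mu, mu \in Lam_new tw_cell k &
      cell_supp (Ind tw_rho (cellmod tw_cell k mu)) lam
}.

Section Structure.
Variables (K : fieldType) (T : tensor_tower K).
Notation A := (endalg T).

Definition two_sided_projective (m n : nat) : Prop :=
  projective (resmod (tw_rho T m n) (regmod (A (m + n)%N))) /\
  projective (resmod (alghom_op (tw_rho T m n)) (regmod (opalg (A (m + n)%N)))).

Definition G0tower : zmodType := dsum (fun n => G0 (A n)).
Definition G0_in n : {additive G0 (A n) -> G0tower} := dsum_in (fun n => G0 (A n)) n.

Definition unit_class : G0 (A 0%N) := G0_class (resmod (tw_iso0 T) (regmod K^o)).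

Record structure_maps := StructureMaps {
  (* the identification of G0(A_k) (x) G0(A_l) with G0(A_k (x) A_l) *)
  G0_tens : forall k l,
    {additive ztens (G0 (A k)) (G0 (A l)) -> G0 (tens (A k) (A l))};
  G0_tensE : forall k l (M : fdMod (A k)) (N : fdMod (A l)),
    G0_tens k l (G0_class M ⊠ G0_class N) = G0_class (tensmod M N);
  G0_tens_bij : forall k l, bijective (G0_tens k l);

  G0_ind : forall m n,
    {additive ztens (G0 (A m)) (G0 (A n)) -> G0 (A (m + n)%N)};
  G0_indE : forall m n (M : fdMod (A m)) (N : fdMod (A n)),
    G0_ind m n (G0_class M ⊠ G0_class N) =
      G0_class (indmod (tw_rho T m n) (tensmod M N));

  G0_res : forall k l n, (k + l = n)%N ->
    {additive G0 (A n) -> ztens (G0 (A k)) (G0 (A l))};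
  G0_resE : forall k l n (e : (k + l = n)%N) (N : fdMod (A n)),
    G0_tens k l (G0_res e (G0_class N)) = G0_class (resmod (rho_at (tw_rho T) e) N);

  G0_mul : {additive ztens G0tower G0tower -> G0tower};
  G0_mulE : forall k l (x : G0 (A k)) (y : G0 (A l)),
    G0_mul (G0_in k x ⊠ G0_in l y) = G0_in (k + l)%N (G0_ind k l (x ⊠ y));

  G0_comul : {additive G0tower -> ztens G0tower G0tower};
  G0_comulE : forall n (x : G0 (A n)),
    G0_comul (G0_in n x) =
      \sum_(k < n.+1) ztens_map (G0_in k) (G0_in (n - k)%N)
                        (G0_res (subnKC (leq_ord k)) x);

  G0_unit : {additive int -> G0tower};
  G0_unitE : forall a : int, G0_unit a = G0_in 0%N (unit_class *~ a);

  G0_counit : {additive G0tower -> int};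
  G0_counitE : forall a : int, G0_counit (G0_in 0%N (unit_class *~ a)) = a;
  G0_counit0 : forall n (x : G0 (A n)), (0 < n)%N -> G0_counit (G0_in n x) = 0
}.
End Structure.

(* Main.v *)
(* All the structure maps are determined by classes of modules, so each law
   reduces to an isomorphism of modules, or to an equality of restriction
   functors.  Associativity holds since both iterated inductions represent the
   same balanced trilinear maps; the unit law since rho_{0,n}(1 (x) -) is an
   injective endomorphism which associativity of rho makes idempotent, hence the
   identity.

   What makes the maps exist is that induction is exact (A_{m+n} is projective
   on the right) and that G0(A) (x) G0(B) -> G0(A (x) B) is bijective.  The
   latter needs every simple module L of A = A_n to be absolutely simple, which
   is where cellularity enters: if lam is minimal with C^lam_{S,T} nonzero on L,
   then C^lam_{S,T} acts on L with rank one.  Given such rank one elements, an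
   A (x) B-module M contains L (x) B x for a simple A-submodule L and x in L,
   whence surjectivity by induction on dim M; and for pairwise nonisomorphic
   simple modules L_i, idempotents e_i of A with e_i L_j = 0 for j <> i and
   dim e_i L_i = 1 give exact functors M |-> e_i M recovering the coefficients
   y_i of sum_i [L_i] (x) y_i, whence injectivity.

   The coalgebra laws are then checked after applying these bijections. *)

From HB Require Import structures.
From mathcomp Require Import all_boot all_order all_algebra.
From mathcomp Require Import boolp.
From mathcomp.multinomials Require Import freeg.
Require Import Defs.

Set Implicit Arguments.
Unset Strict Implicit.
Unset Printing Implicit Defensive.

Import GRing.Theory.
Local Open Scope ring_scope.

(** * Modules and additive functions on short exact sequences *)

(** Three obstacles shape the argument. The groups are presented by modules on row spaces, with
    short exact sequences as the only relations; that isomorphic modules have equal classes is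
    derived, from sequences whose left term is zero. Next, M |-> eM is exact because e is idempotent
    in the algebra, while the cellular basis only yields elements that act as a projection on one
    simple module. Multiplying by elements that kill the other simple modules, and then passing to
    the Fitting idempotent, turns the latter into the former. Finally, A_{(l+m)+n} and A_{l+(m+n)},
    or A_{n+0} and A_n, are different types. Casts along equalities of indices are therefore carried
    explicitly; they disappear by eliminating the equality or by the uniqueness of equality proofs
    in [nat]. For the same reason restrictions and summands of the comultiplication are indexed by
    arbitrary proofs of k + l = n, so that two ways of splitting n can be compared. *)

Section LinearMaps.
Variable K : fieldType.

Definition lin_hom (U V : vectType K) (f : U -> V) (fl : linear f) : 'Hom(U, V) :=
  linfun (HB.pack f (GRing.isLinear.Build K U V _ f fl) : {linear U -> V}).

Lemma lin_homE (U V : vectType K) (f : U -> V) (fl : linear f) : lin_hom fl =1 f.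
Proof. by move=> u; rewrite lfunE. Qed.

Lemma lfun_linear (U V : vectType K) (f : 'Hom(U, V)) : linear f.
Proof. by move=> c x y; rewrite linearP. Qed.

Lemma fullv_eq0 (V : vectType K) : (forall v : V, v = 0) -> ({:V} = 0)%VS.
Proof.
move=> V0; apply/eqP; rewrite eqEsubv sub0v andbT; apply/subvP => v _.
by rewrite (V0 v) mem0v.
Qed.

Section RawLinear.
Variables (U V : lmodType K) (f : U -> V) (fl : linear f).
(** Many maps below are bare functions with a proof of [linear f]; these rules rewrite with such a
    proof directly. *)
Lemma lin0 : f 0 = 0.
Proof. by have := fl (-1) 0 0; rewrite scaler0 addr0 scaleN1r addNr. Qed.
Lemma linD x y : f (x + y) = f x + f y.
Proof. by rewrite -[x in LHS]scale1r fl scale1r. Qed.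
Lemma linZ c x : f (c *: x) = c *: f x.
Proof. by rewrite -[_ *: x]addr0 fl lin0 addr0. Qed.
Lemma linB x y : f (x - y) = f x - f y.
Proof. by rewrite linD -scaleN1r linZ scaleN1r. Qed.
Lemma linear_cst0 : linear (fun _ : U => 0 : V).
Proof. by move=> c x y; rewrite scaler0 addr0. Qed.
End RawLinear.

(** Linear in the tensor whatever [f] and [g] are; their own linearity enters in [tmap_pure]. Bare
    functions are accepted so that [idfun] and partial actions can be used as factors. *)
Definition tmap (U V U' V' : vectType K) (f : U -> U') (g : V -> V') :
  tens U V -> tens U' V' := tlift (fun u v => f u ⊗ g v).

Fact tmap_linear (U V U' V' : vectType K) (f : U -> U') (g : V -> V') :
  linear (tmap f g).
Proof. by move=> c x y; rewrite /tmap linearP. Qed.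
HB.instance Definition _ U V U' V' f g :=
  GRing.isLinear.Build K _ _ _ (@tmap U V U' V' f g) (@tmap_linear U V U' V' f g).

Lemma tmap_pure (U V U' V' : vectType K) (f : U -> U') (g : V -> V') u v :
  linear f -> linear g -> tmap f g (u ⊗ v) = f u ⊗ g v.
Proof.
move=> fl gl; rewrite /tmap tlift_pure //; split=> w c x y.
  by rewrite fl (tpure_bilin _ _).1.
by rewrite gl (tpure_bilin _ _).2.
Qed.

Section ModuleMaps.
Variable A : fdAlgType K.
Implicit Types L M N : fdMod A.

Lemma mact_linl M v : linear (fun a : A => mact a v : M).
Proof. exact: (mact_bilin M).1. Qed.
Lemma mact_linr M (a : A) : linear (mact a : M -> M).
Proof. exact: (mact_bilin M).2. Qed.
HB.instance Definition _ M (a : A) := GRing.isLinear.Build K M M _ (@mact K A M a) (@mact_linr M a).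

Lemma short_exact_intro L M N (f : L -> M) (g : M -> N) :
  linear f -> linear g ->
  (forall a v, f (mact a v) = mact a (f v)) ->
  (forall a v, g (mact a v) = mact a (g v)) ->
  injective f -> (forall v, g (f v) = 0) ->
  (forall v, g v = 0 -> exists u, v = f u) -> (forall w, exists v, w = g v) ->
  short_exact L M N.
Proof.
move=> fl gl fh gh fi gf ex gs; exists (lin_hom fl), (lin_hom gl); split.
- by move=> a v; rewrite !lin_homE.
- by move=> a v; rewrite !lin_homE.
split.
- by apply/eqP/lker0P => u v; rewrite !lin_homE => /fi.
- apply/eqP; rewrite eqEsubv; apply/andP; split; apply/subvP => v.
    by case/memv_imgP => u _ ->; rewrite memv_ker !lin_homE gf.
  rewrite memv_ker lin_homE => /eqP /ex [u ->].
  by rewrite -(lin_homE fl) memv_img ?memvf.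
- apply/eqP; rewrite eqEsubv subvf; apply/subvP => w _.
  by case: (gs w) => v ->; rewrite -(lin_homE gl) memv_img ?memvf.
Qed.

Lemma short_exact_elim L M N : short_exact L M N ->
  exists (f : 'Hom(L, M)) (g : 'Hom(M, N)),
    [/\ modhom f, modhom g, injective f &
     [/\ forall v, g (f v) = 0, forall v, g v = 0 -> exists u, v = f u &
         forall w, exists v, w = g v]].
Proof.
case=> f [g [fh gh [kf ifg ig]]]; exists f, g; split=> //.
  by apply/lker0P; rewrite kf.
split.
- by move=> v; apply/eqP; rewrite -memv_ker -ifg memv_img ?memvf.
- move=> v gv0; have : v \in lker g by rewrite memv_ker gv0.
  by rewrite -ifg => /memv_imgP [u _ ->]; exists u.
- move=> w; have : w \in limg g by rewrite ig memvf.
  by case/memv_imgP => v _ ->; exists v.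
Qed.

Definition modiso M N : Prop := exists f : 'Hom(M, N), modhom f /\ bijective f.

Lemma modiso_intro M N (f : M -> N) : linear f ->
  (forall a v, f (mact a v) = mact a (f v)) -> injective f ->
  (forall w, exists v, w = f v) -> modiso M N.
Proof.
move=> fl fh fi fs; exists (lin_hom fl); split.
  by move=> a v; rewrite !lin_homE.
pose g w := sval (cid (fs w)).
exists g => v; rewrite lin_homE; last by rewrite -(svalP (cid (fs v))).
by apply: fi; rewrite -(svalP (cid (fs (f v)))).
Qed.

(** Turns an isomorphism into a short exact sequence, the only form of relation that [G0] knows. *)
Lemma short_exact_iso L M N : ({:L} = 0)%VS -> modiso M N -> short_exact L M N.
Proof.
move=> L0 [g [gh gb]]; pose f : L -> M := fun=> 0.
have z (u : L) : u = 0 by apply/eqP; rewrite -memv0 -L0 memvf.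
apply: (@short_exact_intro _ _ _ f g).
- by move=> c x y; rewrite /f scaler0 addr0.
- by move=> c x y; rewrite linearP.
- by move=> a v; rewrite /f linear0.
- exact: gh.
- by move=> x y _; rewrite (z x) (z y).
- by move=> v; rewrite linear0.
- move=> v gv; exists 0; apply: (bij_inj gb); by rewrite linear0.
- by case: gb => h _ hK w; exists (h w); rewrite hK.
Qed.

Section Sub.
Variables (M : fdMod A) (U : {vspace M}) (hU : submod U).
Let sact (a : A) (x : subvs_of U) : subvs_of U := vsproj U (mact a (vsval x)).
Lemma sub_actE a x : vsval (sact a x) = mact a (vsval x).
Proof. by rewrite vsprojK // hU ?subvsP. Qed.
Fact sub_act_bilin : bilin sact.
Proof.
split=> [x|a] c y z; apply: val_inj; rewrite /= !sub_actE.
  by rewrite mact_linl.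
by rewrite !linearP.
Qed.
Fact sub_actM a b x : sact (a ⋅ b) x = sact a (sact b x).
Proof. by apply: val_inj; rewrite /= !sub_actE mactM. Qed.
Fact sub_act1 x : sact aone x = x.
Proof. by apply: val_inj; rewrite /= !sub_actE mact1. Qed.
Definition submodule : fdMod A := FdMod sub_act_bilin sub_actM sub_act1.

Let qact (a : A) (x : quotv U) : quotv U := quotv_pi U (mact a (vsval x)).
Lemma quot_actE a v : qact a (quotv_pi U v) = quotv_pi U (mact a v).
Proof.
apply/eqP; rewrite -subr_eq0 -linearB -memv_ker lker_quotv_pi.
rewrite -(linearB (mact a)) hU // -opprB memvN; exact: quotv_decomp.
Qed.
Fact quot_act_bilin : bilin qact.
Proof.
split=> [x|a] c y z; rewrite /qact; first by rewrite mact_linl linearP.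
by rewrite !linearP.
Qed.
Fact quot_actM a b x : qact (a ⋅ b) x = qact a (qact b x).
Proof. by rewrite [qact b x]/qact quot_actE /qact mactM. Qed.
Fact quot_act1 x : qact aone x = x.
Proof. by rewrite /qact mact1 quotv_piK. Qed.
Definition quotmodule : fdMod A := FdMod quot_act_bilin quot_actM quot_act1.

Lemma short_exact_sub : short_exact submodule M quotmodule.
Proof.
apply: (@short_exact_intro submodule M quotmodule vsval (quotv_pi U)).
- by move=> c x y; rewrite linearP.
- by move=> c x y; rewrite linearP.
- by move=> a v; rewrite [LHS]sub_actE.
- by move=> a v; rewrite [RHS]quot_actE.
- exact: val_inj.
- by move=> v; apply/eqP; rewrite -memv_ker lker_quotv_pi subvsP.
- move=> v /eqP; rewrite -memv_ker lker_quotv_pi => vU.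
  by exists (vsproj U v); rewrite vsprojK.
- by move=> w; exists (vsval w); rewrite quotv_piK.
Qed.
End Sub.

(** The zero submodule supplies a zero module over [A] wherever a zero left term of a sequence is
    wanted. *)
Lemma submod0 M : submod (0%VS : {vspace M}).
Proof. by move=> a v; rewrite !memv0 => /eqP ->; rewrite linear0. Qed.

Lemma submodule0 M (x : submodule (@submod0 M)) : x = 0.
Proof.
have := subvsP x; rewrite memv0 => /eqP x0; apply: val_inj.
exact: etrans x0 (esym (linear0 _)).
Qed.

Definition exact_additive (Z : zmodType) (F : fdMod A -> Z) : Prop :=
  forall L M N, short_exact L M N -> F M = F L + F N.

Section ExactAdditive.
Variables (Z : zmodType) (F : fdMod A -> Z) (Fx : exact_additive F).

(** For zero [L] the sequence L, L, L is exact, so F L = F L + F L. *)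
Lemma exact_additive0 L : ({:L} = 0)%VS -> F L = 0.
Proof.
move=> L0; have /Fx /eqP : short_exact L L L.
  apply: short_exact_iso L0 _; exists (\1%VF); split.
    by move=> a v; rewrite !lfunE.
  by exists (\1%VF : 'End(L)) => v; rewrite !lfunE /= ?lfunE.
by rewrite -subr_eq0 opprD addNKr oppr_eq0 => /eqP.
Qed.

Lemma exact_additive_iso M N : modiso M N -> F M = F N.
Proof.
have L0 : ({:submodule (@submod0 M)} = 0)%VS.
  by apply: fullv_eq0; exact: submodule0.
by move=> i; rewrite (Fx (short_exact_iso L0 i)) (exact_additive0 L0) add0r.
Qed.

Let Frow (M : rowMod A) : Z := F (mod_of_row M).
Fact G0_lift_rel r : G0_rel r -> free_lift Frow r = 0.
Proof.
case=> L M N /Fx e; rewrite !raddfB /= !free_lift_gen /Frow e.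
by rewrite addrAC addrK subrr.
Qed.
(** The universal property of [G0 A]. Here [F] is sampled on row modules; [G0_liftE] recovers its
    value on all modules by isomorphism invariance. *)
Definition G0_lift : {additive G0 A -> Z} :=
  HB.pack (presented_lift Frow : G0 A -> Z) (GRing.isZmodMorphism.Build _ _ _
    (presented_lift_additive G0_lift_rel)).
Lemma G0_liftE M : G0_lift (G0_class M) = F M.
Proof.
rewrite [LHS](presented_lift_gen G0_lift_rel) /Frow; symmetry.
exact/exact_additive_iso/row_of_mod_iso.
Qed.
End ExactAdditive.

End ModuleMaps.
End LinearMaps.

(** * Grothendieck groups *)

Section GrothendieckGroups.
Variable K : fieldType.

Section OneAlgebra.
Variable A : fdAlgType K.
Implicit Types L M N : fdMod A.

Lemma modiso_refl M : modiso M M.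
Proof.
apply: (modiso_intro (f := idfun)) => //; last by move=> w; exists w.
Qed.

Lemma modiso_sym M N : modiso M N -> modiso N M.
Proof.
case=> f [fh [g fK gK]]; apply: (modiso_intro (f := g)).
- by move=> c x y; apply: (can_inj fK); rewrite lfun_linear !gK.
- by move=> a v; apply: (can_inj fK); rewrite fh !gK.
- exact: can_inj gK.
- by move=> w; exists (f w); rewrite fK.
Qed.

(** Carries a sequence of arbitrary modules to the row modules where the relations of [G0] are
    stated. *)
Lemma short_exact_transport L M N L' M' N' :
  modiso L L' -> modiso M M' -> modiso N N' ->
  short_exact L M N -> short_exact L' M' N'.
Proof.
move=> /modiso_sym [i [ih [i' iK i'K]]] [j [jh [j' jK j'K]]] [k [kh [k' kK k'K]]].
case/short_exact_elim => f [g [fh gh fi [gf ex gs]]].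
have j'l : linear j' by move=> c x y; apply: (can_inj jK); rewrite lfun_linear !j'K.
have j'h a v : j' (mact a v) = mact a (j' v) by apply: (can_inj jK); rewrite jh !j'K.
apply: (short_exact_intro (f := j \o f \o i) (g := k \o g \o j')).
- by move=> c x y /=; rewrite !lfun_linear.
- by move=> c x y /=; rewrite j'l !lfun_linear.
- by move=> a v /=; rewrite ih fh jh.
- by move=> a v /=; rewrite j'h gh kh.
- by apply: inj_comp (can_inj iK); apply: inj_comp fi; exact: can_inj jK.
- by move=> v /=; rewrite jK gf linear0.
- move=> v /= kv; have [|u eu] := ex (j' v).
    by apply: (can_inj kK); rewrite linear0.
  by exists (i' u); rewrite /= i'K -eu j'K.
- move=> w; have [v ev] := gs (k' w); exists (j v); rewrite /= jK.
  by rewrite -ev k'K.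
Qed.

Lemma G0_class_exact : exact_additive (@G0_class K A).
Proof.
move=> L M N /(short_exact_transport (row_of_mod_iso L) (row_of_mod_iso M)
  (row_of_mod_iso N)) => e; have /mem_zspan := G0_exact e.
rewrite -addrA -opprD Quotient.idealrBE => /eqP; by rewrite raddfD.
Qed.

Lemma G0_class_iso M N : modiso M N -> G0_class M = G0_class N.
Proof. exact: exact_additive_iso (@G0_class_exact) M N. Qed.

Lemma G0_class0 L : ({:L} = 0)%VS -> G0_class L = 0.
Proof. exact: exact_additive0 (@G0_class_exact) L. Qed.

(** [M] and [row_of_mod (mod_of_row M)] are isomorphic but distinct row modules. A sequence with
    zero left term [Z] identifies their generators once the sequence Z, Z, Z has shown the generator
    at [Z] to vanish. *)
Lemma pgen_row (M : rowMod A) : pgen (@G0_rel K A) M = G0_class (mod_of_row M).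
Proof.
pose Z := row_of_mod (submodule (@submod0 K A (mod_of_row M))).
have Z0 : ({:mod_of_row Z} = 0)%VS.
  case: (row_of_mod_iso (submodule (@submod0 K A (mod_of_row M)))) => f [_ [g _ gK]].
  by apply: fullv_eq0 => v; rewrite -(gK v) (submodule0 (g v)) linear0.
have H : pgen (@G0_rel K A) Z = 0.
  have /mem_zspan := G0_exact (short_exact_iso Z0 (modiso_refl (mod_of_row Z))).
  rewrite addrAC subrr add0r => h.
  by apply/eqP; rewrite -[X in _ == X](raddf0 (\pi_(G0 A)%qT)) eq_sym -Quotient.idealrBE sub0r.
have /mem_zspan := G0_exact (short_exact_iso Z0 (row_of_mod_iso (mod_of_row M))).
rewrite -addrA -opprD Quotient.idealrBE => /eqP.
rewrite raddfD => e; apply: (etrans e).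
by rewrite -[RHS]add0r; congr (_ + _); exact: H.
Qed.

Lemma presented_induction (X : Type) (R : {freeg {classic X}} -> Prop)
    (P : presented R -> Prop) :
  P 0 -> (forall x y, P x -> P y -> P (x - y)) -> (forall x, P (pgen R x)) ->
  forall t, P t.
Proof.
move=> P0 PB Pg t.
have PN x : P x -> P (- x) by move=> /(PB _ _ P0); rewrite sub0r.
have PD x y : P x -> P y -> P (x + y) by move=> Px /PN /(PB _ _ Px); rewrite opprK.
rewrite -[t]reprK -(freeg_sumE (repr t)) raddf_sum.
elim/big_ind: _ => // x _.
rewrite -[coeff _ _]intz -freegU_mulz raddfMz.
have Pn n : P (pgen R x *+ n) by elim: n => [|n IH]; rewrite ?mulr0n // mulrS; apply: PD.
by case: (coeff _ _) => n; [exact: Pn | rewrite NegzE mulrNz; exact/PN/Pn].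
Qed.

Lemma G0_induction (P : G0 A -> Prop) :
  P 0 -> (forall x y, P x -> P y -> P (x - y)) -> (forall M, P (G0_class M)) ->
  forall t, P t.
Proof.
by move=> P0 PB Pc; apply: presented_induction => // M; rewrite pgen_row.
Qed.

Lemma G0_ext (Z : zmodType) (f g : {additive G0 A -> Z}) :
  (forall M, f (G0_class M) = g (G0_class M)) -> f =1 g.
Proof.
move=> fg; apply: G0_induction => [|x y ex ey|//]; first by rewrite !raddf0.
by rewrite !raddfB ex ey.
Qed.
End OneAlgebra.

Lemma ztens_induction (G H : zmodType) (P : ztens G H -> Prop) :
  P 0 -> (forall x y, P x -> P y -> P (x - y)) -> (forall x y, P (x ⊠ y)) ->
  forall t, P t.
Proof. by move=> P0 PB Pp; apply: presented_induction => // -[x y]; exact: Pp. Qed.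

Section Biadditive.
Variables (G H : zmodType).
Lemma zpureDl (x x' : G) (y : H) : (x + x') ⊠ y = x ⊠ y + x' ⊠ y.
Proof. exact: (zpure_biadditive G H).1. Qed.
Lemma zpureDr (x : G) (y y' : H) : x ⊠ (y + y') = x ⊠ y + x ⊠ y'.
Proof. exact: (zpure_biadditive G H).2. Qed.
Fact zpurel_additive (y : H) : zmod_morphism (fun x : G => x ⊠ y).
Proof. by move=> x x'; apply: (addIr (x' ⊠ y)); rewrite -zpureDl !subrK. Qed.
Fact zpurer_additive (x : G) : zmod_morphism (fun y : H => x ⊠ y).
Proof. by move=> y y'; apply: (addIr (x ⊠ y')); rewrite -zpureDr !subrK. Qed.
Definition zpurel (y : H) : {additive G -> ztens G H} :=
  HB.pack (fun x : G => x ⊠ y) (GRing.isZmodMorphism.Build _ _ _ (zpurel_additive y)).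
Definition zpurer (x : G) : {additive H -> ztens G H} :=
  HB.pack (fun y : H => x ⊠ y) (GRing.isZmodMorphism.Build _ _ _ (zpurer_additive x)).

Lemma zpure0l y : (0 : G) ⊠ (y : H) = 0. Proof. exact: (raddf0 (zpurel y)). Qed.
Lemma zpure0r x : (x : G) ⊠ (0 : H) = 0. Proof. exact: (raddf0 (zpurer x)). Qed.
Lemma zpureNr (x : G) (y : H) : x ⊠ (- y) = - (x ⊠ y).
Proof. exact: (raddfN (zpurer x)). Qed.
Lemma zpureBl (x x' : G) (y : H) : (x - x') ⊠ y = x ⊠ y - x' ⊠ y.
Proof. exact: zpurel_additive. Qed.
Lemma zpureBr (x : G) (y y' : H) : x ⊠ (y - y') = x ⊠ y - x ⊠ y'.
Proof. exact: zpurer_additive. Qed.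
Lemma zpure_sumr (I : finType) (x : G) (y : I -> H) :
  x ⊠ (\sum_i y i) = \sum_i x ⊠ y i.
Proof. exact: (raddf_sum (zpurer x)). Qed.
Lemma zpure_suml (I : finType) (x : I -> G) (y : H) :
  (\sum_i x i) ⊠ y = \sum_i x i ⊠ y.
Proof. exact: (raddf_sum (zpurel y)). Qed.
End Biadditive.
Arguments zpurel {G H} y.
Arguments zpurer {G H} x.

Lemma ztens_mapE (G G' H H' : zmodType) (f : {additive G -> G'})
  (g : {additive H -> H'}) x y : ztens_map f g (x ⊠ y) = f x ⊠ g y.
Proof. exact: ztens_lift_pure. Qed.

Lemma ztens_map_comp (G G' G'' H H' H'' : zmodType) (f : {additive G -> G'})
  (f' : {additive G' -> G''}) (g : {additive H -> H'}) (g' : {additive H' -> H''}) t :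
  ztens_map f' g' (ztens_map f g t) = ztens_map (f' \o f) (g' \o g) t.
Proof.
move: t; apply: ztens_induction => [|x y ex ey|x y]; first by rewrite !raddf0.
  by rewrite !raddfB ex ey.
by rewrite !ztens_mapE.
Qed.

Lemma ztens_map_ext (G G' H H' : zmodType) (f f' : {additive G -> G'})
  (g g' : {additive H -> H'}) : f =1 f' -> g =1 g' ->
  ztens_map f g =1 ztens_map f' g'.
Proof. by move=> ef eg; apply: ztens_ext => x y; rewrite !ztens_mapE ef eg. Qed.

Lemma ztens_map_id (G H : zmodType) t : ztens_map (@idfun G) (@idfun H) t = t.
Proof.
move: t; apply: ztens_induction => [|x y ex ey|x y]; first by rewrite raddf0.
  by rewrite raddfB ex ey.
by rewrite ztens_mapE.
Qed.

Lemma ztens_assocE (G H L : zmodType) (x : G) (y : H) (z : L) :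
  ztens_assoc G H L (x ⊠ y ⊠ z) = x ⊠ (y ⊠ z).
Proof. by rewrite /ztens_assoc !ztens_lift_pure. Qed.

Lemma ztens_map_sumr (G G' H H' : zmodType) (f : {additive G -> G'})
  (I : finType) (g : I -> {additive H -> H'}) (h : {additive H -> H'}) :
  (forall y, h y = \sum_i g i y) ->
  forall t, ztens_map f h t = \sum_i ztens_map f (g i) t.
Proof.
move=> hE; apply: ztens_induction => [|x y ex ey|x y].
- by rewrite raddf0 big1 // => i _; rewrite raddf0.
- by rewrite raddfB ex ey -sumrB; apply: eq_bigr => i _; rewrite raddfB.
- rewrite ztens_mapE hE zpure_sumr.
  by apply: eq_bigr => i _; rewrite ztens_mapE.
Qed.

Lemma ztens_map_suml (G G' H H' : zmodType) (g : {additive H -> H'})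
  (I : finType) (f : I -> {additive G -> G'}) (h : {additive G -> G'}) :
  (forall y, h y = \sum_i f i y) ->
  forall t, ztens_map h g t = \sum_i ztens_map (f i) g t.
Proof.
move=> hE; apply: ztens_induction => [|x y ex ey|x y].
- by rewrite raddf0 big1 // => i _; rewrite raddf0.
- by rewrite raddfB ex ey -sumrB; apply: eq_bigr => i _; rewrite raddfB.
- rewrite ztens_mapE hE zpure_suml.
  by apply: eq_bigr => i _; rewrite ztens_mapE.
Qed.

Section Lift2.
Variables (A B : fdAlgType K) (Z : zmodType) (F : fdMod A -> fdMod B -> Z).
Hypothesis FA : forall N, exact_additive (F^~ N).
Hypothesis FB : forall M, exact_additive (F M).
(** Lifting in the second variable first leaves a function of [M] that is again additive on exact
    sequences: this passes from classes to all [y] by induction, so the first variable can be lifted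
    too. *)
Fact lift2_exact (y : G0 B) : exact_additive (fun M => G0_lift (FB M) y).
Proof.
move=> L M N e; move: y; apply: G0_induction => [|x y ex ey|P].
- by rewrite !raddf0 addr0.
- by rewrite !raddfB ex ey opprD addrACA.
- by rewrite !G0_liftE; exact: FA e.
Qed.
Fact lift2_biadditive : biadditive (fun x y => G0_lift (lift2_exact y) x).
Proof.
split=> [y x x'|x y y']; first by rewrite raddfD.
move: x; apply: G0_induction => [|x x' ex ex'|M].
- by rewrite !raddf0 addr0.
- by rewrite !raddfB ex ex' opprD addrACA.
- by rewrite !G0_liftE raddfD.
Qed.
Definition G0_lift2 : {additive ztens (G0 A) (G0 B) -> Z} :=
  ztens_lift lift2_biadditive.
Lemma G0_lift2E M N : G0_lift2 (G0_class M ⊠ G0_class N) = F M N.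
Proof. by rewrite /G0_lift2 ztens_lift_pure !G0_liftE. Qed.
End Lift2.

Lemma G0_ztens_ext (A B : fdAlgType K) (Z : zmodType)
  (f g : {additive ztens (G0 A) (G0 B) -> Z}) :
  (forall M N, f (G0_class M ⊠ G0_class N) = g (G0_class M ⊠ G0_class N)) -> f =1 g.
Proof.
move=> fg; apply: ztens_ext => x y; move: x.
apply: G0_induction => [|x x' ex ex'|M].
- by rewrite zpure0l !raddf0.
- by rewrite zpureBl !raddfB ex ex'.
move: y; apply: G0_induction => [|x x' ex ex'|//].
- by rewrite zpure0r !raddf0.
- by rewrite zpureBr !raddfB ex ex'.
Qed.

End GrothendieckGroups.

(** * Exactness of tensor product, restriction and induction *)

Section ExactFunctors.
Variable K : fieldType.

Section TensorPure.
Variables U V : vectType K.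

Lemma tpureL (v : V) : linear (fun u : U => u ⊗ v).
Proof. exact: (tpure_bilin U V).1. Qed.
Lemma tpureR (u : U) : linear (fun v : V => u ⊗ v).
Proof. exact: (tpure_bilin U V).2. Qed.

Lemma tpureDl (u u' : U) (v : V) : (u + u') ⊗ v = u ⊗ v + u' ⊗ v.
Proof. exact: linD (tpureL v) _ _. Qed.
Lemma tpureDr (u : U) (v v' : V) : u ⊗ (v + v') = u ⊗ v + u ⊗ v'.
Proof. exact: linD (tpureR u) _ _. Qed.
Lemma tpure0l (v : V) : (0 : U) ⊗ v = 0. Proof. exact: lin0 (tpureL v). Qed.
Lemma tpure0r (u : U) : u ⊗ (0 : V) = 0. Proof. exact: lin0 (tpureR u). Qed.

End TensorPure.

Section TensorExact.
Variables U V W X : vectType K.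

(** Over a field [f] has a linear retraction, which survives tensoring. *)
Lemma tmap_inj_l (f : 'Hom(U, V)) : injective f -> injective (tmap (V := X) f idfun).
Proof.
move=> /lker0P kf; apply: (can_inj (g := tmap f^-1%VF idfun)) => t.
have : linear (fun t => tmap f^-1%VF idfun (tmap (V := X) f idfun t)).
  by move=> c x y; rewrite !tmap_linear.
move/tens_ext; apply => [c x y //|u v].
by rewrite !tmap_pure ?lker0_lfunK //; exact: lfun_linear.
Qed.

Lemma tmap_inj_r (f : 'Hom(U, V)) : injective f -> injective (tmap (U := X) idfun f).
Proof.
move=> /lker0P kf; apply: (can_inj (g := tmap idfun f^-1%VF)) => t.
have : linear (fun t => tmap idfun f^-1%VF (tmap (U := X) idfun f t)).
  by move=> c x y; rewrite !tmap_linear.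
move/tens_ext; apply => [c x y //|u v].
by rewrite !tmap_pure ?lker0_lfunK //; exact: lfun_linear.
Qed.

Variables (f : 'Hom(U, V)) (g : 'Hom(V, W)).
Hypotheses (gs : forall w, exists v, w = g v) (gf : forall u, g (f u) = 0)
  (ex : forall v, g v = 0 -> exists u, v = f u).

Let gi w : g (g^-1%VF w) = w.
Proof. by apply: limg_lfunVK; have [v ->] := gs w; rewrite memv_img ?memvf. Qed.

Let fi v : g v = 0 -> f (f^-1%VF v) = v.
Proof. by case/ex => u ->; apply: limg_lfunVK; rewrite memv_img ?memvf. Qed.

(** Together with the section [g^-1%VF] this splits V into the image of [f] and a copy of W.
    Tensoring the identity [rE] with [X] gives exactness in the middle. *)
Let r (v : V) : U := f^-1%VF (v - g^-1%VF (g v)).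
Let r_linear : linear r.
Proof. by move=> c x y; rewrite /r -lfun_linear scalerBr addrACA -opprD !lfun_linear. Qed.

Let rE v : v = f (r v) + g^-1%VF (g v).
Proof. by rewrite fi ?subrK // linearB /= gi subrr. Qed.

Lemma tmap_surj_l (t : tens W X) : exists s, t = tmap g idfun s.
Proof.
exists (tmap g^-1%VF idfun t); symmetry.
have : linear (fun t => tmap (V := X) g idfun (tmap g^-1%VF idfun t)).
  by move=> c x y; rewrite !tmap_linear.
move/tens_ext; apply => [c x y //|u v].
by rewrite !tmap_pure ?gi //; exact: lfun_linear.
Qed.

Lemma tmap_surj_r (t : tens X W) : exists s, t = tmap idfun g s.
Proof.
exists (tmap idfun g^-1%VF t); symmetry.
have : linear (fun t => tmap (U := X) idfun g (tmap idfun g^-1%VF t)).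
  by move=> c x y; rewrite !tmap_linear.
move/tens_ext; apply => [c x y //|u v].
by rewrite !tmap_pure ?gi //; exact: lfun_linear.
Qed.

Lemma tmap_exact_l (t : tens V X) :
  tmap g idfun t = 0 -> exists s, t = tmap f idfun s.
Proof.
move=> gt; exists (tmap r idfun t).
have {1}-> : t = tmap f idfun (tmap r idfun t) + tmap g^-1%VF idfun (tmap g idfun t).
  apply: (tens_ext (f := idfun) (g := fun t => tmap (V := X) f idfun (tmap r idfun t)
    + tmap g^-1%VF idfun (tmap g idfun t))) => // [c x y|u v].
    by rewrite !tmap_linear scalerDr addrACA.
  rewrite !tmap_pure //; try exact: lfun_linear.
  by rewrite -tpureDl -rE.
by rewrite gt linear0 addr0.
Qed.

Lemma tmap_exact_r (t : tens X V) :
  tmap idfun g t = 0 -> exists s, t = tmap idfun f s.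
Proof.
move=> gt; exists (tmap idfun r t).
have {1}-> : t = tmap idfun f (tmap idfun r t) + tmap idfun g^-1%VF (tmap idfun g t).
  apply: (tens_ext (f := idfun) (g := fun t => tmap (U := X) idfun f (tmap idfun r t)
    + tmap idfun g^-1%VF (tmap idfun g t))) => // [c x y|u v].
    by rewrite !tmap_linear scalerDr addrACA.
  rewrite !tmap_pure //; try exact: lfun_linear.
  by rewrite -tpureDr -rE.
by rewrite gt linear0 addr0.
Qed.

Lemma tmap_comp0_l (t : tens U X) : tmap g idfun (tmap f idfun t) = 0.
Proof.
have : linear (fun t => tmap (V := X) g idfun (tmap f idfun t)).
  by move=> c x y; rewrite !tmap_linear.
move/tens_ext; apply => [c x y|u v]; first by rewrite scaler0 addr0.
rewrite !tmap_pure ?gf //; try exact: lfun_linear.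
by rewrite tpure0l.
Qed.

Lemma tmap_comp0_r (t : tens X U) : tmap idfun g (tmap idfun f t) = 0.
Proof.
have : linear (fun t => tmap (U := X) idfun g (tmap idfun f t)).
  by move=> c x y; rewrite !tmap_linear.
move/tens_ext; apply => [c x y|u v]; first by rewrite scaler0 addr0.
rewrite !tmap_pure ?gf //; try exact: lfun_linear.
by rewrite tpure0r.
Qed.
End TensorExact.

Lemma modhom_pure (A B : fdAlgType K) (M : fdMod A) (N : fdMod B)
    (X : fdMod (tens A B)) (h : tens M N -> X) : linear h ->
  (forall a b m n, h (mact a m ⊗ mact b n) = mact (a ⊗ b) (h (m ⊗ n))) ->
  forall x (t : tensmod M N), h (mact x t) = mact x (h t).
Proof.
move=> hl hp x t.
have xl : linear (fun x => h (mact x t)) by move=> c y z; rewrite mact_linl hl.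
have xl' : linear (fun x => mact x (h t)) by move=> c y z; rewrite mact_linl.
apply: (tens_ext xl xl') => a b {x xl xl'}.
have tl : linear (fun t : tens M N => h (mact (a ⊗ b) (t : tensmod M N))).
  by move=> c y z; rewrite mact_linr hl.
have tl' : linear (fun t : tens M N => mact (a ⊗ b) (h t)).
  by move=> c y z; rewrite hl mact_linr.
apply: (tens_ext tl tl') => m n.
by rewrite -hp; congr h; exact: tens_act_pure.
Qed.

Lemma tensmod_exact_l (A B : fdAlgType K) (L M N : fdMod A) (X : fdMod B) :
  short_exact L M N -> short_exact (tensmod L X) (tensmod M X) (tensmod N X).
Proof.
case/short_exact_elim => f [g [fh gh fi [gf ex gs]]].
apply: (@short_exact_intro K _ (tensmod L X) (tensmod M X) (tensmod N X)
  (tmap f idfun) (tmap g idfun)).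
- exact: tmap_linear.
- exact: tmap_linear.
- apply: (modhom_pure (X := tensmod M X)) (tmap_linear _ _) _ => a b m n.
  rewrite !tmap_pure //; try exact: lfun_linear.
  by rewrite fh; symmetry; exact: tens_act_pure.
- apply: (modhom_pure (X := tensmod N X)) (tmap_linear _ _) _ => a b m n.
  rewrite !tmap_pure //; try exact: lfun_linear.
  by rewrite gh; symmetry; exact: tens_act_pure.
- exact: tmap_inj_l.
- exact: tmap_comp0_l.
- exact: tmap_exact_l.
- exact: tmap_surj_l.
Qed.

Lemma tensmod_exact_r (A B : fdAlgType K) (X : fdMod A) (L M N : fdMod B) :
  short_exact L M N -> short_exact (tensmod X L) (tensmod X M) (tensmod X N).
Proof.
case/short_exact_elim => f [g [fh gh fi [gf ex gs]]].
apply: (@short_exact_intro K _ (tensmod X L) (tensmod X M) (tensmod X N)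
  (tmap idfun f) (tmap idfun g)).
- exact: tmap_linear.
- exact: tmap_linear.
- apply: (modhom_pure (X := tensmod X M)) (tmap_linear _ _) _ => a b m n.
  rewrite !tmap_pure //; try exact: lfun_linear.
  by rewrite fh; symmetry; exact: tens_act_pure.
- apply: (modhom_pure (X := tensmod X N)) (tmap_linear _ _) _ => a b m n.
  rewrite !tmap_pure //; try exact: lfun_linear.
  by rewrite gh; symmetry; exact: tens_act_pure.
- exact: tmap_inj_r.
- exact: tmap_comp0_r.
- exact: tmap_exact_r.
- exact: tmap_surj_r.
Qed.

Section Restriction.
Variables (A B : fdAlgType K) (f : alghom B A).
Fact resmod_exact : exact_additive (fun M : fdMod A => G0_class (resmod f M)).
Proof.
move=> L M N /short_exact_elim [h [g [hh gh hi [gf ex gs]]]].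
apply: G0_class_exact.
apply: (@short_exact_intro K B (resmod f L) (resmod f M) (resmod f N) h g) => //;
  try exact: lfun_linear.
  by move=> a v; exact: hh.
by move=> a v; exact: gh.
Qed.
Definition G0_restr : {additive G0 A -> G0 B} := G0_lift resmod_exact.
Lemma G0_restrE M : G0_restr (G0_class M) = G0_class (resmod f M).
Proof. exact: G0_liftE. Qed.
End Restriction.

Section TensorClass.
Variables A B : fdAlgType K.
Fact tens_class_l (N : fdMod B) : exact_additive (fun M : fdMod A => G0_class (tensmod M N)).
Proof. by move=> L M P e; apply: G0_class_exact; exact: tensmod_exact_l. Qed.
Fact tens_class_r (M : fdMod A) : exact_additive (fun N : fdMod B => G0_class (tensmod M N)).
Proof. by move=> L N P e; apply: G0_class_exact; exact: tensmod_exact_r. Qed.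
Definition G0_prod : {additive ztens (G0 A) (G0 B) -> G0 (tens A B)} :=
  G0_lift2 tens_class_l tens_class_r.
Lemma G0_prodE M N : G0_prod (G0_class M ⊠ G0_class N) = G0_class (tensmod M N).
Proof. exact: G0_lift2E. Qed.
End TensorClass.

(** * Universal property and exactness of induction *)

Section Induction.
Variables (A B : fdAlgType K) (f : alghom B A).

Section Universal.
Variable M : fdMod B.

Definition ipure (a : A) (m : M) : indmod f M := quotv_pi (ind_relspace f M) (a ⊗ m).

Lemma ipure_bilin : bilin ipure.
Proof. by split=> w c x y; rewrite /ipure ?tpureL ?tpureR linearP. Qed.

Lemma ipure_bal a b m : ipure (a ⋅ f b) m = ipure a (mact b m).
Proof.
apply/eqP; rewrite -subr_eq0 -linearB -memv_ker lker_quotv_pi -ind_rel_pure.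
by rewrite -[ind_rel _ _]lfunE memv_img ?memvf.
Qed.

Lemma ipure_act a a' m : mact a (ipure a' m) = ipure (a ⋅ a') m.
Proof. by rewrite /ipure [LHS]ind_act_pi ind_lmul_pure. Qed.

Lemma ipure_gen a m : ipure a m = mact a (ipure aone m).
Proof. by rewrite ipure_act amul1r. Qed.

Lemma indmod_ext (V : lmodType K) (g h : indmod f M -> V) : linear g -> linear h ->
  (forall a m, g (ipure a m) = h (ipure a m)) -> g =1 h.
Proof.
move=> gl hl gh x; rewrite -[x]quotv_piK.
have gl' : linear (fun t => g (quotv_pi (ind_relspace f M) t)).
  by move=> c y z; rewrite linearP gl.
have hl' : linear (fun t => h (quotv_pi (ind_relspace f M) t)).
  by move=> c y z; rewrite linearP hl.
exact: (tens_ext gl' hl').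
Qed.

Variables (X : fdMod A) (h : M -> X).
(** The adjoint of [h] under Frobenius reciprocity, evaluated on the chosen representative in
    [A ⊗ M]; [indlift_pure] expresses independence of that choice. *)
Definition indlift (x : indmod f M) : X :=
  tlift (fun a m => mact a (h m)) (vsval (x : quotv (ind_relspace f M))).

Lemma indlift_linear : linear indlift.
Proof. by move=> c x y; rewrite /indlift !linearP. Qed.

Hypotheses (hl : linear h) (hh : forall b m, h (mact b m) = mact (f b) (h m)).

Let hb : bilin (fun a m => mact a (h m)).
Proof. by split=> w c x y; rewrite ?mact_linl // hl mact_linr. Qed.

Let indlift_rel t : t \in ind_relspace f M -> tlift (fun a m => mact a (h m)) t = 0.
Proof.
case/memv_imgP => z _ ->; rewrite lfunE /=.
have gl : linear (fun z => tlift (fun a m => mact a (h m)) (ind_rel f z)).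
  by move=> c x y; rewrite ind_rel_linear linearP.
apply: (tens_ext gl (@linear_cst0 K _ _)) => x m {z gl}.
have gl : linear (fun x => tlift (fun a m => mact a (h m)) (ind_rel f (x ⊗ m))).
  by move=> c y z; rewrite tpureL ind_rel_linear linearP.
apply: (tens_ext gl (@linear_cst0 K _ _)) => a b {x gl}.
by rewrite ind_rel_pure linearB /= !tlift_pure // mactM hh subrr.
Qed.

Lemma indlift_pure a m : indlift (ipure a m) = mact a (h m).
Proof.
have /indlift_rel := quotv_decomp (ind_relspace f M) (a ⊗ m).
by rewrite linearB /= tlift_pure // => /eqP; rewrite subr_eq0 => /eqP ->.
Qed.

Lemma indlift_hom a x : indlift (mact a x) = mact a (indlift x).
Proof.
have gl : linear (fun x => indlift (mact a x)).
  by move=> c y z; rewrite mact_linr indlift_linear.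
have gl' : linear (fun x => mact a (indlift x)).
  by move=> c y z; rewrite indlift_linear mact_linr.
apply: (indmod_ext gl gl') => a' m.
by rewrite ipure_act !indlift_pure mactM.
Qed.
End Universal.

(* The section of the multiplication map A (x) B -> A given by projectivity
   splits the quotient map A (x)_K M -> A (x)_B M naturally in M. *)
Section Exact.
Hypothesis fproj : projective (resmod (alghom_op f) (regmod (opalg A))).

Let rmul (b : opalg B) (t : tens A B) : tens A B := tmap idfun (amul^~ (b : B)) t.
Let rmulE (b : B) a b' : rmul b (a ⊗ b') = a ⊗ (b' ⋅ b).
Proof. by rewrite /rmul tmap_pure //; exact: amul_linl. Qed.
Fact rmul_bilin : bilin rmul.
Proof.
split=> [t|b]; last exact: tmap_linear.
by apply: tlift_param => u v c x y; rewrite amul_linr tpureR.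
Qed.
Fact rmulM (b b' : opalg B) t : rmul (b ⋅ b') t = rmul b (rmul b' t).
Proof.
have gl : linear (fun t => rmul b (rmul b' t)).
  by move=> c x y; rewrite !rmul_bilin.2.
by apply: (tens_ext (rmul_bilin.2 _) gl) => a b''; rewrite !rmulE amulA.
Qed.
Fact rmul1 t : rmul aone t = t.
Proof.
apply: (tens_ext (g := idfun) (rmul_bilin.2 _)) => // a b.
by rewrite rmulE amul1r.
Qed.
(** [A ⊗ B] as a right B-module through its second factor; left modules over [opalg B] encode right
    B-modules. *)
Let free : fdMod (opalg B) := FdMod rmul_bilin rmulM rmul1.
Let reg : fdMod (opalg B) := resmod (alghom_op f) (regmod (opalg A)).

Lemma proj_section : exists k : A -> tens A B, [/\ linear k,
   forall a b, k (a ⋅ f b) = tmap idfun (amul^~ b) (k a) &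
   forall a, tlift (fun a' b => a' ⋅ f b) (k a) = a].
Proof.
pose g0 : free -> reg := tlift (fun a' b => a' ⋅ f b).
have gb : bilin (fun a' b => a' ⋅ f b).
  by split=> w c x y; rewrite ?amul_linl // lfun_linear amul_linr.
have g0l : linear g0 by move=> c x y; rewrite /g0 linearP.
have gh : modhom (lin_hom g0l).
  move=> b t; rewrite !lin_homE.
  have l1 : linear (fun t : tens A B => g0 (mact b (t : free))).
    by move=> c x y; rewrite mact_linr g0l.
  have l2 : linear (fun t : tens A B => mact b (g0 t)).
    by move=> c x y; rewrite g0l mact_linr.
  apply: (tens_ext l1 l2) => a b'.
  rewrite [X in g0 X]rmulE /g0 !tlift_pure // alghomM amulA.
  by [].
have gs : limg (lin_hom g0l) = fullv.
  apply/eqP; rewrite eqEsubv subvf; apply/subvP => a _.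
  have -> : a = lin_hom g0l ((a : A) ⊗ aone).
    by rewrite lin_homE /g0 tlift_pure // alghom1 amul1r.
  by rewrite memv_img ?memvf.
have idh : modhom (\1%VF : 'Hom(reg, reg)) by move=> a v; rewrite !lfunE.
(* The identity of the projective right module A is lifted along the multiplication map from the
   free module. *)
have [k kh ke] := fproj gh idh gs.
exists k; split; first exact: lfun_linear.
- by move=> a b; have := kh b a.
- by move=> a; have := congr1 (fun h : 'Hom(reg, reg) => h a) ke;
    rewrite /= comp_lfunE lin_homE lfunE.
Qed.

Section Functor.
Variables (M N : fdMod B) (h : 'Hom(M, N)) (hh : modhom h).
Let h1 (m : M) : indmod f N := ipure aone (h m).
Let h1_linear : linear h1.
Proof. by move=> c x y; rewrite /h1 lfun_linear (ipure_bilin N).2. Qed.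
Let h1_hom b m : h1 (mact b m) = mact (f b) (h1 m).
Proof. by rewrite /h1 hh ipure_act -ipure_bal amul1l amul1r. Qed.
Definition imap : indmod f M -> indmod f N := indlift h1.
Lemma imap_linear : linear imap. Proof. exact: indlift_linear. Qed.
Lemma imap_hom a x : imap (mact a x) = mact a (imap x).
Proof. exact: indlift_hom. Qed.
Lemma imapE a m : imap (ipure a m) = ipure a (h m).
Proof. by rewrite /imap indlift_pure // /h1 -ipure_gen. Qed.
Lemma imap_pi t :
  imap (quotv_pi (ind_relspace f M) t) = quotv_pi (ind_relspace f N) (tmap idfun h t).
Proof.
have l1 : linear (fun t => imap (quotv_pi (ind_relspace f M) t)).
  by move=> c x y; rewrite lfun_linear imap_linear.
have l2 : linear (fun t => quotv_pi (ind_relspace f N) (tmap idfun h t)).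
  by move=> c x y; rewrite tmap_linear lfun_linear.
apply: (tens_ext l1 l2) => a m; rewrite imapE tmap_pure //; exact: lfun_linear.
Qed.
Lemma ind_rel_map z : ind_rel f (tmap idfun h z) = tmap idfun h (ind_rel f z).
Proof.
have l1 : linear (fun z => ind_rel f (tmap idfun h z)).
  by move=> c x y; rewrite tmap_linear ind_rel_linear.
have l2 : linear (fun z => tmap idfun h (ind_rel f z)).
  by move=> c x y; rewrite ind_rel_linear tmap_linear.
apply: (tens_ext l1 l2) => {l1 l2} x m; have hl := lfun_linear h.
have l1 : linear (fun x => ind_rel f (tmap idfun h (x ⊗ m))).
  by move=> c y y'; rewrite tpureL tmap_linear ind_rel_linear.
have l2 : linear (fun x => tmap idfun h (ind_rel f (x ⊗ m))).
  by move=> c y y'; rewrite tpureL ind_rel_linear tmap_linear.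
apply: (tens_ext l1 l2) => a b.
rewrite tmap_pure // !ind_rel_pure (linB (tmap_linear _ _)) !tmap_pure //.
by rewrite hh.
Qed.
End Functor.

Section Sec.
Variables (k : A -> tens A B) (kl : linear k)
  (kB : forall a b, k (a ⋅ f b) = tmap idfun (amul^~ b) (k a))
  (kK : forall a, tlift (fun a' b => a' ⋅ f b) (k a) = a).
Variable M : fdMod B.

Let act (t : tens A B) (m : M) : tens A M := tmap idfun (fun b => mact b m) t.
Let act_pure a b m : act (a ⊗ b) m = a ⊗ mact b m.
Proof. by rewrite /act tmap_pure //; exact: mact_linl. Qed.
Let act_bilin : bilin act.
Proof.
split=> [m|t]; first exact: tmap_linear.
by apply: tlift_param => u v c x y; rewrite mact_linr tpureR.
Qed.

Let s : tens A M -> tens A M := tlift (fun a m => act (k a) m).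
Let s_pure a m : s (a ⊗ m) = act (k a) m.
Proof.
by rewrite /s tlift_pure //; split=> w c x y; rewrite ?kl ?act_bilin.1 ?act_bilin.2.
Qed.
Let s_linear : linear s. Proof. by move=> c x y; rewrite /s linearP. Qed.

Let act_mul t b m : act (tmap idfun (amul^~ b) t) m = act t (mact b m).
Proof.
have l1 : linear (fun t => act (tmap idfun (amul^~ b) t) m).
  by move=> c x y; rewrite tmap_linear act_bilin.1.
apply: (tens_ext l1 (act_bilin.1 _)) => a b'.
by rewrite tmap_pure ?act_pure ?mactM //; exact: amul_linl.
Qed.

Let s_rel t : t \in ind_relspace f M -> s t = 0.
Proof.
case/memv_imgP => z _ ->; rewrite lfunE /=.
have gl : linear (fun z => s (ind_rel f z)).
  by move=> c x y; rewrite ind_rel_linear s_linear.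
apply: (tens_ext gl (@linear_cst0 K _ _)) => x m {z gl}.
have gl : linear (fun x => s (ind_rel f (x ⊗ m))).
  by move=> c y z; rewrite tpureL ind_rel_linear s_linear.
apply: (tens_ext gl (@linear_cst0 K _ _)) => a b {x gl}.
by rewrite ind_rel_pure (linB s_linear) !s_pure kB act_mul subrr.
Qed.

(** If [k a] is a sum of [a_i ⊗ b_i], the class of [a ⊗ m] goes to the sum of the
    [a_i ⊗ mact b_i m]. Right B-linearity of [k] makes this vanish on balancing relations. *)
Definition isec (x : indmod f M) : tens A M :=
  tlift (fun a m => tmap idfun (fun b => mact b m) (k a))
    (vsval (x : quotv (ind_relspace f M))).
Lemma isec_linear : linear isec.
Proof. by move=> c x y; rewrite /isec !linearP. Qed.
Lemma isecE a m : isec (ipure a m) = tmap idfun (fun b => mact b m) (k a).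
Proof.
have /s_rel := quotv_decomp (ind_relspace f M) (a ⊗ m).
by rewrite (linB s_linear) s_pure => /eqP; rewrite subr_eq0 eq_sym => /eqP e; exact: e.
Qed.
Lemma isecK x : quotv_pi (ind_relspace f M) (isec x) = x.
Proof.
have l1 : linear (fun x => quotv_pi (ind_relspace f M) (isec x) : indmod f M).
  by move=> c y z; rewrite isec_linear lfun_linear.
apply: (indmod_ext (h := idfun) l1) => // a m; rewrite isecE.
transitivity (ipure (tlift (fun a' b => a' ⋅ f b) (k a)) m); last by rewrite kK.
move: (k a) => t.
have l2 : linear (fun t => quotv_pi (ind_relspace f M) (tmap idfun (fun b => mact b m) t)).
  by move=> c y z; rewrite tmap_linear lfun_linear.
have l3 : linear (fun t => ipure (tlift (fun a' b => a' ⋅ f b) t) m).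
  by move=> c y z; rewrite tlift_linear (ipure_bilin M).1.
apply: (tens_ext l2 l3) => a' b.
rewrite tmap_pure //; last exact: mact_linl.
rewrite tlift_pure ?ipure_bal //.
by split=> w c y z; rewrite ?amul_linl // lfun_linear amul_linr.
Qed.
End Sec.

Lemma indmod_exact L M N : short_exact L M N ->
  short_exact (indmod f L) (indmod f M) (indmod f N).
Proof.
case/short_exact_elim => i [p [ih ph ii [pi ex ps]]].
have [k [kl kB kK]] := proj_section.
apply: (@short_exact_intro K A (indmod f L) (indmod f M) (indmod f N) (imap i) (imap p)).
- exact: imap_linear.
- exact: imap_linear.
- by move=> a v; rewrite imap_hom.
- by move=> a v; rewrite imap_hom.
(* Injectivity is where projectivity enters: by naturality of [isec], [imap i] is a restriction of
   [tmap idfun i], which is injective over the field. *)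
- move=> x y exy; rewrite -(isecK kl kB kK x) -(isecK kl kB kK y); congr (quotv_pi _ _).
  apply: (tmap_inj_r ii).
  have nat u : isec k (imap i u) = tmap idfun i (isec k u).
    have l1 : linear (fun u => isec k (imap i u)).
      by move=> c v w; rewrite imap_linear isec_linear.
    have l2 : linear (fun u => tmap (U := A) idfun i (isec k u)).
      by move=> c v w; rewrite isec_linear tmap_linear.
    apply: (indmod_ext l1 l2) => a m; rewrite imapE // !isecE //.
    move: (k a) => t.
    have l3 : linear (fun t : tens A B => tmap idfun i (tmap idfun (fun b => mact b m) t)).
      by move=> c v w; rewrite !tmap_linear.
    apply: (tens_ext (tmap_linear _ _) l3) => a' b.
    rewrite !tmap_pure ?ih //; [exact: lfun_linear | exact: mact_linl | exact: mact_linl].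
  by rewrite -!nat exy.
- have l1 : linear (fun x => imap p (imap i x)).
    by move=> c x y; rewrite !imap_linear.
  apply: (indmod_ext l1 (@linear_cst0 K _ _)) => a m.
  by rewrite !imapE // pi; exact: lin0 ((ipure_bilin N).2 a).
(* The image of [t] over N is a balancing relation. It lifts to a relation over M; subtracting that
   from [t] leaves the class unchanged and puts [t] in the kernel over the field. *)
- move=> v; rewrite -[v]quotv_piK; set t := vsval _.
  rewrite imap_pi // => /eqP; rewrite -memv_ker lker_quotv_pi => /memv_imgP [z _].
  rewrite lfunE /= => ez.
  have [z' ez'] := tmap_surj_r ps z.
  have : tmap idfun p (t - ind_rel f z') = 0.
    by rewrite (linB (tmap_linear _ _)) ez ez' ind_rel_map // subrr.
  case/(tmap_exact_r ps ex) => t' et'; exists (quotv_pi (ind_relspace f L) t').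
  rewrite imap_pi // -et' linearB /=.
  have -> : quotv_pi (ind_relspace f M) (ind_rel f z') = 0; last by rewrite subr0.
  by apply/eqP; rewrite -memv_ker lker_quotv_pi -[ind_rel _ _]lfunE memv_img ?memvf.
- move=> w; have [t et] := tmap_surj_r ps (vsval (w : quotv (ind_relspace f N))).
  exists (quotv_pi (ind_relspace f M) t); rewrite imap_pi // -et.
  by rewrite quotv_piK.
Qed.

Fact indmod_class_exact : exact_additive (fun M : fdMod B => G0_class (indmod f M)).
Proof. by move=> L M N e; apply: G0_class_exact; exact: indmod_exact. Qed.
Definition G0_induce : {additive G0 B -> G0 A} := G0_lift indmod_class_exact.
Lemma G0_induceE M : G0_induce (G0_class M) = G0_class (indmod f M).
Proof. exact: G0_liftE. Qed.
End Exact.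
End Induction.
End ExactFunctors.

(** * Simple modules and rank one idempotents *)

Section SplitAlgebras.
Variable K : fieldType.

Section Simple.
Variable A : fdAlgType K.
Implicit Types L M N : fdMod A.

Lemma short_exact_dim L M N : short_exact L M N ->
  \dim {:M} = (\dim {:L} + \dim {:N})%N.
Proof.
case=> f [g [_ _ [kf fg sg]]].
rewrite -(limg_ker_dim g {:M}) capfv sg -fg; congr (_ + _)%N.
by rewrite -(limg_ker_dim f {:L}) capfv kf dimv0.
Qed.

Lemma minimal_submod M (M0 : ({:M} <> 0)%VS) : exists U : {vspace M},
  [/\ submod U, (U <> 0)%VS & forall W : {vspace M}, submod W -> (W <= U)%VS ->
        W = 0%VS \/ W = U].
Proof.
pose P n := `[< exists U : {vspace M}, [/\ submod U, (U <> 0)%VS & \dim U = n] >].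
have exP : exists n, P n.
  by exists (\dim {:M}); apply/asboolP; exists fullv; split=> // a v _; exact: memvf.
case: (ex_minnP exP) => n /asboolP [U [hU U0 dU]] nmin.
exists U; split=> // W hW WU; have [->|/eqP W0] := eqVneq W 0%VS; [by left|right].
have /nmin : P (\dim W) by apply/asboolP; exists W.
by move=> le; apply/eqP; rewrite eqEdim WU dU.
Qed.

Lemma submodule_simple M (U : {vspace M}) (hU : submod U) : (U <> 0)%VS ->
  (forall W : {vspace M}, submod W -> (W <= U)%VS -> W = 0%VS \/ W = U) ->
  simple_mod (submodule hU).
Proof.
move=> U0 Umin; split.
  move=> F0; apply: U0; apply/eqP; rewrite -subv0; apply/subvP => v vU.
  have := memvf (vsproj U v : submodule hU); rewrite F0 memv0 => /eqP v0.
  by rewrite memv0 -(vsprojK vU) v0 [vsval 0]linear0.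
move=> W hW; pose f : 'Hom(submodule hU, M) := linfun vsval.
have fE x : f x = vsval x by rewrite lfunE.
have fW : submod (f @: W)%VS.
  move=> a v /memv_imgP [x xW ->]; rewrite fE -[mact a _](sub_actE hU) -fE.
  by apply: memv_img; exact: hW.
have fU : (f @: W <= U)%VS.
  by apply/subvP => v /memv_imgP [x _ ->]; rewrite fE subvsP.
case: (Umin _ fW fU) => e; [left|right]; apply/eqP.
  rewrite -subv0; apply/subvP => x /(memv_img f); rewrite e !memv0 fE => /eqP x0.
  by apply/eqP/val_inj; exact: etrans x0 (esym (linear0 _)).
rewrite eqEsubv subvf; apply/subvP => x _.
have : vsval x \in (f @: W)%VS by rewrite e subvsP.
by case/memv_imgP => y yW; rewrite fE => /val_inj ->.
Qed.

Lemma simple_submodule M : ({:M} <> 0)%VS ->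
  exists U (hU : submod (U : {vspace M})), simple_mod (submodule hU).
Proof.
case/minimal_submod => U [hU U0 Umin]; exists U, hU; exact: submodule_simple.
Qed.

Lemma dim_quotmodule M (U : {vspace M}) (hU : submod U) :
  ({:submodule hU} <> 0)%VS -> (\dim {:quotmodule hU} < \dim {:M})%N.
Proof.
move=> U0; rewrite (short_exact_dim (short_exact_sub hU)) -[X in (X < _)%N]add0n.
by rewrite ltn_add2r lt0n dimv_eq0; apply/eqP.
Qed.

(** Splitting off a simple submodule and inducting on the dimension shows that simple classes
    generate [G0 A]. *)
Lemma G0_simple_induction (P : G0 A -> Prop) :
  P 0 -> (forall x y, P x -> P y -> P (x - y)) ->
  (forall L, simple_mod L -> P (G0_class L)) -> forall t, P t.
Proof.
move=> P0 PB Ps; have PD x y : P x -> P y -> P (x + y).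
  by move=> Px Py; rewrite -[y]opprK; apply: (PB) => //; rewrite -sub0r; apply: (PB).
apply: G0_induction => // M.
have [n] := ubnP (\dim {:M}); elim: n M => // n IHn M.
rewrite ltnS => dM; have [M0|M0] := pselect ({:M} = 0)%VS.
  by rewrite G0_class0.
have [U [hU sU]] := simple_submodule M0.
rewrite (G0_class_exact (short_exact_sub hU)); apply: PD; first exact: Ps.
by apply: IHn; apply: leq_trans dM; exact: dim_quotmodule sU.1.
Qed.

Lemma simple_cyclic L (u : L) : simple_mod L -> u != 0 ->
  forall v, exists a, v = mact a u.
Proof.
move=> [_ sL] u0 v; pose q := lin_hom (@mact_linl K A L u).
have qE a : q a = mact a u by rewrite lin_homE.
have : submod (limg q).
  move=> a _ /memv_imgP [b _ ->]; rewrite qE -mactM -qE memv_img ?memvf //.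
case/sL => e.
  have : u \in limg q by rewrite -(mact1 u) -qE memv_img ?memvf.
  by rewrite e memv0 (negPf u0).
have : v \in limg q by rewrite e memvf.
by case/memv_imgP => a _; rewrite qE; exists a.
Qed.

(** The element carrying [u] to [v] can be chosen K-linearly in [v]; the choice is A-linear only
    modulo the annihilator of [u]. *)
Lemma cyclic_section L (u : L) : (forall v, exists a, v = mact a u) ->
  exists s : 'Hom(L, A), forall v, mact (s v) u = v.
Proof.
move=> cyc; pose q := lin_hom (@mact_linl K A L u).
have qE a : q a = mact a u by rewrite lin_homE.
exists q^-1%VF => v; rewrite -qE limg_lfunVK //.
by have [a ->] := cyc v; rewrite -qE memv_img ?memvf.
Qed.

Lemma schur L M (f : L -> M) (u : L) : simple_mod L -> simple_mod M -> linear f ->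
  (forall a v, f (mact a v) = mact a (f v)) -> f u <> 0 -> modiso L M.
Proof.
move=> [_ sL] sM fl fh fu; apply: (modiso_intro fl fh).
  have : submod (lker (lin_hom fl)).
    by move=> a v; rewrite !memv_ker !lin_homE fh => /eqP ->; rewrite linear0.
  case/sL => [/eqP/lker0P i x y e|e]; first by apply: i; rewrite !lin_homE.
  have := memvf u; rewrite -e memv_ker lin_homE => /eqP; contradiction.
move=> w; have [a ->] := simple_cyclic sM (introN eqP fu) w.
by exists (mact a u); rewrite fh.
Qed.

(** Let I be the annihilator of [w]. Then I u is a submodule of L. If it is L, some element of I
    fixes [u]. If it is zero, a w |-> a u is a well defined nonzero map from M to L, an isomorphism
    by Schur's lemma. *)
Lemma separate_vector L M (u : L) (w : M) : simple_mod L -> simple_mod M ->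
  ~ modiso M L -> exists2 a, mact a u = u & mact a w = 0.
Proof.
move=> sL sM nML.
have [->|u0] := eqVneq u 0; first by exists 0; rewrite ?(lin0 (mact_linl _)) ?linear0.
have [->|w0] := eqVneq w 0; first by exists aone; rewrite ?mact1.
pose q := lin_hom (@mact_linl K A L u); pose r := lin_hom (@mact_linl K A M w).
have qE a : q a = mact a u by rewrite lin_homE.
have rE a : r a = mact a w by rewrite lin_homE.
have : submod (q @: lker r)%VS.
  move=> a v /memv_imgP [b]; rewrite memv_ker rE => /eqP bw ->.
  by rewrite qE -mactM -qE memv_img // memv_ker rE mactM bw linear0.
case/sL.2 => e; last first.
  have : u \in (q @: lker r)%VS by rewrite e memvf.
  by case/memv_imgP => a; rewrite memv_ker rE qE => /eqP aw eu; exists a.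
have ann a : mact a w = 0 -> mact a u = 0.
  move=> aw; apply/eqP; rewrite -memv0 -e -qE memv_img // memv_ker rE aw.
  by rewrite eqxx.
have [s sE] := cyclic_section (simple_cyclic sM w0).
have annB a b : mact a w = mact b w -> mact a u = mact b u.
  move=> ab; apply/eqP; rewrite -subr_eq0 -(linB (mact_linl _)); apply/eqP/ann.
  by rewrite (linB (mact_linl _)) ab subrr.
case: nML; apply: (@schur M L (fun m => mact (s m) u) w) => //.
- by move=> c x y; rewrite lfun_linear mact_linl.
- by move=> a v; rewrite -mactM; apply: annB; rewrite mactM !sE.
- by rewrite (annB _ aone) ?sE ?mact1 //; exact/eqP.
Qed.

Lemma separate_module L M (u : L) : simple_mod L -> simple_mod M ->
  ~ modiso M L -> exists2 a, mact a u = u & forall w : M, mact a w = 0.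
Proof.
move=> sL sM nML.
have kill (s : seq M) : exists2 a, mact a u = u & forall w, w \in s -> mact a w = 0.
  elim: s => [|w s [a au aw]]; first by exists aone => [|w']; rewrite ?mact1 ?in_nil.
  (* The new vector is separated after [a] has acted on it, so that [b ⋅ a] kills it and still kills
     the earlier ones. *)
  have [b bu bw] := separate_vector u (mact a w) sL sM nML.
  exists (b ⋅ a) => [|w']; rewrite mactM; first by rewrite au.
  by rewrite inE => /orP[/eqP -> //|/aw ->]; rewrite linear0.
have [a au aw] := kill (vbasis {:M}).
exists a => // w; rewrite (coord_vbasis (memvf w)) linear_sum big1 // => i _.
by rewrite linearZ /= aw ?scaler0 // mem_nth ?size_tuple.
Qed.

(** Only the action of [e] on [L] is a projection, onto the line of [u]; [e] itself need not be
    idempotent in A. *)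
Definition rank1_idem (e : A) L (u : L) : Prop :=
  [/\ u != 0, mact e u = u & forall v, exists c, mact e v = c *: u].

(** This forces endomorphisms of a simple module to be scalars: they preserve the line K u, and [u]
    generates. *)
Definition split_alg : Prop :=
  forall L, simple_mod L -> exists e (u : L), rank1_idem e u.

Lemma rank1_functional e L (u : L) : rank1_idem e u ->
  exists2 psi : L -> K^o, linear psi & psi u = 1 /\ forall v, mact e v = psi v *: u.
Proof.
case=> u0 eu eK; pose psi v : K^o := sval (cid (eK v)).
have psiE v : mact e v = psi v *: u by rewrite /psi; case: cid.
have inj (c d : K) : c *: u = d *: u -> c = d.
  move/eqP; rewrite -subr_eq0 -scalerBl scaler_eq0 (negPf u0) orbF subr_eq0.
  by move/eqP.
exists psi; last by split=> //; apply: inj; rewrite -psiE eu scale1r.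
by move=> c x y; apply: inj; rewrite scalerDl -scalerA -!psiE linearP.
Qed.

(* e is the component of 1 in the Fitting decomposition of A under left
   multiplication by a. *)
Lemma fitting_idem (a : A) : exists e n x,
  let an := iter n (amul a) a in [/\ e ⋅ e = e, e = an ⋅ x & an ⋅ e = an].
Proof.
(* [p n] is the power of [a] with exponent n + 1. The exponent is positive, so whatever [a] kills in
   a module on which it acts by zero, the idempotent kills too. *)
pose p n := iter n (amul a) a; pose l n := lin_hom (@amul_linr K A (p n)).
have lE n x : l n x = p n ⋅ x by rewrite lin_homE.
have pM n m : p n ⋅ p m = p (n + m).+1.
  by elim: n => [//|n IHn]; rewrite addSn [in RHS]/p iterS -/(p _) -IHn amulA.
pose P d := `[< exists n, \dim (lker (l n)) = d >].
have exP : exists d, P d by exists (\dim (lker (l 0%N))); apply/asboolP; exists 0%N.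
have ubP d : P d -> (d <= \dim {:A})%N.
  by case/asboolP => n <-; rewrite dimvS ?subvf.
case: (ex_maxnP exP ubP) => d /asboolP [n dn] dmax.
(* The kernel of left multiplication by [p n] has maximal dimension among the powers, hence equals
   that of the square of [p n]. *)
have kn x : p n ⋅ (p n ⋅ x) = 0 -> p n ⋅ x = 0.
  have sub : (lker (l n) <= lker (l (n + n).+1))%VS.
    apply/subvP => y; rewrite !memv_ker !lE -pM -amulA => /eqP ->.
    by rewrite (lin0 (amul_linr _)).
  have /eqP e : lker (l n) == lker (l (n + n).+1).
    rewrite eqEdim sub dn dmax //; apply/asboolP.
    by exists (n + n).+1.
  rewrite amulA pM -lE => /eqP; rewrite -memv_ker -e memv_ker lE; by move/eqP.
have cap : (limg (l n) :&: lker (l n) = 0)%VS.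
  apply/eqP; rewrite -subv0; apply/subvP => y; rewrite memv_cap.
  case/andP => /memv_imgP [x _ ->]; rewrite memv_ker !lE => /eqP /kn ->.
  exact: mem0v.
have : (limg (l n) + lker (l n) = fullv)%VS.
  apply/eqP; rewrite eqEdim subvf /=.
  have := dimv_sum_cap (limg (l n)) (lker (l n)); rewrite cap dimv0 addn0 => ->.
  by rewrite addnC -[lker _]capfv limg_ker_dim.
move=> full; have : aone \in (limg (l n) + lker (l n))%VS by rewrite full memvf.
case/memv_addP => e /memv_imgP [x _ ex] [y yk e1].
rewrite lE in ex; move: yk; rewrite memv_ker lE => /eqP yk.
have ne : p n ⋅ e = p n.
  by rewrite -[RHS]amul1r e1 (linD (amul_linr _)) yk addr0.
exists e, n, x; split=> //.
(* The difference of [e] and [e ⋅ e] lies in the image of [p n] and, since [p n ⋅ e = p n], also in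
   its kernel. *)
apply/eqP; rewrite eq_sym -subr_eq0 {1}ex {1}[in e ⋅ e]ex -amulA.
rewrite -(linB (amul_linr _)); apply/eqP/kn.
rewrite (linB (amul_linr (p n))) -ex amulA -ex.
by rewrite (linB (amul_linr (p n))) amulA ne ne subrr.
Qed.

(** Let [c] fix [u] and kill every other L_j. Then [c ⋅ e] acts as the rank one projection on L_i
    and as zero on the others, without being idempotent in A. Its Fitting idempotent acts in the
    same way. *)
Lemma dual_idem n (L : 'I_n -> fdMod A) : split_alg ->
  (forall i, simple_mod (L i)) -> (forall i j, modiso (L i) (L j) -> i = j) ->
  forall i, exists2 e, e ⋅ e = e & (exists u : L i, rank1_idem e u) /\
    forall j, j != i -> forall v : L j, mact e v = 0.
Proof.
move=> spl sL dL i; have [e [u eu]] := spl _ (sL i).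
have [c cu c0] : exists2 c, mact c u = u &
    forall j, j \in enum 'I_n -> j != i -> forall v : L j, mact c v = 0.
  elim: (enum _) => [|j s [c cu c0]]; first by exists aone => [|w']; rewrite ?mact1 ?in_nil.
  have [ji|ji] := eqVneq j i.
    exists c => // k; rewrite inE => /orP[/eqP -> | ]; last exact: c0.
    by rewrite ji eqxx.
  have [a au a0] : exists2 a, mact a u = u & forall v : L j, mact a v = 0.
    by apply: separate_module => // /dL /eqP; rewrite (negPf ji).
  exists (c ⋅ a) => [|k]; first by rewrite mactM au.
  rewrite inE => /orP[/eqP -> _ v|ks ki v]; rewrite mactM; last exact: c0.
  by rewrite a0 linear0.
pose a := c ⋅ e.
have [psi psil [psiu psiE]] := rank1_functional eu.
have aE v : mact a v = psi v *: u by rewrite mactM psiE linearZ /= cu.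
have a0 j : j != i -> forall v : L j, mact a v = 0.
  by move=> ji v; rewrite mactM c0 ?mem_enum.
have [f [m [x /= [ff fx xf]]]] := fitting_idem a.
have pE v : mact (iter m (amul a) a) v = psi v *: u.
  elim: m {fx xf} => [|m IHm]; first exact: aE.
  by rewrite iterS mactM IHm linearZ /= aE psiu scale1r.
have p0 j : j != i -> forall v : L j, mact (iter m (amul a) a) v = 0.
  move=> ji v; elim: m {fx xf pE} => [|m IHm]; first exact: a0.
  by rewrite iterS mactM IHm linear0.
exists f => //; split; last by move=> j ji v; rewrite fx mactM p0.
(* [mact f v] is a multiple of [u], so the power of [a] fixes it; as that power times [f] is the
   power itself, both act alike. *)
have fE v : mact f v = psi v *: u.
  rewrite -pE -xf mactM pE {1 2}fx !mactM !pE (linZ psil) psiu.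
  by rewrite /GRing.scale /= mulr1.
exists u; split; first by case: eu.
  by rewrite fE psiu scale1r.
by move=> v; exists (psi v).
Qed.
End Simple.
End SplitAlgebras.

(** * The Grothendieck group of a tensor product *)

Section Kunneth.
Variables (K : fieldType) (A B : fdAlgType K).

Let inl (a : A) : tens A B := a ⊗ aone.
Fact tens_inl_linear : linear inl. Proof. exact: tpureL. Qed.
Fact tens_inl1 : lin_hom tens_inl_linear aone = aone. Proof. by rewrite lin_homE. Qed.
Fact tens_inlM : {morph lin_hom tens_inl_linear : x y / x ⋅ y}.
Proof. by move=> x y; rewrite !lin_homE [RHS]tens_mul_pure amul1l. Qed.
Definition tens_inl : alghom A (tens A B) := AlgHom tens_inl1 tens_inlM.
Lemma tens_inlE a : tens_inl a = a ⊗ aone. Proof. exact: lin_homE. Qed.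
Lemma tens_inrE b : tens_inr A B b = aone ⊗ b. Proof. by rewrite [LHS]lfunE. Qed.

Lemma tens_inlr a b : tens_inl a ⋅ tens_inr A B b = a ⊗ b.
Proof. by rewrite tens_inlE tens_inrE [LHS]tens_mul_pure amul1l amul1r. Qed.
Lemma tens_inrl a b : tens_inr A B b ⋅ tens_inl a = a ⊗ b.
Proof. by rewrite tens_inlE tens_inrE [LHS]tens_mul_pure amul1l amul1r. Qed.

Section IdemPart.
Variables (e : A) (ee : e ⋅ e = e).

Definition idem_space (M : fdMod (tens A B)) : {vspace M} :=
  limg (lin_hom (mact_linr (M := M) (tens_inl e))).

Let idem_actE (M : fdMod (tens A B)) v :
  lin_hom (mact_linr (M := M) (tens_inl e)) v = mact (tens_inl e) v.
Proof. exact: lin_homE. Qed.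

Lemma idem_spaceP (M : fdMod (tens A B)) (v : M) :
  reflect (mact (tens_inl e) v = v) (v \in idem_space M).
Proof.
apply: (iffP memv_imgP) => [[w _ ->]|ev].
  by rewrite idem_actE -mactM -alghomM ee.
by exists v; rewrite ?memvf ?idem_actE.
Qed.

Fact idem_submod (M : fdMod (tens A B)) : submod (M := resmod (tens_inr A B) M) (idem_space M).
Proof.
move=> b v /idem_spaceP ev; apply/idem_spaceP.
by rewrite -mactM tens_inlr -tens_inrl mactM ev.
Qed.
(** The space e M, stable under B because [e ⊗ 1] commutes with [1 ⊗ b]. *)
Definition idem_part M : fdMod B := submodule (@idem_submod M).

(** A preimage of a vector of the e-part may lie outside the e-part, but applying [e] moves it
    inside without changing its image. This uses that [e] is idempotent on every module. *)
Lemma idem_part_exact : exact_additive (fun M => G0_class (idem_part M)).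
Proof.
move=> L M N /short_exact_elim [f [g [fh gh fi [gf ex gs]]]].
apply: G0_class_exact.
have fU v : v \in idem_space L -> f v \in idem_space M.
  by move/idem_spaceP => ev; apply/idem_spaceP; rewrite -fh ev.
have gU v : v \in idem_space M -> g v \in idem_space N.
  by move/idem_spaceP => ev; apply/idem_spaceP; rewrite -gh ev.
pose f' (v : idem_part L) : idem_part M := vsproj (idem_space M) (f (vsval v)).
pose g' (v : idem_part M) : idem_part N := vsproj (idem_space N) (g (vsval v)).
have f'E v : vsval (f' v) = f (vsval v) by rewrite vsprojK // fU ?subvsP.
have g'E v : vsval (g' v) = g (vsval v) by rewrite vsprojK // gU ?subvsP.
have vi X : injective (vsval : idem_part X -> X) by exact: val_inj.
have acE X b (x : idem_part X) : vsval (mact b x) = mact (tens_inr A B b) (vsval x : X).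
  exact: (sub_actE (@idem_submod X)).
apply: (@short_exact_intro K B (idem_part L) (idem_part M) (idem_part N) f' g').
- by move=> c x y; rewrite /f' !linearP.
- by move=> c x y; rewrite /g' !linearP.
- by move=> b v; apply: vi; rewrite f'E !acE f'E fh.
- by move=> b v; apply: vi; rewrite g'E !acE g'E gh.
- by move=> x y /(congr1 vsval); rewrite !f'E => /fi /vi.
- by move=> v; apply: vi; rewrite g'E f'E gf linear0.
- move=> v /(congr1 vsval); rewrite g'E linear0 => /ex [u eu].
  have uU : mact (tens_inl e) u \in idem_space L.
    by apply/idem_spaceP; rewrite -mactM -alghomM ee.
  exists (vsproj (idem_space L) (mact (tens_inl e) u)); apply: vi.
  rewrite f'E vsprojK // fh -eu; symmetry; exact/idem_spaceP/subvsP.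
- move=> w; have [v ev] := gs (vsval w).
  have vU : mact (tens_inl e) v \in idem_space M.
    by apply/idem_spaceP; rewrite -mactM -alghomM ee.
  exists (vsproj (idem_space M) (mact (tens_inl e) v)); apply: vi.
  rewrite g'E vsprojK // gh -ev; symmetry; exact/idem_spaceP/subvsP.
Qed.

Definition G0_idem : {additive G0 (tens A B) -> G0 B} := G0_lift idem_part_exact.

Lemma tens_inl_act (L : fdMod A) (N : fdMod B) a (t : tensmod L N) :
  mact (tens_inl a) t = tmap (mact a) idfun t.
Proof.
apply: (tens_ext (mact_linr (M := tensmod L N) _) (tmap_linear _ _)) => l n.
rewrite tmap_pure //; last exact: mact_linr.
by rewrite tens_inlE [LHS]tens_act_pure mact1.
Qed.

Lemma tens_inr_act (L : fdMod A) (N : fdMod B) b (t : tensmod L N) :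
  mact (tens_inr A B b) t = tmap idfun (mact b) t.
Proof.
apply: (tens_ext (mact_linr (M := tensmod L N) _) (tmap_linear _ _)) => l n.
rewrite tmap_pure //; last exact: mact_linr.
by rewrite tens_inrE [LHS]tens_act_pure mact1.
Qed.

(** The e-part of L ⊗ N is u ⊗ N, a copy of N; contraction with [psi] is the inverse of n |-> u ⊗
    n. *)
Lemma G0_idem_rank1 (L : fdMod A) (u : L) (y : G0 B) : rank1_idem e u ->
  G0_idem (G0_prod A B (G0_class L ⊠ y)) = y.
Proof.
move=> eu; have [psi psil [psiu psiE]] := rank1_functional eu.
move: y; apply: G0_induction => [|x y ex ey|N]; first by rewrite zpure0r !raddf0.
  by rewrite zpureBr !raddfB ex ey.
rewrite G0_prodE [LHS]G0_liftE; symmetry; apply: G0_class_iso.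
have uU (n : N) : u ⊗ n \in idem_space (tensmod L N).
  apply/idem_spaceP; rewrite tens_inl_act tmap_pure //; last exact: mact_linr.
  by case: eu => _ ->.
pose f n : idem_part (tensmod L N) := vsproj (idem_space (tensmod L N)) (u ⊗ n).
have fE n : vsval (f n) = u ⊗ n by rewrite vsprojK ?uU.
have vi : injective (vsval : idem_part (tensmod L N) -> tensmod L N) by exact: val_inj.
have psib : bilin (fun l (n : N) => psi l *: n).
  split=> [n|l] c x y; first by rewrite psil scalerDl -scalerA.
  by rewrite scalerDr !scalerA mulrC.
apply: (modiso_intro (f := f)).
- by move=> c x y; rewrite /f tpureR linearP.
- move=> b n; apply: vi; rewrite fE [RHS](sub_actE (@idem_submod (tensmod L N))) fE.
  rewrite [RHS]tens_inr_act tmap_pure //; exact: mact_linr.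
- move=> x y /(congr1 vsval); rewrite !fE => /(congr1 (tlift (fun l (n : N) => psi l *: n))).
  by rewrite !tlift_pure // psiu !scale1r.
- move=> w; exists (tlift (fun l (n : N) => psi l *: n) (vsval w)); apply: vi; rewrite fE.
  have /idem_spaceP <- := subvsP w; rewrite tens_inl_act.
  set t := vsval w.
  have l1 : linear (fun t => u ⊗ tlift (fun l (n : N) => psi l *: n) (tmap (mact e) idfun t)).
    by move=> c x y; rewrite tmap_linear tlift_linear tpureR.
  apply: (tens_ext (tmap_linear _ _) l1) => l n.
  rewrite tmap_pure //; last exact: mact_linr.
  by rewrite tlift_pure // psiE (linZ (tpureL n)) (linZ psil) psiu /GRing.scale /=
    mulr1 (linZ (tpureR u)).
Qed.

Lemma G0_idem_kill (L : fdMod A) (y : G0 B) : (forall l : L, mact e l = 0) ->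
  G0_idem (G0_prod A B (G0_class L ⊠ y)) = 0.
Proof.
move=> eL; move: y; apply: G0_induction => [|x y ex ey|N].
- by rewrite zpure0r !raddf0.
- by rewrite zpureBr !raddfB ex ey subrr.
rewrite G0_prodE [LHS]G0_liftE; apply: G0_class0; apply: fullv_eq0 => v.
have vi : injective (vsval : idem_part (tensmod L N) -> tensmod L N) by exact: val_inj.
apply: vi; have /idem_spaceP <- := subvsP v; rewrite tens_inl_act [RHS]linear0.
apply: (tens_ext (tmap_linear _ _) (@linear_cst0 K _ _)) => l n.
rewrite tmap_pure //; last exact: mact_linr.
by rewrite eL tpure0l.
Qed.
End IdemPart.

(** Terms whose simple modules are isomorphic are merged by adding coefficients, which makes the
    modules pairwise nonisomorphic. *)
Lemma ztens_simple_sum (t : ztens (G0 A) (G0 B)) :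
  exists n (L : 'I_n -> fdMod A) (y : 'I_n -> G0 B),
    [/\ forall i, simple_mod (L i), forall i j, modiso (L i) (L j) -> i = j &
        t = \sum_i G0_class (L i) ⊠ y i].
Proof.
pose Q t := exists n (L : 'I_n -> fdMod A) (y : 'I_n -> G0 B),
    [/\ forall i, simple_mod (L i), forall i j, modiso (L i) (L j) -> i = j &
        t = \sum_i G0_class (L i) ⊠ y i].
have Q0 : Q 0.
  (* The index set is empty; [regmod A] is a filler. *)
  exists 0%N, (fun i => regmod A), (fun=> 0).
  by split=> [[m mlt]|[m mlt]|]; [have := mlt; rewrite ltn0..|rewrite big_ord0].
have Qadd L y x : simple_mod L -> Q x -> Q (G0_class L ⊠ y + x).
  move=> sL [n [M [z [sM dM ->]]]].
  have [[i iL]|nL] := pselect (exists i, modiso (M i) L).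
    exists n, M, (fun j => (if j == i then y else 0) + z j); split=> //.
    have -> : G0_class L ⊠ y = \sum_j G0_class (M j) ⊠ (if j == i then y else 0).
      rewrite (bigD1 i) //= eqxx big1 ?addr0 ?(G0_class_iso iL) // => j /negPf ->.
      by rewrite zpure0r.
    by rewrite -big_split; apply: eq_bigr => j _; rewrite zpureDr.
  pose M' i := oapp M L (unlift ord0 i); pose z' i := oapp z y (unlift ord0 i).
  exists n.+1, M', z'; split.
  - by move=> i; rewrite /M'; case: (unliftP ord0 i) => [j|] _ /=.
  - move=> i j; rewrite /M'; case: (unliftP ord0 i) => [k|] ->;
      case: (unliftP ord0 j) => [l|] -> //=.
    + by move/dM ->.
    + by move=> h; case: nL; exists k.
    + by move/modiso_sym => h; case: nL; exists l.
  - rewrite big_ord_recl /M' /z' unlift_none /=; congr (_ + _).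
    by apply: eq_bigr => i _; rewrite liftK.
have QB x y : Q x -> Q y -> Q (x - y).
  move=> Qx [n [M [z [sM dM ->]]]]; rewrite -sumrN.
  elim/big_rec: _ => [|i w _ Qw]; first by rewrite addr0.
  by rewrite addrCA -zpureNr; apply: Qadd.
move: t; rewrite -/Q; apply: ztens_induction => // x y; move: x.
apply: G0_simple_induction => [|x x' Qx Qx'|L sL].
- by rewrite zpure0l.
- by rewrite zpureBl; apply: QB.
- by rewrite -[_ ⊠ _]addr0; apply: Qadd.
Qed.

Lemma G0_prod_inj : split_alg A -> injective (G0_prod A B).
Proof.
move=> spl; apply: raddf_inj => t.
have [n [L [y [sL dL ->]]]] := ztens_simple_sum t.
move=> e0; rewrite big1 // => i _.
have [e ee [[u eu] ek]] := dual_idem spl sL dL i.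
suff -> : y i = 0 by rewrite zpure0r.
have sumE (F : 'I_n -> ztens (G0 A) (G0 B)) :
  G0_idem ee (G0_prod A B (\sum_j F j)) = \sum_j G0_idem ee (G0_prod A B (F j)).
  by rewrite !raddf_sum.
have := congr1 (G0_idem ee) e0; rewrite raddf0 sumE (bigD1 i) //.
rewrite (G0_idem_rank1 ee _ eu) big1 => [|j ji]; first by rewrite /= addr0.
by rewrite G0_idem_kill //; exact: ek.
Qed.

(** With [x] the vector [u] seen in M and H = B x, the map is l ⊗ h |-> s(l) h, where s(l) u = l.
    The annihilator of [u] kills all of H because the two actions commute, so the choice of s(l) is
    immaterial and the map is A-linear. *)
Lemma simple_split_embedding (M : fdMod (tens A B)) : split_alg A -> ({:M} <> 0)%VS ->
  exists (L : fdMod A) (H : fdMod B) (N : fdMod (tens A B)),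
    short_exact (tensmod L H) M N /\ (\dim {:N} < \dim {:M})%N.
Proof.
move=> spl M0; pose MA := resmod tens_inl M; pose MB := resmod (tens_inr A B) M.
have [U [hU sL]] : exists U (hU : submod (U : {vspace MA})), simple_mod (submodule hU).
  exact: simple_submodule.
pose L := submodule hU; have [e [u eu]] := spl _ sL.
have [psi psil [psiu psiE]] := rank1_functional eu.
have u0 : u != 0 by case: eu.
have [s sE] := cyclic_section (simple_cyclic sL u0).
pose x : M := vsval u.
pose V : {vspace MB} := limg (lin_hom (@mact_linl K B MB x)).
have VP (v : M) : reflect (exists b, v = mact (tens_inr A B b) x) (v \in V).
  apply: (iffP memv_imgP) => [[b _ ->]|[b ->]].
    by exists b; rewrite [LHS]lin_homE.
  by exists b; rewrite ?memvf // [RHS]lin_homE.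
have hV : submod V.
  move=> b v /VP [b' ->]; apply/VP; exists (b ⋅ b').
  by rewrite alghomM mactM.
pose H := submodule hV.
have inlr a b (v : M) : mact (tens_inl a) (mact (tens_inr A B b) v) =
    mact (tens_inr A B b) (mact (tens_inl a) v).
  by rewrite -!mactM tens_inlr tens_inrl.
have LE a (l : L) : vsval (mact a l) = mact (tens_inl a) (vsval l : M).
  exact: (sub_actE hU).
have HE b (h : H) : vsval (mact b h) = mact (tens_inr A B b) (vsval h : M).
  exact: (sub_actE hV).
have vi : injective (vsval : H -> M) by exact: val_inj.
(* H consists of vectors killed by the annihilator of u. *)
have annH a (h : H) : mact a u = 0 -> mact (tens_inl a) (vsval h : M) = 0.
  move=> au; have /VP [b ->] := subvsP h.
  by rewrite inlr /x -LE au [vsval 0]linear0 linear0.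
have annB a b (h : H) : mact a u = mact b u ->
    mact (tens_inl a) (vsval h : M) = mact (tens_inl b) (vsval h : M).
  move=> ab; apply/eqP; rewrite -subr_eq0 -(linB (mact_linl _)) -linearB; apply/eqP/annH.
  by rewrite (linB (mact_linl _)) ab subrr.
pose phi : tens L H -> M := tlift (fun l (h : H) => mact (tens_inl (s l)) (vsval h : M)).
have phib : bilin (fun l (h : H) => mact (tens_inl (s l)) (vsval h : M)).
  split=> [h|l] c y z; last by rewrite !linearP.
  by rewrite !lfun_linear mact_linl.
have phil : linear phi by move=> c y z; rewrite /phi linearP.
have phih : forall z (t : tensmod L H), phi (mact z t) = mact z (phi t).
  apply: modhom_pure phil _ => a b l h.
  rewrite /phi !tlift_pure // HE inlr -(tens_inrl a b) mactM; congr (mact _ _).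
  by rewrite -[RHS]mactM -alghomM; apply: annB; rewrite mactM !sE.
have phii : injective phi.
  have ker0 t : phi t = 0 -> t = 0.
    move=> t0; pose vb := vbasis {:H}.
    pose l j : L := \sum_i (t : 'M[K]_(_, _)) i j *: (vbasis {:L})`_i.
    have tE : t = \sum_j l j ⊗ vb`_j.
      rewrite {1}(tens_sum t) exchange_big; apply: eq_bigr => j _.
      rewrite (big_morph _ (fun x y => tpureDl x y vb`_j) (tpure0l _ vb`_j)).
      by apply: eq_bigr => i _; rewrite (linZ (tpureL _)).
    (* Acting by [e ⋅ b] contracts the first factor to multiples of [u], and [phi] sends u ⊗ h to h.
       Since the [vb] are free, all [psi (mact b (l j))] vanish; a nonzero [l j] would generate L
       and give [psi u = 0]. *)
    have contr b : \sum_j psi (mact b (l j)) *: vb`_j = 0.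
      have : phi (mact (tens_inl (e ⋅ b)) (t : tensmod L H)) = 0.
        by rewrite phih t0 linear0.
      pose F (t : tensmod L H) := phi (mact (tens_inl (e ⋅ b)) t).
      have Fl : linear F by move=> c y z; rewrite /F mact_linr phil.
      rewrite -/(F t) tE (big_morph F (linD Fl) (lin0 Fl)) => e0.
      apply: vi; rewrite [RHS]linear0 -[RHS]e0 linear_sum; apply: eq_bigr => j _.
      rewrite /F.
      rewrite tens_inl_act tmap_pure //; last exact: mact_linr.
      rewrite mactM psiE (linZ (tpureL _)) (linZ phil) /phi tlift_pure // linearZ /=.
      congr (_ *: _); rewrite (annB _ aone) ?sE ?mact1 //.
      by rewrite alghom1 mact1.
    have l0 j : l j = 0.
      apply/eqP/negP => /negP lj0; have [b ub] := simple_cyclic sL lj0 u.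
      have /freeP/(_ (fun j => psi (mact b (l j))) (contr b) j) : free vb.
        exact: basis_free (vbasisP _).
      by rewrite -ub psiu; apply/eqP; exact: oner_neq0.
    by rewrite tE big1 // => j _; rewrite l0 tpure0l.
  move=> y z yz; apply/eqP; rewrite -subr_eq0; apply/eqP/ker0.
  by rewrite (linB phil) yz subrr.
pose I := limg (lin_hom phil).
have IP v : reflect (exists t, v = phi t) (v \in I).
  apply: (iffP memv_imgP) => [[t _ ->]|[t ->]]; exists t; rewrite ?memvf ?lin_homE //.
have hI : submod I.
  by move=> z v /IP [t ->]; apply/IP; exists (mact z (t : tensmod L H)); rewrite phih.
have ex : short_exact (tensmod L H) M (quotmodule hI).
  apply: (@short_exact_intro K _ (tensmod L H) M (quotmodule hI) phi (quotv_pi I)) => //.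
  - by move=> c y z; rewrite linearP.
  - by move=> z v; rewrite [RHS]quot_actE.
  - by move=> t; apply/eqP; rewrite -memv_ker lker_quotv_pi; apply/IP; exists t.
  - by move=> v /eqP; rewrite -memv_ker lker_quotv_pi => /IP.
  - by move=> w; exists (vsval w); rewrite quotv_piK.
exists L, H, (quotmodule hI); split=> //.
rewrite (short_exact_dim ex) -[X in (X < _)%N]add0n ltn_add2r lt0n dimv_eq0.
apply/eqP => F0.
(* [L ⊗ H] is nonzero, since [phi] sends u ⊗ x to the nonzero vector x. *)
have xV : x \in V by apply/VP; exists aone; rewrite alghom1 mact1.
have : phi (u ⊗ (vsproj V x : H)) = 0.
  by have := memvf (u ⊗ (vsproj V x : H) : tensmod L H); rewrite F0 memv0 => /eqP ->; exact: lin0.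
rewrite /phi tlift_pure // (annB _ aone) ?sE ?mact1 // alghom1 mact1 vsprojK // => x0.
by case/eqP: u0; apply: val_inj; exact: etrans x0 (esym (linear0 _)).
Qed.

Lemma G0_prod_surj : split_alg A -> forall x, exists t, x = G0_prod A B t.
Proof.
move=> spl; apply: G0_induction => [|x y [t ->] [t' ->]|M].
- by exists 0; rewrite raddf0.
- by exists (t - t'); rewrite raddfB.
have [n] := ubnP (\dim {:M}); elim: n M => // n IHn M.
rewrite ltnS => dM; have [M0|M0] := pselect ({:M} = 0)%VS.
  by exists 0; rewrite G0_class0 // raddf0.
have [L [H [N [/G0_class_exact -> dN]]]] := simple_split_embedding spl M0.
have [t ->] := IHn N (leq_trans dN dM).
by exists (G0_class L ⊠ G0_class H + t); rewrite raddfD G0_prodE.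
Qed.

Lemma G0_prod_bij : split_alg A -> bijective (G0_prod A B).
Proof.
move=> spl; pose g x := sval (cid (G0_prod_surj spl x)).
have gK : cancel g (G0_prod A B) by move=> x; rewrite /g; case: cid.
by exists g => // t; apply: (G0_prod_inj spl); rewrite gK.
Qed.
End Kunneth.

(** * Simple modules of cellular algebras *)

Section CellularSplit.
Variables (K : fieldType) (Ob : Type) (C : klincat K Ob) (D : cell_datum C).
Variable n : Ob.
Notation A := (endalg C n).

(** A coordinate of the cellular basis: it reads off a coefficient in the layer [lam] from a
    congruence modulo the lower layers. *)
Lemma cell_coord (lam : Lam D) (S0 T0 : tab D n lam) :
  exists2 phi : hom C n n -> K^o, linear phi &
    (forall S T : tab D n lam, phi (cbas D S T) = ((S == S0) && (T == T0))%:R) /\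
    forall x, lower_span (D := D) lam x -> phi x = 0.
Proof.
case: (cell_basis D n n) => X bX XP.
have X0 : cbas D S0 T0 \in X by apply/XP; exists lam, S0, T0.
pose i0 : 'I_(size X) := Ordinal (etrans (index_mem _ _) X0).
pose X' := in_tuple X.
have phiX x : x \in X -> coord X' i0 x = (x == cbas D S0 T0)%:R.
  move=> xX; rewrite -[in LHS](nth_index 0 xX) -{1}[X]/(tval X').
  rewrite (coord_free (Ordinal (etrans (index_mem _ _) xX)) i0) ?(basis_free bX) //.
  congr (_%:R); congr (nat_of_bool _).
  apply/eqP/eqP => [/(congr1 val) /= e|e]; last by apply: val_inj; rewrite /= e.
  by rewrite -(nth_index 0 xX) e nth_index.
exists (fun x => coord X' i0 x) => [c x y|]; first by rewrite linearP.
have inj mu (S T : tab D n mu) : cbas D S T = cbas D S0 T0 ->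
    Tagged (fun lam => tab D n lam * tab D n lam)%type (S, T) =
    Tagged (fun lam => tab D n lam * tab D n lam)%type (S0, T0).
  by move=> e; apply: (@cell_inj _ _ _ D n n).
split=> [S T|x].
  rewrite phiX; last by apply/XP; exists lam, S, T.
  congr (_%:R); congr (nat_of_bool _); apply/eqP/andP => [/inj /eqP|[/eqP -> /eqP ->] //].
  by rewrite -tag_eqE /tag_eq eqxx /= tagged_asE => /eqP [-> ->].
have lin : linear (fun x => coord X' i0 x : K^o) by move=> c y z; rewrite linearP.
case/(in_span_map (Q := fun=> False) lin) => [_ [mu [S [T [mulam ->]]]]|].
  rewrite phiX; last by apply/XP; exists mu, S, T.
  case: eqP => [/inj /(congr1 (@tag _ _)) /= emu|_]; last exact: in_span0.
  by move: mulam; rewrite emu Order.POrderTheory.ltxx.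
by case=> [|y s] sP; [rewrite span_nil memv0 => /eqP | case: (sP y (mem_head _ _))].
Qed.

Lemma star_lower_span (lam : Lam D) x :
  lower_span (p := n) (n := n) lam x -> lower_span (D := D) lam (star D x).
Proof.
apply: in_span_map => [c y z|_ [mu [S [T [mulam ->]]]]]; first by rewrite linearP.
rewrite cell_star; exists [:: cbas D T S] => [z|]; last by rewrite span_seq1 memv_line.
by rewrite inE => /eqP ->; exists mu, T, S.
Qed.

(* Expanding the product of C_(S,T) and C_(Z,W) on both sides via the star
   leaves only the term C_(S,W) in the layer lam. *)
Lemma cell_r_cbas (lam : Lam D) (S T Z S' : tab D n lam) :
  S' != S -> cell_r D (cbas D S T) S' Z = 0.
Proof.
move=> S'S; have [phi phil [phiE phi0]] := cell_coord S' Z.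
have /phi0 := cell_mul D (cbas D S T) Z Z.
rewrite (linB phil) (big_morph phi (linD phil) (lin0 phil)) (bigD1 S') //=.
rewrite (linZ phil) phiE !eqxx big1 ?addr0 => [|S'' nS]; last first.
  by rewrite (linZ phil) phiE (negPf nS) scaler0.
rewrite /GRing.scale /= mulr1 => /eqP; rewrite subr_eq0 => /eqP <-.
have /star_lower_span/phi0 := cell_mul D (cbas D Z Z) T S.
rewrite linearB /= star_comp !cell_star linear_sum (linB phil) => /eqP.
rewrite (big_morph phi (linD phil) (lin0 phil)) big1 ?subr0 => [/eqP //|S'' _].
by rewrite linearZ /= cell_star (linZ phil) phiE eq_sym (negPf S'S) scaler0.
Qed.

Lemma seq_minimal (d : Order.disp_t) (P : porderType d) (p : P -> Prop) (s : seq P) x :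
  x \in s -> p x -> exists2 y, y \in s & p y /\ forall z, z \in s -> p z -> ~~ (z < y)%O.
Proof.
elim: s x => // x0 s IHs x; rewrite inE => xs px.
have [[y ys py]|ns] := pselect (exists2 y, y \in s & p y); last first.
  have ex0 : x = x0.
    by case/orP: xs => [/eqP //|xs]; case: ns; exists x.
  subst x0; exists x; rewrite ?mem_head //; split=> // z.
  rewrite inE => /orP[/eqP -> _|zs pz]; first by rewrite Order.POrderTheory.ltxx.
  by case: ns; exists z.
have [m ms [pm mmin]] := IHs y ys py.
have [[px0 lt]|nx0] := pselect (p x0 /\ (x0 < m)%O).
  exists x0; rewrite ?mem_head //; split=> // z; rewrite inE => /orP[/eqP -> _|zs pz].
    by rewrite Order.POrderTheory.ltxx.
  by apply: contra (mmin z zs pz) => /Order.POrderTheory.lt_trans; apply.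
exists m; rewrite ?inE ?ms ?orbT //; split=> // z.
rewrite inE => /orP[/eqP -> pz|]; last exact: mmin.
by apply/negP => lt; apply: nx0.
Qed.

(** The basis of A_n is finite, so only finitely many labels occur. This provides minimal labels
    although [Lam D] may be infinite. *)
Lemma cell_labels : exists s : seq (Lam D), forall lam (S T : tab D n lam), lam \in s.
Proof.
case: (cell_basis D n n) => X _ XP.
suff [s sP] : exists s : seq (Lam D), forall lam (S T : tab D n lam),
    cbas D S T \in X -> lam \in s.
  by exists s => lam S T; apply: (sP lam S T); apply/XP; exists lam, S, T.
have {XP} : forall x, x \in X -> exists lam (S T : tab D n lam), x = cbas D S T by move=> x /XP.
elim: X => [|x X IHX] XP; first by exists [::].
have [y yX|s sP] := IHX; first by apply: XP; rewrite inE yX orbT.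
have [lam [S [T ->]]] := XP x (mem_head _ _).
exists (lam :: s) => mu S' T'; rewrite !inE => /orP[/eqP e|/sP ->]; last by rewrite orbT.
have /(congr1 (@tag _ _)) /= -> := @cell_inj _ _ _ D n n
  (Tagged (fun lam => tab D n lam * tab D n lam)%type (S', T'))
  (Tagged (fun lam => tab D n lam * tab D n lam)%type (S, T)) e.
by rewrite eqxx.
Qed.

Lemma in_span_kill (V W : vectType K) (P : V -> Prop) (f : V -> W) : linear f ->
  (forall x, P x -> f x = 0) -> forall x, in_span P x -> f x = 0.
Proof.
move=> fl fP x [s sP]; elim: s sP x => [|y s IHs] sP x.
  by rewrite span_nil memv0 => /eqP ->; exact: lin0.
rewrite span_cons => /memv_addP[u /vlineP[c ->] [v vs ->]].
rewrite fl (fP y) ?scaler0 ?add0r ?IHs //; last exact/sP/mem_head.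
by move=> z zs; apply: sP; rewrite inE zs orbT.
Qed.

(** The vectors C_(S,T0) v0 transform under A like the basis of the cell module, and L is generated
    by any nonzero one of them. On these vectors C_(S,T) has values in the line of its own row S. *)
Lemma cellular_split : split_alg A.
Proof.
move=> L sL.
pose p (lam : Lam D) := exists (S T : tab D n lam) (v : L), mact (cbas D S T : A) v <> 0.
have [s sP] := cell_labels.
have [lam _ [[S0 [T0 [v0 v0P]]] lmin]] : exists2 lam, lam \in s & p lam /\
    forall mu, mu \in s -> p mu -> ~~ (mu < lam)%O.
  suff [lam [S [T [v vP]]]] : exists lam, p lam.
    by apply: (seq_minimal (x := lam)); [exact: sP S T | exists S, T, v].
  apply: contrapT => np; case: (sL) => L0 _; apply: L0; apply: fullv_eq0 => v.
  case: (cell_basis D n n) => X bX XP; rewrite -[v]mact1.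
  apply: (in_span_kill (P := fun x => x \in X) (@mact_linl K A L v)).
    move=> x /XP [lam [S [T ->]]]; apply: contrapT => nz; apply: np.
    by exists lam, S, T, v.
  by exists X => //; rewrite (span_basis bX) memvf.
(* By minimality of [lam] the lower layers act by zero, so the congruence (C3) becomes an equality
   on L. *)
have kill x (v : L) : lower_span (p := n) (n := n) lam x -> mact (x : A) v = 0.
  have ll : linear (fun x : hom C n n => mact (x : A) v) := @mact_linl K A L v.
  apply: (in_span_kill ll) => {x} _ [mu [S [T [mulam ->]]]].
  apply: contrapT => nz; have := lmin mu (sP mu S T); rewrite mulam => h.
  by have : p mu by [exists S, T, v]; move/h.
pose w (S : tab D n lam) : L := mact (cbas D S T0 : A) v0.
have actw (a : A) S : mact a (w S) = \sum_S' cell_r D a S' S *: w S'.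
  have /(kill _ v0) := cell_mul D a S T0.
  rewrite (linB (@mact_linl K A L v0)) mactM => /eqP; rewrite subr_eq0 => /eqP ->.
  have ll := @mact_linl K A L v0.
  rewrite (big_morph (fun a : A => mact a v0) (linD ll) (lin0 ll)).
  by apply: eq_bigr => S' _; exact: (linZ ll).
have w0 : w S0 != 0 by apply/eqP.
have cbasw S T v : exists c, mact (cbas D S T : A) v = c *: w S.
  have [a ->] := simple_cyclic sL w0 v.
  rewrite actw linear_sum; exists (\sum_Z cell_r D a Z S0 * cell_r D (cbas D S T) S Z).
  rewrite scaler_suml; apply: eq_bigr => Z _; rewrite linearZ /= actw -scalerA.
  rewrite (bigD1 S) //= big1 ?addr0 // => S' nS.
  by rewrite cell_r_cbas // scale0r.
(* C_(S0,T0) maps [v0] to [w S0]; preceding it by an element that moves [w S0] back to [v0] makes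
   the product fix [w S0]. *)
have [b bE] := simple_cyclic sL w0 v0.
exists ((cbas D S0 T0 : A) ⋅ b), (w S0); split=> //; first by rewrite mactM -bE.
by move=> v; rewrite mactM.
Qed.
End CellularSplit.

(** * Associativity of induction *)

Section InductionAssociativity.
Variables (K : fieldType) (A B C D1 D2 E : fdAlgType K).
Variables (f : alghom (tens A B) D1) (g : alghom (tens D1 C) E).
Variables (f' : alghom (tens B C) D2) (g' : alghom (tens A D2) E).
Hypothesis fg : forall a b c, g (f (a ⊗ b) ⊗ c) = g' (a ⊗ f' (b ⊗ c)).
Variables (M : fdMod A) (N : fdMod B) (P : fdMod C).

Let X := indmod g (tensmod (indmod f (tensmod M N)) P).
Let Y := indmod g' (tensmod M (indmod f' (tensmod N P))).
Let x (m : M) (n : N) (p : P) : X :=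
  ipure g aone ((ipure f aone (m ⊗ n : tensmod M N) ⊗ p) : tensmod (indmod f (tensmod M N)) P).
Let y (m : M) (n : N) (p : P) : Y :=
  ipure g' aone ((m ⊗ ipure f' aone (n ⊗ p : tensmod N P)) : tensmod M (indmod f' (tensmod N P))).

Lemma indlift_param (A0 B0 : fdAlgType K) (f0 : alghom B0 A0) (M0 : fdMod B0)
    (Z : fdMod A0) (Q : lmodType K) (h : Q -> M0 -> Z) :
  (forall m, linear (fun q => h q m)) ->
  forall w : indmod f0 M0, linear (fun q => indlift (h q) w).
Proof.
move=> hl w; apply: tlift_param => a m c q q'.
by rewrite hl mact_linr.
Qed.

Section Lift.
Variables (Z : fdMod E) (t : M -> N -> P -> Z).
Hypotheses (tM : forall n p, linear (fun m => t m n p))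
  (tN : forall m p, linear (fun n => t m n p)) (tP : forall m n, linear (t m n))
  (tE : forall a b c m n p,
     t (mact a m) (mact b n) (mact c p) = mact (g (f (a ⊗ b) ⊗ c)) (t m n p)).

Let t2b p : bilin (fun m n => t m n p). Proof. by split. Qed.
Let ZD := resmod (alghom_comp g (tens_inl D1 C)) Z.
Let hp p : tensmod M N -> ZD := tlift (fun m n => t m n p).
Let ZDE d (z : Z) : mact d (z : ZD) = mact (g (d ⊗ aone)) z.
Proof. by rewrite /= comp_lfunE -[alghom_fun (tens_inl _ _) _]/(tens_inl D1 C d) tens_inlE. Qed.
Let hpl p : linear (hp p). Proof. by move=> c u v; rewrite /hp linearP. Qed.
Let hpP z : linear (fun p => hp p z).
Proof. by apply: tlift_param => u v c p p'; rewrite tP. Qed.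
Let hph p w (z : tensmod M N) : hp p (mact w z) = mact (f w) (hp p z).
Proof.
apply: (@modhom_pure K A B M N (resmod f ZD) (hp p)) => // a b m n.
rewrite /hp !tlift_pure // -[in LHS](mact1 p) tE.
by rewrite -[RHS]/(mact (f (a ⊗ b)) (t m n p : ZD)) ZDE.
Qed.
Let H (w : indmod f (tensmod M N)) (p : P) : Z := indlift (hp p) w.
Let Hb : bilin H.
Proof. by split=> [p|w]; [exact: (@indlift_linear K D1 _ f _ ZD (hp p)) |
  exact: (@indlift_param D1 _ f _ ZD P hp)]. Qed.
Let hpC c p z : hp (mact c p) z = mact (g (aone ⊗ c)) (hp p z).
Proof.
have l1 : linear (fun z => mact (g (aone ⊗ c)) (hp p z : Z)).
  by move=> k u v; rewrite hpl mact_linr.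
apply: (tens_ext (hpl _) l1) => m n.
rewrite /hp !tlift_pure // -[m in LHS]mact1 -[n in LHS]mact1 tE.
by rewrite -[aone ⊗ aone]/(aone : tens A B) alghom1.
Qed.
Let HC c w p : H w (mact c p) = mact (g (aone ⊗ c)) (H w p).
Proof.
move: w; have l1 : linear (fun w => mact (g (aone ⊗ c)) (H w p)).
  by move=> k u v; rewrite Hb.1 mact_linr.
apply: (indmod_ext (Hb.1 _) l1) => d z; rewrite /H !indlift_pure //.
rewrite !ZDE hpC -!mactM -!alghomM; congr (mact (g _) _).
by rewrite [LHS]tens_mul_pure [RHS]tens_mul_pure !amul1l !amul1r.
Qed.
Let HD d w p : H (mact d w) p = mact (g (d ⊗ aone)) (H w p).
Proof. by rewrite /H indlift_hom // ZDE. Qed.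

(** For fixed [p] the map [t] extends over the inner induction to [H], with values in [Z] restricted
    to D1. As [H] is bilinear and equivariant in both arguments, it extends over the outer
    induction. *)
Lemma ind3l_lift : exists F : X -> Z, [/\ linear F,
  forall e v, F (mact e v) = mact e (F v) & forall m n p, F (x m n p) = t m n p].
Proof.
have hl : linear (tlift H) by move=> c u v; rewrite linearP.
have hh d (v : tensmod (indmod f (tensmod M N)) P) :
    tlift H (mact d v) = mact (g d) (tlift H v).
  apply: (@modhom_pure K D1 C _ _ (resmod g Z) (tlift H)) => // a c w p.
  rewrite !tlift_pure // HD HC -mactM -alghomM [_ ⋅ _]tens_mul_pure.
  by rewrite amul1l amul1r.
pose T3 := tensmod (indmod f (tensmod M N)) P.
exists (indlift (M := T3) (X := Z) (tlift H)); split.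
- exact: indlift_linear.
- by move=> e v; rewrite indlift_hom.
- move=> m n p; rewrite /x indlift_pure // mact1 tlift_pure // /H indlift_pure //.
  by rewrite mact1 /hp tlift_pure.
Qed.
End Lift.

(** The vectors [x m n p] generate X over E: elements of E are pulled out of the outer induction,
    then elements of D1 out of the inner one through d ⊗ 1. *)
Lemma ind3l_ext (Z : fdMod E) (F G : X -> Z) : linear F -> linear G ->
  (forall e v, F (mact e v) = mact e (F v)) -> (forall e v, G (mact e v) = mact e (G v)) ->
  (forall m n p, F (x m n p) = G (x m n p)) -> F =1 G.
Proof.
move=> Fl Gl Fh Gh FG; apply: (indmod_ext Fl Gl) => e v.
rewrite ipure_gen Fh Gh; congr (mact _ _); move: v.
have lin (F0 : X -> Z) : linear F0 -> linear (fun v => F0 (ipure g aone v)).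
  by move=> F0l c u v; rewrite (ipure_bilin _ _).2 F0l.
apply: (tens_ext (lin _ Fl) (lin _ Gl)) => w p; move: w.
have lin' (F0 : X -> Z) : linear F0 -> linear (fun w =>
    F0 (ipure g aone (w ⊗ p : tensmod (indmod f (tensmod M N)) P))).
  by move=> F0l c u v; rewrite tpureL (ipure_bilin _ _).2 F0l.
apply: (indmod_ext (lin' _ Fl) (lin' _ Gl)) => d v; rewrite (ipure_gen f d v).
have step (F0 : X -> Z) w : (forall e v, F0 (mact e v) = mact e (F0 v)) ->
    F0 (ipure g aone (mact d w ⊗ p : tensmod (indmod f (tensmod M N)) P)) =
    mact (g (d ⊗ aone)) (F0 (ipure g aone (w ⊗ p : tensmod (indmod f (tensmod M N)) P))).
  move=> F0h; rewrite -F0h ipure_act amul1r; congr F0.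
  rewrite -[g _ in RHS]amul1l ipure_bal; congr ipure.
  by rewrite [RHS]tens_act_pure mact1.
rewrite [LHS](step F) // [RHS](step G) //; congr (mact _ _); move: v.
have lin'' (F0 : X -> Z) : linear F0 ->
    linear (fun v => F0 (ipure g aone
      (ipure f aone (v : tensmod M N) ⊗ p : tensmod (indmod f (tensmod M N)) P))).
  by move=> F0l c u v; rewrite (ipure_bilin f _).2 tpureL (ipure_bilin _ _).2 F0l.
by apply: (tens_ext (lin'' _ Fl) (lin'' _ Gl)) => m n; exact: FG.
Qed.

Section LiftR.
Variables (Z : fdMod E) (t : M -> N -> P -> Z).
Hypotheses (tM : forall n p, linear (fun m => t m n p))
  (tN : forall m p, linear (fun n => t m n p)) (tP : forall m n, linear (t m n))
  (tE : forall a b c m n p,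
     t (mact a m) (mact b n) (mact c p) = mact (g' (a ⊗ f' (b ⊗ c))) (t m n p)).

Let t2b m : bilin (t m). Proof. by split. Qed.
Let ZD := resmod (alghom_comp g' (tens_inr A D2)) Z.
Let hm m : tensmod N P -> ZD := tlift (t m).
Let ZDE d (z : Z) : mact d (z : ZD) = mact (g' (aone ⊗ d)) z.
Proof. by rewrite /= comp_lfunE -[alghom_fun (tens_inr _ _) _]/(tens_inr A D2 d) tens_inrE. Qed.
Let hml m : linear (hm m). Proof. by move=> c u v; rewrite /hm linearP. Qed.
Let hmM z : linear (fun m => hm m z).
Proof. by apply: tlift_param => u v c m m'; rewrite tM. Qed.
Let hmh m w (z : tensmod N P) : hm m (mact w z) = mact (f' w) (hm m z).
Proof.
apply: (@modhom_pure K B C N P (resmod f' ZD) (hm m)) => // b c n p.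
rewrite /hm !tlift_pure // -[in LHS](mact1 m) tE.
by rewrite -[RHS]/(mact (f' (b ⊗ c)) (t m n p : ZD)) ZDE.
Qed.
Let H (m : M) (w : indmod f' (tensmod N P)) : Z := indlift (hm m) w.
Let Hb : bilin H.
Proof.
by split=> [w|m]; [exact: (@indlift_param D2 _ f' _ ZD M hm) |
  exact: (@indlift_linear K D2 _ f' _ ZD (hm m))].
Qed.
Let hmA a m z : hm (mact a m) z = mact (g' (a ⊗ aone)) (hm m z).
Proof.
have l1 : linear (fun z => mact (g' (a ⊗ aone)) (hm m z : Z)).
  by move=> k u v; rewrite hml mact_linr.
apply: (tens_ext (hml _) l1) => n p.
rewrite /hm !tlift_pure // -[n in LHS]mact1 -[p in LHS]mact1 tE.
by rewrite -[aone ⊗ aone]/(aone : tens B C) alghom1.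
Qed.
Let HA a m w : H (mact a m) w = mact (g' (a ⊗ aone)) (H m w).
Proof.
move: w; have l1 : linear (fun w => mact (g' (a ⊗ aone)) (H m w)).
  by move=> k u v; rewrite Hb.2 mact_linr.
apply: (indmod_ext (Hb.2 _) l1) => d z; rewrite /H !indlift_pure //.
rewrite !ZDE hmA -!mactM -!alghomM; congr (mact (g' _) _).
by rewrite [LHS]tens_mul_pure [RHS]tens_mul_pure !amul1l !amul1r.
Qed.
Let HD d m w : H m (mact d w) = mact (g' (aone ⊗ d)) (H m w).
Proof. by rewrite /H indlift_hom // ZDE. Qed.

Lemma ind3r_lift : exists F : Y -> Z, [/\ linear F,
  forall e v, F (mact e v) = mact e (F v) & forall m n p, F (y m n p) = t m n p].
Proof.
have hl : linear (tlift H) by move=> c u v; rewrite linearP.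
have hh d (v : tensmod M (indmod f' (tensmod N P))) :
    tlift H (mact d v) = mact (g' d) (tlift H v).
  apply: (@modhom_pure K A D2 _ _ (resmod g' Z) (tlift H)) => // a c m w.
  rewrite !tlift_pure // HD HA -mactM -alghomM [_ ⋅ _]tens_mul_pure.
  by rewrite amul1l amul1r.
pose T3 := tensmod M (indmod f' (tensmod N P)).
exists (indlift (M := T3) (X := Z) (tlift H)); split.
- exact: indlift_linear.
- by move=> e v; rewrite indlift_hom.
- move=> m n p; rewrite /y indlift_pure // mact1 tlift_pure // /H indlift_pure //.
  by rewrite mact1 /hm tlift_pure.
Qed.
End LiftR.

Lemma ind3r_ext (Z : fdMod E) (F G : Y -> Z) : linear F -> linear G ->
  (forall e v, F (mact e v) = mact e (F v)) -> (forall e v, G (mact e v) = mact e (G v)) ->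
  (forall m n p, F (y m n p) = G (y m n p)) -> F =1 G.
Proof.
move=> Fl Gl Fh Gh FG; apply: (indmod_ext Fl Gl) => e v.
rewrite ipure_gen Fh Gh; congr (mact _ _); move: v.
have lin (F0 : Y -> Z) : linear F0 -> linear (fun v => F0 (ipure g' aone v)).
  by move=> F0l c u v; rewrite (ipure_bilin _ _).2 F0l.
apply: (tens_ext (lin _ Fl) (lin _ Gl)) => m w; move: w.
have lin' (F0 : Y -> Z) : linear F0 -> linear (fun w =>
    F0 (ipure g' aone (m ⊗ w : tensmod M (indmod f' (tensmod N P))))).
  by move=> F0l c u v; rewrite tpureR (ipure_bilin _ _).2 F0l.
apply: (indmod_ext (lin' _ Fl) (lin' _ Gl)) => d v; rewrite (ipure_gen f' d v).
have step (F0 : Y -> Z) w : (forall e v, F0 (mact e v) = mact e (F0 v)) ->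
    F0 (ipure g' aone (m ⊗ mact d w : tensmod M (indmod f' (tensmod N P)))) =
    mact (g' (aone ⊗ d)) (F0 (ipure g' aone (m ⊗ w : tensmod M (indmod f' (tensmod N P))))).
  move=> F0h; rewrite -F0h ipure_act amul1r; congr F0.
  rewrite -[g' _ in RHS]amul1l ipure_bal; congr ipure.
  by rewrite [RHS]tens_act_pure mact1.
rewrite [LHS](step F) // [RHS](step G) //; congr (mact _ _); move: v.
have lin'' (F0 : Y -> Z) : linear F0 -> linear (fun v => F0 (ipure g' aone
    (m ⊗ ipure f' aone (v : tensmod N P) : tensmod M (indmod f' (tensmod N P))))).
  by move=> F0l c u v; rewrite (ipure_bilin f' _).2 tpureR (ipure_bilin _ _).2 F0l.
by apply: (tens_ext (lin'' _ Fl) (lin'' _ Gl)) => n p; exact: FG.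
Qed.

Lemma ind_assoc : modiso X Y.
Proof.
have xl1 n p : linear (fun m => x m n p).
  by move=> c u v; rewrite /x tpureL (ipure_bilin f _).2 tpureL (ipure_bilin g _).2.
have xl2 m p : linear (fun n => x m n p).
  by move=> c u v; rewrite /x tpureR (ipure_bilin f _).2 tpureL (ipure_bilin g _).2.
have xl3 m n : linear (fun p => x m n p).
  by move=> c u v; rewrite /x tpureR (ipure_bilin g _).2.
have yl1 n p : linear (fun m => y m n p).
  by move=> c u v; rewrite /y tpureL (ipure_bilin g' _).2.
have yl2 m p : linear (fun n => y m n p).
  by move=> c u v; rewrite /y tpureL (ipure_bilin f' _).2 tpureR (ipure_bilin g' _).2.
have yl3 m n : linear (fun p => y m n p).
  by move=> c u v; rewrite /y tpureR (ipure_bilin f' _).2 tpureR (ipure_bilin g' _).2.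
have xE a b c m n p : x (mact a m) (mact b n) (mact c p) =
    mact (g (f (a ⊗ b) ⊗ c)) (x m n p).
  rewrite /x ipure_act amul1r -[g _]amul1l ipure_bal; congr ipure.
  rewrite [RHS]tens_act_pure; congr (_ ⊗ _).
  rewrite ipure_act amul1r -[f _]amul1l ipure_bal; congr ipure.
  by rewrite [RHS]tens_act_pure.
have yE a b c m n p : y (mact a m) (mact b n) (mact c p) =
    mact (g' (a ⊗ f' (b ⊗ c))) (y m n p).
  rewrite /y ipure_act amul1r -[g' _]amul1l ipure_bal; congr ipure.
  rewrite [RHS]tens_act_pure; congr (_ ⊗ _).
  rewrite ipure_act amul1r -[f' _]amul1l ipure_bal; congr ipure.
  by rewrite [RHS]tens_act_pure.
(* By [fg] the vectors [y] are equivariant as required of trilinear maps out of X, and the vectors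
   [x] as required out of Y. The two lifts exchange [x] and [y], hence are inverse to each other. *)
have [a b c m n p|F [Fl Fh FE]] := ind3l_lift yl1 yl2 yl3; first by rewrite yE fg.
have [a b c m n p|G [Gl Gh GE]] := ind3r_lift xl1 xl2 xl3; first by rewrite xE fg.
have FGl : linear (fun v => F (G v)) by move=> c u w; rewrite Gl Fl.
have GFl : linear (fun v => G (F v)) by move=> c u w; rewrite Fl Gl.
have FG : (fun v => F (G v)) =1 idfun.
  apply: (ind3r_ext FGl) => [//|e w|//|m n p]; first by rewrite Gh Fh.
  by rewrite GE FE.
have GF : (fun v => G (F v)) =1 idfun.
  apply: (ind3l_ext GFl) => [//|e w|//|m n p]; first by rewrite Fh Gh.
  by rewrite FE GE.
apply: (modiso_intro Fl Fh); first exact: (can_inj (g := G) GF).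
by move=> w; exists (G w); rewrite FG.
Qed.
End InductionAssociativity.

(** * The unit module *)

Section TensorUnit.
Variables (K : fieldType) (A B E : fdAlgType K) (phi : alghom A K^o).
Hypothesis phi_bij : bijective phi.
Notation k := (resmod phi (regmod K^o)).

Lemma alghom_scalar (a : A) : a = (phi a : K) *: (aone : A).
Proof.
apply: (bij_inj phi_bij); rewrite linearZ /= alghom1.
by rewrite -[LHS]mulr1.
Qed.

Lemma alghom_unitl (f : alghom (tens A B) E) a b :
  f (a ⊗ b) = (phi a : K) *: f (aone ⊗ b).
Proof. by rewrite {1}[a]alghom_scalar (linZ (tpureL b)) linearZ. Qed.

Lemma alghom_unitr (f : alghom (tens B A) E) a b :
  f (b ⊗ a) = (phi a : K) *: f (b ⊗ aone).
Proof. by rewrite {1}[a]alghom_scalar (linZ (tpureR b)) linearZ. Qed.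

(** The scalar multiplication c ⊗ z |-> c z extends to the induced module. Its inverse is z |-> 1 ⊗
    (1 ⊗ z), because by [fs] each element of E can be moved across the balanced tensor. *)
Lemma ind_unitl (f : alghom (tens A B) E) (Z : fdMod E) :
  (forall e, exists b, e = f (aone ⊗ b)) ->
  modiso (indmod f (tensmod k (resmod (alghom_comp f (tens_inr A B)) Z))) Z.
Proof.
move=> fs; set N := resmod _ Z.
have NE b (z : Z) : mact b (z : N) = mact (f (aone ⊗ b)) z.
  by rewrite /= comp_lfunE -[alghom_fun (tens_inr _ _) _]/(tens_inr A B b) tens_inrE.
have hb : bilin (fun (c : k) (z : N) => (c : K) *: z : Z).
  split=> [z|c] d x y; last by rewrite scalerDr !scalerA mulrC.
  by rewrite scalerDl scalerA.
pose h : tensmod k N -> Z := tlift (fun (c : k) (z : N) => (c : K) *: z : Z).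
have hl : linear h by move=> c u v; rewrite /h linearP.
have hh x (t : tensmod k N) : h (mact x t) = mact (f x) (h t).
  apply: (@modhom_pure K A B _ _ (resmod f Z) h) => // a b c z.
  rewrite /h !tlift_pure // NE -[RHS]/(mact (f (a ⊗ b)) ((c : K) *: (z : Z))).
  rewrite (alghom_unitl f a b) (linZ (mact_linl _)) (linZ (mact_linr _)) scalerA.
  by congr (_ *: _).
pose F : indmod f (tensmod k N) -> Z := indlift h.
have Fl : linear F by exact: indlift_linear.
have Fh e v : F (mact e v) = mact e (F v) by exact: indlift_hom.
have FE e (c : k) (z : N) : F (ipure f e (c ⊗ z : tensmod k N)) = (c : K) *: mact e (z : Z).
  by rewrite /F indlift_pure // /h tlift_pure // linearZ.
pose G (z : Z) : indmod f (tensmod k N) := ipure f aone ((1 : K^o) ⊗ z : tensmod k N).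
have Gl : linear G.
  by move=> c u v; rewrite /G (tpureR (U := k) (V := N)) (ipure_bilin _ _).2.
have FG z : F (G z) = z by rewrite /G FE mact1 scale1r.
have GFl : linear (fun v => G (F v)) by move=> c u v; rewrite Fl Gl.
have GF : (fun v => G (F v)) =1 idfun.
  apply: (indmod_ext GFl) => // e t; move: t.
  have l1 : linear (fun t => G (F (ipure f e t))).
    by move=> c u v; rewrite (ipure_bilin f _).2 GFl.
  have l2 : linear (fun t : tensmod k N => ipure f e t) := (ipure_bilin f _).2 e.
  apply: (tens_ext l1 l2) => c z; rewrite FE; have [b ->] := fs e.
  rewrite -[f _ in RHS]amul1l ipure_bal /G; congr ipure.
  rewrite [RHS]tens_act_pure mact1 NE (linZ (tpureR _)) -(linZ (tpureL _)).
  by rewrite /GRing.scale /= mulr1.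
apply: (modiso_intro Fl Fh); first exact: (can_inj (g := G) GF).
by move=> z; exists (G z).
Qed.

Lemma ind_unitr (f : alghom (tens B A) E) (Z : fdMod E) :
  (forall e, exists b, e = f (b ⊗ aone)) ->
  modiso (indmod f (tensmod (resmod (alghom_comp f (tens_inl B A)) Z) k)) Z.
Proof.
move=> fs; set N := resmod _ Z.
have NE b (z : Z) : mact b (z : N) = mact (f (b ⊗ aone)) z.
  by rewrite /= comp_lfunE -[alghom_fun (tens_inl _ _) _]/(tens_inl B A b) tens_inlE.
have hb : bilin (fun (z : N) (c : k) => (c : K) *: z : Z).
  split=> [c|z] d x y; first by rewrite scalerDr !scalerA mulrC.
  by rewrite scalerDl scalerA.
pose h : tensmod N k -> Z := tlift (fun (z : N) (c : k) => (c : K) *: z : Z).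
have hl : linear h by move=> c u v; rewrite /h linearP.
have hh x (t : tensmod N k) : h (mact x t) = mact (f x) (h t).
  apply: (@modhom_pure K B A _ _ (resmod f Z) h) => // b a z c.
  rewrite /h !tlift_pure // NE -[RHS]/(mact (f (b ⊗ a)) ((c : K) *: (z : Z))).
  rewrite (alghom_unitr f a b) (linZ (mact_linl _)) (linZ (mact_linr _)) scalerA.
  by congr (_ *: _).
pose F : indmod f (tensmod N k) -> Z := indlift h.
have Fl : linear F by exact: indlift_linear.
have Fh e v : F (mact e v) = mact e (F v) by exact: indlift_hom.
have FE e (z : N) (c : k) : F (ipure f e (z ⊗ c : tensmod N k)) = (c : K) *: mact e (z : Z).
  by rewrite /F indlift_pure // /h tlift_pure // linearZ.
pose G (z : Z) : indmod f (tensmod N k) := ipure f aone (z ⊗ (1 : K^o) : tensmod N k).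
have Gl : linear G.
  by move=> c u v; rewrite /G (tpureL (U := N) (V := k)) (ipure_bilin _ _).2.
have FG z : F (G z) = z by rewrite /G FE mact1 scale1r.
have GFl : linear (fun v => G (F v)) by move=> c u v; rewrite Fl Gl.
have GF : (fun v => G (F v)) =1 idfun.
  apply: (indmod_ext GFl) => // e t; move: t.
  have l1 : linear (fun t => G (F (ipure f e t))).
    by move=> c u v; rewrite (ipure_bilin f _).2 GFl.
  have l2 : linear (fun t : tensmod N k => ipure f e t) := (ipure_bilin f _).2 e.
  apply: (tens_ext l1 l2) => z c; rewrite FE; have [b ->] := fs e.
  rewrite -[f _ in RHS]amul1l ipure_bal /G; congr ipure.
  rewrite [RHS]tens_act_pure mact1 NE (linZ (tpureL _)) -(linZ (tpureR _)).
  by rewrite /GRing.scale /= mulr1.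
apply: (modiso_intro Fl Fh); first exact: (can_inj (g := G) GF).
by move=> z; exists (G z).
Qed.

Lemma res_unitl (f : alghom (tens A B) E) (Z : fdMod E) :
  modiso (resmod f Z) (tensmod k (resmod (alghom_comp f (tens_inr A B)) Z)).
Proof.
set N := resmod (alghom_comp _ _) Z.
have NE b (z : Z) : mact b (z : N) = mact (f (aone ⊗ b)) z.
  by rewrite /= comp_lfunE -[alghom_fun (tens_inr _ _) _]/(tens_inr A B b) tens_inrE.
pose G (z : resmod f Z) : tensmod k N := (1 : K^o) ⊗ z.
have Gl : linear G by exact: (tpureR (U := k) (V := N)).
have hb : bilin (fun (c : k) (z : N) => (c : K) *: z : Z).
  split=> [z|c] d x y; last by rewrite scalerDr !scalerA mulrC.
  by rewrite scalerDl scalerA.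
apply: (modiso_intro Gl).
- move=> x z.
  have l1 : linear (fun x : tens A B => G (mact x z)).
    by move=> c u v; rewrite mact_linl Gl.
  have l2 : linear (fun x : tens A B => mact x (G z)).
    by move=> c u v; rewrite mact_linl.
  apply: (tens_ext l1 l2) => a b; rewrite /G [RHS]tens_act_pure NE.
  rewrite -[mact (a ⊗ b) z]/(mact (f (a ⊗ b)) (z : Z)).
  rewrite (alghom_unitl f a b) (linZ (mact_linl _)).
  rewrite (linZ (tpureR _)) -(linZ (tpureL _)); congr (_ ⊗ _).
- move=> u v /(congr1 (tlift (fun (c : k) (z : N) => (c : K) *: z : Z))).
  by rewrite /G !tlift_pure // !scale1r.
- move=> t; exists (tlift (fun (c : k) (z : N) => (c : K) *: z : Z) t).
  have l1 : linear (fun t => G (tlift (fun (c : k) (z : N) => (c : K) *: z : Z) t)).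
    by move=> c u v; rewrite tlift_linear Gl.
  apply: (tens_ext (f := idfun) _ l1) => // c z.
  rewrite tlift_pure // /G (linZ (tpureR _)) -(linZ (tpureL _)).
  by rewrite /GRing.scale /= mulr1.
Qed.

Lemma res_unitr (f : alghom (tens B A) E) (Z : fdMod E) :
  modiso (resmod f Z) (tensmod (resmod (alghom_comp f (tens_inl B A)) Z) k).
Proof.
set N := resmod (alghom_comp _ _) Z.
have NE b (z : Z) : mact b (z : N) = mact (f (b ⊗ aone)) z.
  by rewrite /= comp_lfunE -[alghom_fun (tens_inl _ _) _]/(tens_inl B A b) tens_inlE.
pose G (z : resmod f Z) : tensmod N k := (z : N) ⊗ (1 : K^o).
have Gl : linear G by exact: (tpureL (U := N) (V := k)).
have hb : bilin (fun (z : N) (c : k) => (c : K) *: z : Z).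
  split=> [c|z] d x y; first by rewrite scalerDr !scalerA mulrC.
  by rewrite scalerDl scalerA.
apply: (modiso_intro Gl).
- move=> x z.
  have l1 : linear (fun x : tens B A => G (mact x z)).
    by move=> c u v; rewrite mact_linl Gl.
  have l2 : linear (fun x : tens B A => mact x (G z)).
    by move=> c u v; rewrite mact_linl.
  apply: (tens_ext l1 l2) => b a; rewrite /G [RHS]tens_act_pure NE.
  rewrite -[mact (b ⊗ a) z]/(mact (f (b ⊗ a)) (z : Z)).
  rewrite (alghom_unitr f a b) (linZ (mact_linl _)).
  rewrite (linZ (tpureL _)) -(linZ (tpureR _)); congr (_ ⊗ _).
- move=> u v /(congr1 (tlift (fun (z : N) (c : k) => (c : K) *: z : Z))).
  by rewrite /G !tlift_pure // !scale1r.
- move=> t; exists (tlift (fun (z : N) (c : k) => (c : K) *: z : Z) t).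
  have l1 : linear (fun t => G (tlift (fun (z : N) (c : k) => (c : K) *: z : Z) t)).
    by move=> c u v; rewrite tlift_linear Gl.
  apply: (tens_ext (f := idfun) _ l1) => // z c.
  rewrite tlift_pure // /G (linZ (tpureL _)) -(linZ (tpureR _)).
  by rewrite /GRing.scale /= mulr1.
Qed.
End TensorUnit.

(** * Restriction along maps of tensor products *)

Section TensorHoms.
Variable K : fieldType.

Section Map.
Variables (A B A' B' : fdAlgType K) (f : alghom A A') (g : alghom B B').
Fact tens_hom1 : lin_hom (tmap_linear f g) aone = aone.
Proof.
rewrite lin_homE -[LHS]/(tmap f g (aone ⊗ aone)) tmap_pure; try exact: lfun_linear.
by rewrite !alghom1.
Qed.
Fact tens_homM : {morph lin_hom (tmap_linear f g) : x y / x ⋅ y}.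
Proof.
move=> x y; rewrite !lin_homE.
have l1 : linear (fun x => tmap f g (x ⋅ y)).
  by move=> c u v; rewrite amul_linl tmap_linear.
have l2 : linear (fun x => tmap f g x ⋅ tmap f g y).
  by move=> c u v; rewrite tmap_linear amul_linl.
apply: (tens_ext l1 l2) => a b {x l1 l2}.
have l1 : linear (fun y => tmap f g ((a ⊗ b : tens A B) ⋅ y)).
  by move=> c u v; rewrite amul_linr tmap_linear.
have l2 : linear (fun y => tmap f g (a ⊗ b) ⋅ tmap f g y).
  by move=> c u v; rewrite tmap_linear amul_linr.
apply: (tens_ext l1 l2) => a' b' {y l1 l2}.
rewrite [_ ⋅ _]tens_mul_pure !tmap_pure; try exact: lfun_linear.
by rewrite !alghomM [RHS]tens_mul_pure.
Qed.
Definition tens_hom : alghom (tens A B) (tens A' B') := AlgHom tens_hom1 tens_homM.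
Lemma tens_homE a b : tens_hom (a ⊗ b) = f a ⊗ g b.
Proof. by rewrite [LHS]lin_homE tmap_pure //; exact: lfun_linear. Qed.

Lemma tensmod_resmod (M : fdMod A') (N : fdMod B') :
  modiso (tensmod (resmod f M) (resmod g N)) (resmod tens_hom (tensmod M N)).
Proof.
(* Restriction keeps the carrier, so both sides are the same space and only the actions are
   compared. *)
pose h : tens (resmod f M) (resmod g N) -> resmod tens_hom (tensmod M N) := id.
have hl : linear h by [].
apply: (@modiso_intro K _ (tensmod (resmod f M) (resmod g N))
  (resmod tens_hom (tensmod M N)) h) => //; last by move=> w; exists w.
apply: (modhom_pure hl) => a b m n; rewrite /h.
by rewrite -[RHS]/(mact (tens_hom (a ⊗ b)) (m ⊗ n : tensmod M N)) tens_homE [RHS]tens_act_pure.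
Qed.
End Map.

Section Assoc.
Variables U V W : vectType K.

Lemma tpure3_bilin (u : U) : bilin (fun (v : V) (w : W) => u ⊗ v ⊗ w).
Proof. by split=> [w|v] c x y; rewrite ?tpureR ?tpureL. Qed.
Lemma tpure3_bilin' (w : W) : bilin (fun (u : U) (v : V) => u ⊗ (v ⊗ w)).
Proof. by split=> [v|u] c x y; rewrite ?tpureL ?tpureR. Qed.

Definition tassoc : tens U (tens V W) -> tens (tens U V) W :=
  tlift (fun u => tlift (fun v w => u ⊗ v ⊗ w)).
Definition tassoc' : tens (tens U V) W -> tens U (tens V W) :=
  tlift (fun t w => tlift (fun u v => u ⊗ (v ⊗ w)) t).
Lemma tassoc_linear : linear tassoc. Proof. by move=> c x y; rewrite /tassoc linearP. Qed.
Lemma tassoc'_linear : linear tassoc'. Proof. by move=> c x y; rewrite /tassoc' linearP. Qed.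
Lemma tassocE u v w : tassoc (u ⊗ (v ⊗ w)) = u ⊗ v ⊗ w.
Proof.
rewrite /tassoc tlift_pure ?tlift_pure //; first exact: tpure3_bilin.
split=> [t|{}u]; last exact: tlift_linear.
by apply: tlift_param => v' w' c x y; rewrite !tpureL.
Qed.
Lemma tassoc'E u v w : tassoc' (u ⊗ v ⊗ w) = u ⊗ (v ⊗ w).
Proof.
rewrite /tassoc' tlift_pure ?tlift_pure //; first exact: tpure3_bilin'.
split=> [w'|t]; first exact: tlift_linear.
by apply: tlift_param => u' v' c x y; rewrite !tpureR.
Qed.

Lemma tens3_ext (Z : lmodType K) (F G : tens U (tens V W) -> Z) : linear F -> linear G ->
  (forall u v w, F (u ⊗ (v ⊗ w)) = G (u ⊗ (v ⊗ w))) -> F =1 G.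
Proof.
move=> Fl Gl FG; apply: (tens_ext Fl Gl) => u; apply: tens_ext => [c x y|c x y|v w].
- by rewrite tpureR Fl.
- by rewrite tpureR Gl.
- exact: FG.
Qed.
Lemma tens3_ext' (Z : lmodType K) (F G : tens (tens U V) W -> Z) : linear F -> linear G ->
  (forall u v w, F (u ⊗ v ⊗ w) = G (u ⊗ v ⊗ w)) -> F =1 G.
Proof.
move=> Fl Gl FG; apply: (tens_ext Fl Gl) => t w; move: t; apply: tens_ext => [c x y|c x y|u v].
- by rewrite tpureL Fl.
- by rewrite tpureL Gl.
- exact: FG.
Qed.
Lemma tassocK : cancel tassoc tassoc'.
Proof.
apply: (tens3_ext (F := fun t => tassoc' (tassoc t)) (G := idfun)) => // [c x y|u v w].
  by rewrite tassoc_linear tassoc'_linear.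
by rewrite tassocE tassoc'E.
Qed.
Lemma tassoc'K : cancel tassoc' tassoc.
Proof.
apply: (tens3_ext' (F := fun t => tassoc (tassoc' t)) (G := idfun)) => // [c x y|u v w].
  by rewrite tassoc'_linear tassoc_linear.
by rewrite tassoc'E tassocE.
Qed.
End Assoc.

Section AssocHom.
Variables A B C : fdAlgType K.
Fact tens_assoc1 : lin_hom (@tassoc_linear A B C) aone = aone.
Proof. by rewrite lin_homE; exact: tassocE. Qed.
Fact tens_assocM : {morph lin_hom (@tassoc_linear A B C) : x y / x ⋅ y}.
Proof.
move=> x y; rewrite !lin_homE.
have l1 : linear (fun x => tassoc (x ⋅ y)).
  by move=> c u v; rewrite amul_linl tassoc_linear.
have l2 : linear (fun x => tassoc x ⋅ tassoc y).
  by move=> c u v; rewrite tassoc_linear amul_linl.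
apply: (tens3_ext l1 l2) => a b c {x l1 l2}.
have l1 : linear (fun y => tassoc ((a ⊗ (b ⊗ c) : tens A (tens B C)) ⋅ y)).
  by move=> d u v; rewrite amul_linr tassoc_linear.
have l2 : linear (fun y => tassoc (a ⊗ (b ⊗ c)) ⋅ tassoc y).
  by move=> d u v; rewrite tassoc_linear amul_linr.
apply: (tens3_ext l1 l2) => a' b' c' {y l1 l2}.
rewrite !tassocE.
transitivity (tassoc ((a ⋅ a') ⊗ ((b ⋅ b') ⊗ (c ⋅ c')))).
  by congr tassoc; rewrite [LHS]tens_mul_pure; congr (_ ⊗ _); exact: tens_mul_pure.
rewrite tassocE [RHS]tens_mul_pure; congr (_ ⊗ _); symmetry; exact: tens_mul_pure.
Qed.
Definition tens_assoc_hom : alghom (tens A (tens B C)) (tens (tens A B) C) :=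
  AlgHom tens_assoc1 tens_assocM.
Lemma tens_assoc_homE a b c : tens_assoc_hom (a ⊗ (b ⊗ c)) = a ⊗ b ⊗ c.
Proof. by rewrite [LHS]lin_homE tassocE. Qed.

Lemma tensmod_assoc (M : fdMod A) (N : fdMod B) (P : fdMod C) :
  modiso (tensmod M (tensmod N P)) (resmod tens_assoc_hom (tensmod (tensmod M N) P)).
Proof.
have l0 : linear (@tassoc M N P) := @tassoc_linear M N P.
apply: (@modiso_intro K _ (tensmod M (tensmod N P))
  (resmod tens_assoc_hom (tensmod (tensmod M N) P)) (@tassoc M N P)) => //.
- move=> x t; move: x.
  have l1 : linear (fun x => tassoc (mact x (t : tensmod M (tensmod N P)))).
    by move=> c u v; rewrite mact_linl tassoc_linear.
  have l2 : linear (fun x => mact x (tassoc t : resmod tens_assoc_hom (tensmod (tensmod M N) P))).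
    by move=> c u v; rewrite mact_linl.
  apply: (tens3_ext l1 l2) => a b c {l1 l2}; move: t.
  have l1 : linear (fun t => tassoc (mact (a ⊗ (b ⊗ c)) (t : tensmod M (tensmod N P)))).
    by move=> d u v; rewrite mact_linr tassoc_linear.
  have l2 : linear (fun t => mact (a ⊗ (b ⊗ c))
      (tassoc t : resmod tens_assoc_hom (tensmod (tensmod M N) P))).
    by move=> d u v; rewrite tassoc_linear mact_linr.
  apply: (tens3_ext l1 l2) => m n p; rewrite tassocE.
  transitivity (tassoc (mact a m ⊗ (mact b n ⊗ mact c p))).
    by congr tassoc; rewrite [LHS]tens_act_pure; congr (_ ⊗ _); exact: tens_act_pure.
  rewrite tassocE -[RHS]/(mact (tens_assoc_hom (a ⊗ (b ⊗ c)))
    (m ⊗ n ⊗ p : tensmod (tensmod M N) P)).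
  rewrite tens_assoc_homE [RHS]tens_act_pure; congr (_ ⊗ _); symmetry; exact: tens_act_pure.
- exact: can_inj (@tassocK M N P).
- by move=> w; exists (tassoc' w); rewrite tassoc'K.
Qed.
End AssocHom.

Lemma resmod_ext (A B : fdAlgType K) (f g : alghom B A) (M : fdMod A) :
  f =1 g -> modiso (resmod f M) (resmod g M).
Proof.
move=> fg; apply: (@modiso_intro K B (resmod f M) (resmod g M) idfun) => //.
  by move=> b v /=; rewrite fg.
by move=> w; exists w.
Qed.

Lemma G0_restr_ext (A B : fdAlgType K) (f g : alghom B A) : f =1 g ->
  G0_restr f =1 G0_restr g.
Proof.
move=> fg; apply: G0_ext => M; rewrite !G0_restrE.
by apply: G0_class_iso; exact: resmod_ext.
Qed.

Lemma G0_restr_comp (A B C : fdAlgType K) (f : alghom B A) (g : alghom C B) x :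
  G0_restr g (G0_restr f x) = G0_restr (alghom_comp f g) x.
Proof.
move: x; apply: G0_induction => [|x y ex ey|M]; first by rewrite !raddf0.
  by rewrite !raddfB ex ey.
rewrite !G0_restrE; apply: G0_class_iso.
apply: (@modiso_intro K C (resmod g (resmod f M)) (resmod (alghom_comp f g) M) idfun) => //.
  by move=> c v; rewrite /= comp_lfunE.
by move=> w; exists w.
Qed.

Fact alghom_id1 (A : fdAlgType K) : (\1%VF : 'Hom(A, A)) aone = aone.
Proof. by rewrite lfunE. Qed.
Fact alghom_idM (A : fdAlgType K) : {morph (\1%VF : 'Hom(A, A)) : x y / x ⋅ y}.
Proof. by move=> x y; rewrite !lfunE. Qed.
Definition alghom_id (A : fdAlgType K) : alghom A A := AlgHom (alghom_id1 A) (@alghom_idM A).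
Lemma alghom_idE (A : fdAlgType K) a : alghom_id A a = a. Proof. by rewrite [LHS]lfunE. Qed.

Lemma G0_restr_id (A : fdAlgType K) x : G0_restr (alghom_id A) x = x.
Proof.
move: x; apply: G0_induction => [|x y ex ey|M]; first by rewrite !raddf0.
  by rewrite !raddfB ex ey.
rewrite !G0_restrE; apply: G0_class_iso.
apply: (@modiso_intro K A (resmod (alghom_id A) M) M idfun) => //.
  by move=> c v; rewrite /= lfunE.
by move=> w; exists w.
Qed.

Lemma G0_prod_restr (A B A' B' : fdAlgType K) (f : alghom A A') (g : alghom B B') t :
  G0_prod A B (ztens_map (G0_restr f) (G0_restr g) t) =
  G0_restr (tens_hom f g) (G0_prod A' B' t).
Proof.
move: t; apply: (G0_ztens_ext
  (f := G0_prod A B \o ztens_map (G0_restr f) (G0_restr g))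
  (g := G0_restr (tens_hom f g) \o G0_prod A' B')) => M N.
rewrite -[LHS]/(G0_prod A B (ztens_map (G0_restr f) (G0_restr g) (G0_class M ⊠ G0_class N))).
rewrite -[RHS]/(G0_restr (tens_hom f g) (G0_prod A' B' (G0_class M ⊠ G0_class N))).
rewrite ztens_mapE !G0_restrE !G0_prodE G0_restrE.
apply: G0_class_iso; exact: tensmod_resmod.
Qed.

Lemma G0_prod_assoc (A B C : fdAlgType K) t :
  G0_prod A (tens B C) (ztens_map idfun (G0_prod B C) (ztens_assoc _ _ _ t)) =
  G0_restr (tens_assoc_hom A B C) (G0_prod (tens A B) C (ztens_map (G0_prod A B) idfun t)).
Proof.
move: t; apply: ztens_induction => [|x y ex ey|t z]; first by rewrite !raddf0.
  by rewrite !raddfB ex ey.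
move: z; apply: G0_induction => [|x y ex ey|P]; first by rewrite zpure0r !raddf0.
  by rewrite zpureBr !raddfB ex ey.
move: t; apply: ztens_induction => [|x y ex ey|x y]; first by rewrite zpure0l !raddf0.
  by rewrite zpureBl !raddfB ex ey.
move: x; apply: G0_induction => [|x x' ex ex'|M]; first by rewrite !zpure0l !raddf0.
  by rewrite !zpureBl !raddfB ex ex'.
move: y; apply: G0_induction => [|x x' ex ex'|N]; first by rewrite zpure0r zpure0l !raddf0.
  by rewrite zpureBr zpureBl !raddfB ex ex'.
rewrite ztens_assocE !ztens_mapE !G0_prodE G0_restrE.
apply: G0_class_iso; exact: tensmod_assoc.
Qed.

Fact dim_exact (A : fdAlgType K) : exact_additive (fun M : fdMod A => (\dim {:M})%:Z).
Proof. by move=> L M N /short_exact_dim ->; rewrite PoszD. Qed.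
(** In degree 0, where the algebra is K, this is the coordinate along [unit_class]; it gives the
    counit. *)
Definition G0_dim (A : fdAlgType K) : {additive G0 A -> int} := G0_lift (@dim_exact A).
Lemma G0_dimE (A : fdAlgType K) M : G0_dim A (G0_class M) = (\dim {:M})%:Z.
Proof. exact: G0_liftE. Qed.
End TensorHoms.

(** * Direct sums *)

Section DirectSums.
Variable G : nat -> zmodType.

Lemma dsum_in_nth n (x : G n) : dsum_in G n x n = x.
Proof. exact: dfwith_in. Qed.
Lemma dsum_in_out n k (x : G n) : n != k -> dsum_in G n x k = 0.
Proof. by move=> nk; exact: dfwith_out. Qed.

Section Sum.
Variables (Z : zmodType) (F : forall n, G n -> Z).
(** The sum stops at a chosen bound of the support; [dsum_sumE] replaces it by any other bound. *)
Definition dsum_sum (x : dsum G) : Z := \sum_(n < sval (cid (dsum_fin x))) F (x n).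
Hypothesis F0 : forall n, F (0 : G n) = 0.

Lemma dsum_sumE (x : dsum G) N : (forall n, (N <= n)%N -> x n = 0) ->
  dsum_sum x = \sum_(n < N) F (x n).
Proof.
rewrite /dsum_sum; case: (cid _) => N' /= h' h.
have sumE m m' : (forall n, (m <= n)%N -> x n = 0) -> (m <= m')%N ->
    \sum_(n < m) F (x n) = \sum_(n < m') F (x n).
  move=> hm le; rewrite (big_ord_widen _ (fun n => F (x n)) le) big_mkcond.
  by apply: eq_bigr => n _; case: ifP => // /negbT; rewrite -leqNgt => /hm ->.
by rewrite (sumE _ (maxn N N') h') ?leq_maxr // (sumE _ (maxn N N') h) ?leq_maxl.
Qed.

Lemma dsum_sum_in n (x : G n) : dsum_sum (dsum_in G n x) = F x.
Proof.
rewrite (@dsum_sumE _ n.+1) => [|k nk]; last first.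
  by rewrite dsum_in_out // neq_ltn nk.
rewrite big_ord_recr big1 => [|k _].
  by rewrite [LHS]add0r dsum_in_nth.
by rewrite dsum_in_out ?F0 // neq_ltn /= (ltn_ord k) orbT.
Qed.
End Sum.

Lemma dsum_common (x y : dsum G) : exists N, (forall n, (N <= n)%N -> x n = 0) /\
  (forall n, (N <= n)%N -> y n = 0).
Proof.
have [[N h] [N' h']] := (dsum_fin x, dsum_fin y); exists (maxn N N').
by split=> n; rewrite geq_max => /andP[? ?]; [exact: h | exact: h'].
Qed.

Lemma dsum_sum_additive (Z : zmodType) (F : forall n, G n -> Z) :
  (forall n, zmod_morphism (@F n)) -> zmod_morphism (dsum_sum F).
Proof.
move=> FB x y; have [N [hx hy]] := dsum_common x y.
have F0 n : F n 0 = 0 by rewrite -[X in F n X](subrr 0) FB subrr.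
rewrite !(dsum_sumE F0 (N := N)) // => [|n Nn]; last first.
  by rewrite -[LHS]/(x n - y n) hx // hy // subrr.
by rewrite -sumrB; apply: eq_bigr => n _; exact: FB.
Qed.

Lemma dsum_sumB (Z : zmodType) (F1 F2 F3 : forall n, G n -> Z) :
  (forall n x, F1 n x = F2 n x - F3 n x) ->
  forall x, dsum_sum F1 x = dsum_sum F2 x - dsum_sum F3 x.
Proof. by move=> e x; rewrite /dsum_sum -sumrB; apply: eq_bigr => n _. Qed.

Definition dsum_lift (Z : zmodType) (f : forall n, {additive G n -> Z}) :
  {additive dsum G -> Z} :=
  HB.pack (dsum_sum (fun n => f n)) (GRing.isZmodMorphism.Build _ _ _
    (dsum_sum_additive (fun n => raddfB (f n)))).
Lemma dsum_liftE (Z : zmodType) (f : forall n, {additive G n -> Z}) n x :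
  dsum_lift f (dsum_in G n x) = f n x.
Proof. by apply: (dsum_sum_in (F := fun n => f n)) => k; rewrite raddf0. Qed.

Lemma dsum_sum_id (x : dsum G) : exists N, x = \sum_(n < N) dsum_in G n (x n).
Proof.
have [N h] := dsum_fin x; exists N; apply: dsumP => k.
have eval (I : finType) (y : I -> dsum G) : (\sum_i y i) k = \sum_i y i k.
  by apply: (big_morph (fun y : dsum G => y k)).
rewrite eval; have [kN|Nk] := ltnP k N.
  rewrite (bigD1 (Ordinal kN)) // (dsum_in_nth (n := k)) big1 => [|i nik].
    by rewrite [RHS]addr0.
  by rewrite dsum_in_out //; apply: contra nik => /eqP ik; apply/eqP/val_inj.
rewrite h // big1 // => i _; rewrite dsum_in_out //.
by rewrite neq_ltn (leq_trans (ltn_ord i) Nk).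
Qed.

Lemma dsum_induction (P : dsum G -> Prop) : P 0 ->
  (forall x y, P x -> P y -> P (x - y)) -> (forall n x, P (dsum_in G n x)) ->
  forall x, P x.
Proof.
move=> P0 PB Pi x; have [N ->] := dsum_sum_id x.
elim/big_ind: _ => // y z Py Pz; rewrite -[z]opprK; apply: (PB) => //.
by rewrite -sub0r; apply: (PB).
Qed.

Section Lift2.
Variables (Z : zmodType) (f : forall k l, {additive ztens (G k) (G l) -> Z}).
Let inner k (x : G k) (y : dsum G) : Z := dsum_sum (fun l (y' : G l) => f k l (x ⊠ y')) y.
Let innerB k y : zmod_morphism (fun x : G k => inner x y).
Proof. by move=> x x'; apply: dsum_sumB => l z; rewrite zpureBl raddfB. Qed.
Let outer (x y : dsum G) : Z := dsum_sum (fun k (x' : G k) => inner x' y) x.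
Fact dsum_lift2_biadditive : biadditive outer.
Proof.
have ol y : zmod_morphism (outer^~ y) := dsum_sum_additive (innerB^~ y).
have or x : zmod_morphism (outer x).
  move=> y y'; apply: dsum_sumB => k z.
  by apply: dsum_sum_additive => l u u'; rewrite zpureBr raddfB.
have toD (H : zmodType) (h : H -> Z) : zmod_morphism h -> {morph h : x y / x + y}.
  move=> hB x y; have h0 : h 0 = 0 by rewrite -(subrr 0) hB subrr.
  by rewrite -[y in LHS]opprK hB -[- y]sub0r hB h0 sub0r opprK.
by split=> w; [exact: toD (ol w) | exact: toD (or w)].
Qed.
Definition dsum_lift2 : {additive ztens (dsum G) (dsum G) -> Z} :=
  ztens_lift dsum_lift2_biadditive.
Lemma dsum_lift2E k l x y :
  dsum_lift2 (dsum_in G k x ⊠ dsum_in G l y) = f k l (x ⊠ y).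
Proof.
rewrite /dsum_lift2 ztens_lift_pure /outer dsum_sum_in => [|n]; last first.
  by have := @innerB n (dsum_in G l y) 0 0; rewrite !subrr.
by rewrite /inner dsum_sum_in // => n; rewrite zpure0r raddf0.
Qed.
End Lift2.
End DirectSums.

(** * The structure maps of a tower *)

Section Tower.
Variables (K : fieldType) (T : tensor_tower K).
Notation A := (endalg T).
Notation R := (tw_rho T).

Lemma end_cast_id n (e : n = n) (a : A n) : end_cast e a = a.
Proof. by rewrite (eq_irrelevance e erefl). Qed.

Lemma rho_atE k l n (e : (k + l = n)%N) x : rho_at R e x = end_cast e (R k l x).
Proof. by case: _ / e. Qed.

Definition cast_hom j k (e : j = k) : alghom (A j) (A k) :=
  ecast k (alghom (A j) (A k)) e (alghom_id (A j)).
Lemma cast_homE j k (e : j = k) a : cast_hom e a = end_cast e a.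
Proof. by case: _ / e; exact: alghom_idE. Qed.

Lemma G0_in_cast j k (e : j = k) (N : fdMod (A k)) :
  G0_in T j (G0_class (resmod (cast_hom e) N)) = G0_in T k (G0_class N).
Proof. by case: _ / e N => N; rewrite -G0_restrE G0_restr_id. Qed.

Lemma rho_unitl n (a : A n) : R 0%N n (aone ⊗ a) = a :> A n.
Proof.
pose s (a : A n) : A n := R 0%N n (aone ⊗ a).
(* Besides injectivity of [rho], this uses the retraction c ⊗ z |-> c z of z |-> 1 ⊗ z, with [A_0]
   identified with K. *)
have inj : injective s.
  move=> x y /(@rho_inj _ _ R 0%N n) /(congr1 (tlift (fun (c : A 0%N) (z : A n) =>
    (tw_iso0 T c : K) *: z))).
  rewrite !tlift_pure ?alghom1 ?scale1r //.
    by split=> [v|u] c z z'; rewrite ?linearP ?scalerDl -?scalerA // scalerDr !scalerA mulrC.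
  by split=> [v|u] c z z'; rewrite ?linearP ?scalerDl -?scalerA // scalerDr !scalerA mulrC.
apply: (inj); symmetry.
have := @rho_assoc _ _ R 0%N 0%N n aone aone a.
rewrite -[aone ⊗ aone]/(aone : tens (A 0%N) (A 0%N)) alghom1.
by move=> e; apply: (etrans e); rewrite end_cast_id.
Qed.

(** [n + 0] does not compute to [n], so the idempotent map is [s n] followed by a cast. Applying
    [s n] once more requires moving the cast through [s] ([nat]) and merging it with the cast of
    associativity ([cc]). *)
Lemma rho_unitr n (a : A n) : end_cast (addn0 n) (R n 0%N (a ⊗ aone)) = a.
Proof.
pose s n (a : A n) : A (n + 0)%N := R n 0%N (a ⊗ aone).
have inj m : injective (s m).
  move=> x y /(@rho_inj _ _ R m 0%N) /(congr1 (tlift (fun (z : A m) (c : A 0%N) =>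
    (tw_iso0 T c : K) *: z))).
  rewrite !tlift_pure ?alghom1 ?scale1r //.
    by split=> [v|u] c z z'; rewrite ?linearP ?scalerDl -?scalerA // scalerDr !scalerA mulrC.
  by split=> [v|u] c z z'; rewrite ?linearP ?scalerDl -?scalerA // scalerDr !scalerA mulrC.
have nat j k (e : j = k) (x : A j) :
    s k (end_cast e x) = end_cast (congr1 (addn^~ 0%N) e) (s j x).
  by case: _ / e; rewrite end_cast_id.
have cc i j k (e : i = j) (e' : j = k) (x : A i) :
    end_cast e' (end_cast e x) = end_cast (etrans e e') x.
  by case: _ / e' ; case: _ / e.
apply: (inj n); rewrite -/(s n a) nat.
have := @rho_assoc _ _ R n 0%N 0%N a aone aone.
rewrite -[aone ⊗ aone]/(aone : tens (A 0%N) (A 0%N)) alghom1.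
move=> e; rewrite -[X in end_cast _ X]/(R (n + 0)%N 0%N (R n 0%N (a ⊗ aone) ⊗ aone)).
by rewrite e cc end_cast_id.
Qed.

Lemma tower_split n : split_alg (A n).
Proof. exact: (cellular_split (tw_cell T)). Qed.

Definition G0_prod_inv k l : G0 (tens (A k) (A l)) -> ztens (G0 (A k)) (G0 (A l)) :=
  fun x => sval (cid (G0_prod_surj (A := A k) (B := A l) (@tower_split k) x)).
Lemma G0_prod_invK k l : cancel (@G0_prod_inv k l) (G0_prod (A k) (A l)).
Proof. by move=> x; rewrite /G0_prod_inv; case: cid. Qed.
Fact G0_prod_inv_additive k l : zmod_morphism (@G0_prod_inv k l).
Proof.
move=> x y; apply: (G0_prod_inj (@tower_split k)).
by rewrite raddfB !G0_prod_invK.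
Qed.
HB.instance Definition _ k l := GRing.isZmodMorphism.Build _ _ (@G0_prod_inv k l)
  (@G0_prod_inv_additive k l).

(** * Existence of the structure maps *)

Section Existence.
Hypothesis hproj : forall m n : nat, two_sided_projective T m n.

Definition tw_ind m n : {additive ztens (G0 (A m)) (G0 (A n)) -> G0 (A (m + n)%N)} :=
  G0_induce (hproj m n).2 \o G0_prod (A m) (A n).
Definition tw_res k l n (e : (k + l = n)%N) :
    {additive G0 (A n) -> ztens (G0 (A k)) (G0 (A l))} :=
  @G0_prod_inv k l \o G0_restr (rho_at R e).

Definition tw_unit_fun (a : int) : G0tower T := G0_in T 0%N (unit_class T *~ a).
Fact tw_unit_additive : zmod_morphism tw_unit_fun.
Proof. by move=> a b; rewrite /tw_unit_fun mulrzBr raddfB. Qed.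
Definition tw_unit : {additive int -> G0tower T} :=
  HB.pack tw_unit_fun (GRing.isZmodMorphism.Build _ _ _ tw_unit_additive).

Definition tw_counit_fun n (x : G0 (A n)) : int := if n == 0%N then G0_dim (A n) x else 0.
Fact tw_counit_additive n : zmod_morphism (@tw_counit_fun n).
Proof. by move=> x y; rewrite /tw_counit_fun; case: eqP => _; rewrite ?raddfB ?subr0. Qed.

Definition tw_comul_fun n (x : G0 (A n)) : ztens (G0tower T) (G0tower T) :=
  \sum_(k < n.+1) ztens_map (G0_in T k) (G0_in T (n - k)%N) (tw_res (subnKC (leq_ord k)) x).
Fact tw_comul_additive n : zmod_morphism (@tw_comul_fun n).
Proof.
by move=> x y; rewrite /tw_comul_fun -sumrB; apply: eq_bigr => k _; rewrite !raddfB.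
Qed.

Lemma structure_maps_exist : inhabited (structure_maps T).
Proof.
pose mul : {additive ztens (G0tower T) (G0tower T) -> G0tower T} :=
  dsum_lift2 (fun k l => G0_in T (k + l)%N \o tw_ind k l).
pose com n : {additive G0 (A n) -> ztens (G0tower T) (G0tower T)} :=
  HB.pack (@tw_comul_fun n) (GRing.isZmodMorphism.Build _ _ _ (@tw_comul_additive n)).
pose cou n : {additive G0 (A n) -> int} :=
  HB.pack (@tw_counit_fun n) (GRing.isZmodMorphism.Build _ _ _ (@tw_counit_additive n)).
constructor.
apply: (@StructureMaps K T (fun k l => G0_prod (A k) (A l)) _ _ tw_ind _ tw_res _
  mul _ (dsum_lift com) _ tw_unit _ (dsum_lift cou)).
- by move=> k l M N; exact: G0_prodE.
- by move=> k l; apply: G0_prod_bij; exact: tower_split.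
- move=> m n M N; rewrite -[LHS]/(G0_induce (hproj m n).2 (G0_prod _ _ _)).
  by rewrite G0_prodE G0_induceE.
- move=> k l n e N; rewrite -[tw_res _ _]/(@G0_prod_inv k l (G0_restr (rho_at R e) _)).
  by rewrite G0_prod_invK G0_restrE.
- by move=> k l x y; exact: (dsum_lift2E (fun k l => G0_in T (k + l)%N \o tw_ind k l)).
- by move=> n x; exact: (dsum_liftE com).
- by [].
- move=> a; rewrite [LHS](dsum_liftE cou).
  rewrite -[LHS]/(G0_dim (A 0%N) (unit_class T *~ a)) raddfMz G0_dimE.
  by rewrite dimvf intz.
- move=> n x n0; rewrite [LHS](dsum_liftE cou).
  by rewrite -[LHS]/(tw_counit_fun x) /tw_counit_fun -[n == 0%N]negbK -lt0n n0.
Qed.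
End Existence.
End Tower.

(** * The algebra and coalgebra laws *)

Lemma ztens_assoc_nat (G H L G' H' L' : zmodType) (f : {additive G -> G'})
  (g : {additive H -> H'}) (h : {additive L -> L'}) t :
  ztens_assoc _ _ _ (ztens_map (ztens_map f g) h t) =
  ztens_map f (ztens_map g h) (ztens_assoc _ _ _ t).
Proof.
move: t; apply: ztens_induction => [|x y ex ey|t z]; first by rewrite !raddf0.
  by rewrite !raddfB ex ey.
move: t; apply: ztens_induction => [|x y ex ey|x y]; first by rewrite zpure0l !raddf0.
  by rewrite zpureBl !raddfB ex ey.
by rewrite ztens_assocE !ztens_mapE ztens_assocE.
Qed.

(** Both sides run over the pairs (i, j) with i + j <= n; the left one groups them by k = i + j. *)
Lemma sum_triangle (V : nmodType) n (h : nat -> nat -> V) :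
  \sum_(k < n.+1) \sum_(j < k.+1) h j (k - j)%N =
  \sum_(i < n.+1) \sum_(j < (n - i).+1) h i j.
Proof.
elim: n => [|n IHn]; first by rewrite !big_ord1.
rewrite big_ord_recr /= IHn [in RHS]big_ord_recr /= subnn big_ord1.
rewrite [\sum_(j < n.+2) _]big_ord_recr /= subnn addrA -big_split /=; congr (_ + _).
by apply: eq_bigr => i _; rewrite subSn ?leq_ord // [RHS]big_ord_recr.
Qed.

Section AlgebraLaws.
Variables (K : fieldType) (T : tensor_tower K) (X : structure_maps T).
Notation A := (endalg T).
Notation R := (tw_rho T).
Notation unitmod := (resmod (tw_iso0 T) (regmod K^o)).

(** Transfers the injectivity and naturality of [G0_prod] to the identification carried by an
    arbitrary [X]. *)
Lemma G0_tens_prod k l : G0_tens X k l =1 G0_prod (A k) (A l).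
Proof. by apply: G0_ztens_ext => M N; rewrite G0_tensE G0_prodE. Qed.

Lemma G0_prod_res k l n (e : (k + l = n)%N) x :
  G0_prod (A k) (A l) (G0_res X e x) = G0_restr (rho_at R e) x.
Proof.
rewrite -G0_tens_prod; move: x; apply: G0_induction => [|x y ex ey|N].
- by rewrite !raddf0.
- by rewrite !raddfB ex ey.
- by rewrite G0_resE G0_restrE.
Qed.

Lemma tower_induction (P : G0tower T -> Prop) : P 0 ->
  (forall x y, P x -> P y -> P (x - y)) ->
  (forall n M, P (G0_in T n (G0_class M))) -> forall x, P x.
Proof.
move=> P0 PB Pc; apply: dsum_induction => // n x; move: x.
apply: G0_induction => [|x y ex ey|M]; last exact: Pc.
  by rewrite raddf0.
by rewrite raddfB; apply: PB.
Qed.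

Lemma mul_class m n (M : fdMod (A m)) (N : fdMod (A n)) :
  G0_mul X (G0_in T m (G0_class M) ⊠ G0_in T n (G0_class N)) =
  G0_in T (m + n)%N (G0_class (indmod (R m n) (tensmod M N))).
Proof. by rewrite G0_mulE G0_indE. Qed.

Lemma G0_in_ind_cast k l j (e : (k + l = j)%N) (Q : fdMod (tens (A k) (A l))) :
  G0_in T (k + l)%N (G0_class (indmod (R k l) Q)) =
  G0_in T j (G0_class (indmod (rho_at R e) Q)).
Proof. by case: _ / e. Qed.

Lemma tower_mulA t :
  G0_mul X (ztens_map (G0_mul X) idfun t) =
  G0_mul X (ztens_map idfun (G0_mul X) (ztens_assoc _ _ _ t)).
Proof.
move: t; apply: ztens_induction => [|x y ex ey|t z]; first by rewrite !raddf0.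
  by rewrite !raddfB ex ey.
move: z; apply: tower_induction => [|x y ex ey|n P]; first by rewrite zpure0r !raddf0.
  by rewrite zpureBr !raddfB ex ey.
move: t; apply: ztens_induction => [|x y ex ey|x y]; first by rewrite zpure0l !raddf0.
  by rewrite zpureBl !raddfB ex ey.
move: x; apply: tower_induction => [|x x' ex ex'|l M]; first by rewrite !zpure0l !raddf0.
  by rewrite !zpureBl !raddfB ex ex'.
move: y; apply: tower_induction => [|x x' ex ex'|m N]; first by rewrite zpure0r zpure0l !raddf0.
  by rewrite zpureBr zpureBl !raddfB ex ex'.
rewrite ztens_assocE !ztens_mapE /= !mul_class.
rewrite [RHS](G0_in_ind_cast (addnA l m n)); congr (G0_in _ _ _).
apply: G0_class_iso; apply: ind_assoc => a b c.
by rewrite rho_atE; exact: rho_assoc.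
Qed.

Lemma unit_1 : G0_unit X 1 = G0_in T 0%N (unit_class T).
Proof. by rewrite G0_unitE. Qed.

Lemma unit_int a : G0_unit X a = G0_unit X 1 *~ a.
Proof. by rewrite -raddfMz intz. Qed.

(** Puts the class in the form required by [ind_unitl] and [res_unitl]; [0 + n] computes to [n], so
    no cast appears. *)
Lemma class_unitl n (N : fdMod (A n)) : G0_class N = G0_class
  (resmod (alghom_comp (R 0%N n) (tens_inr (A 0%N) (A n))) (N : fdMod (A (0 + n)%N))).
Proof.
set N' := resmod _ _.
apply: G0_class_iso; apply: (@modiso_intro K (A n) N N' idfun) => //.
  move=> a v; rewrite -[RHS]/(mact (alghom_comp (R 0%N n) (tens_inr (A 0%N) (A n)) a) v).
  by rewrite /= comp_lfunE -[alghom_fun (tens_inr _ _) _]/(tens_inr (A 0%N) (A n) a)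
    tens_inrE rho_unitl.
by move=> w; exists w.
Qed.

Lemma class_unitr n (N : fdMod (A n)) : G0_class N = G0_class
  (resmod (alghom_comp (R n 0%N) (tens_inl (A n) (A 0%N))) (resmod (cast_hom T (addn0 n)) N)).
Proof.
set N' := resmod _ _.
apply: G0_class_iso; apply: (@modiso_intro K (A n) N N' idfun) => //.
  move=> a v; rewrite -[RHS]/(mact (cast_hom T (addn0 n)
    (alghom_comp (R n 0%N) (tens_inl (A n) (A 0%N)) a)) (v : N)).
  rewrite cast_homE /= comp_lfunE -[alghom_fun (tens_inl _ _) _]/(tens_inl (A n) (A 0%N) a).
  by rewrite tens_inlE rho_unitr.
by move=> w; exists w.
Qed.

Lemma tower_mul1l x : G0_mul X (G0_unit X 1 ⊠ x) = x.
Proof.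
rewrite unit_1; move: x; apply: tower_induction => [|x x' ex ex'|n N].
- by rewrite zpure0r raddf0.
- by rewrite zpureBr raddfB ex ex'.
rewrite [in LHS]class_unitl mul_class; congr (G0_in _ _ _); apply: G0_class_iso.
apply: ind_unitl; first exact: tw_iso0_bij.
by move=> e; exists e; rewrite rho_unitl.
Qed.

Lemma tower_mul1r x : G0_mul X (x ⊠ G0_unit X 1) = x.
Proof.
rewrite unit_1; move: x; apply: tower_induction => [|x x' ex ex'|n N].
- by rewrite zpure0l raddf0.
- by rewrite zpureBl raddfB ex ex'.
pose Z := resmod (cast_hom T (addn0 n)) N.
rewrite -[RHS](G0_in_cast (addn0 n)) -/Z [in LHS]class_unitr mul_class.
congr (G0_in _ _ _); apply: G0_class_iso.
apply: ind_unitr; first exact: tw_iso0_bij.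
(* By [rho_unitr], rho(- ⊗ 1) is the inverse cast. *)
move=> e; exists (end_cast (addn0 n) e).
have inj j k (i : j = k) : injective (@end_cast _ T _ _ i) by case: _ / i.
by apply: (inj _ _ (addn0 n)); rewrite rho_unitr.
Qed.

Lemma tower_algebra : is_zalgebra (G0_mul X) (G0_unit X).
Proof.
split; first exact: tower_mulA.
- apply: ztens_induction => [|x y ex ey|a x]; first by rewrite !raddf0.
    by rewrite !raddfB ex ey.
  rewrite ztens_mapE /ztens_unitl ztens_lift_pure unit_int.
  have -> : (G0_unit X 1 *~ a) ⊠ x = (G0_unit X 1 ⊠ x) *~ a.
    exact: (raddfMz (@zpurel (G0tower T) (G0tower T) x) a _).
  by rewrite raddfMz tower_mul1l.
- apply: ztens_induction => [|x y ex ey|x a]; first by rewrite !raddf0.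
    by rewrite !raddfB ex ey.
  rewrite ztens_mapE /ztens_unitr ztens_lift_pure unit_int.
  have -> : x ⊠ (G0_unit X 1 *~ a) = (x ⊠ G0_unit X 1) *~ a.
    exact: (raddfMz (@zpurer (G0tower T) (G0tower T) x) a _).
  by rewrite raddfMz tower_mul1r.
Qed.

(** * Counit laws and coassociativity *)

Lemma counit_1 : G0_counit X (G0_in T 0%N (unit_class T)) = 1.
Proof. exact: (G0_counitE X 1). Qed.

Lemma res_unit_l n (e : (0 + n = n)%N) (x : G0 (A n)) :
  G0_res X e x = unit_class T ⊠ x.
Proof.
apply: (G0_prod_inj (@tower_split _ T _)); rewrite G0_prod_res.
move: x; apply: G0_induction => [|x y ex ey|N].
- by rewrite zpure0r !raddf0.
- by rewrite zpureBr !raddfB ex ey.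
rewrite (eq_irrelevance e erefl) G0_restrE.
rewrite [in RHS]class_unitl G0_prodE; apply: G0_class_iso.
exact: (res_unitl (@tw_iso0_bij _ T) (R 0%N n)).
Qed.

(** The counit vanishes in positive degree, so of all summands of the comultiplication only k = 0
    survives. *)
Lemma counit_l k l n (e : (k + l = n)%N) (x : G0 (A n)) :
  ztens_unitl _ (ztens_map (G0_counit X) idfun
    (ztens_map (G0_in T k) (G0_in T l) (G0_res X e x))) =
  if k == 0%N then G0_in T n x else 0.
Proof.
rewrite ztens_map_comp; case: k e => [|k] e.
  case: _ / e x => x; rewrite (@res_unit_l l erefl) ztens_mapE /ztens_unitl ztens_lift_pure /=.
  by rewrite counit_1.
have -> : forall t, ztens_map (G0_counit X \o G0_in T k.+1) (idfun \o G0_in T l) t = 0.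
  move=> t; rewrite (ztens_map_ext (f' := \0) (g' := G0_in T l)) => [|y|//]; last first.
    by rewrite /= G0_counit0.
  move: t; apply: ztens_induction => [|x1 x2 e1 e2|x1 x2]; first by rewrite raddf0.
    by rewrite raddfB e1 e2 subrr.
  by rewrite ztens_mapE zpure0l.
by rewrite raddf0.
Qed.

(** Stated over [A (k + 0)], where [rho] takes its values, so that the single cast is a restriction
    to [A k]. *)
Lemma res_unit_r k (x : G0 (A (k + 0)%N)) :
  G0_res X (erefl (k + 0)%N) x =
  G0_restr (cast_hom T (esym (addn0 k))) x ⊠ unit_class T.
Proof.
apply: (G0_prod_inj (@tower_split _ T _)); rewrite G0_prod_res.
move: x; apply: G0_induction => [|x y ex ey|N].
- by rewrite !raddf0 zpure0l !raddf0.
- by rewrite !raddfB zpureBl !raddfB ex ey.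
rewrite !G0_restrE G0_prodE.
apply: etrans (G0_class_iso (res_unitr (@tw_iso0_bij _ T) (R k 0%N) N)) _.
rewrite -!G0_prodE; congr (G0_prod _ _ (_ ⊠ _)); apply: G0_class_iso.
apply: resmod_ext => a.
rewrite cast_homE /= comp_lfunE.
rewrite -[alghom_fun (tens_inl _ _) _]/(tens_inl (A k) (A 0%N) a) tens_inlE.
have cK i j (e : i = j) (b : A i) : end_cast (esym e) (end_cast e b) = b by case: _ / e.
by rewrite -[a in RHS]rho_unitr cK.
Qed.

Lemma counit_r k l n (e : (k + l = n)%N) (x : G0 (A n)) :
  ztens_unitr _ (ztens_map idfun (G0_counit X)
    (ztens_map (G0_in T k) (G0_in T l) (G0_res X e x))) =
  if l == 0%N then G0_in T n x else 0.
Proof.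
rewrite ztens_map_comp; case: l e => [|l] e.
  case: _ / e x => x; rewrite res_unit_r ztens_mapE /ztens_unitr ztens_lift_pure.
  rewrite -[LHS]/(G0_in T k (G0_restr (cast_hom T (esym (addn0 k))) x) *~
    G0_counit X (G0_in T 0%N (unit_class T))) counit_1 mulr1z.
  rewrite -[RHS]/(G0_in T (k + 0)%N x).
  move: x; apply: G0_induction => [|x y ex ey|N]; first by rewrite !raddf0.
    by rewrite !raddfB ex ey.
  by rewrite G0_restrE G0_in_cast.
have -> : forall t, ztens_map (idfun \o G0_in T k) (G0_counit X \o G0_in T l.+1) t = 0.
  move=> t; rewrite (ztens_map_ext (f' := G0_in T k) (g' := \0)) => [|//|y]; last first.
    by rewrite /= G0_counit0.
  move: t; apply: ztens_induction => [|x1 x2 e1 e2|x1 x2]; first by rewrite raddf0.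
    by rewrite raddfB e1 e2 subrr.
  by rewrite ztens_mapE zpure0r.
by rewrite raddf0.
Qed.

Lemma tower_counitl x :
  ztens_unitl _ (ztens_map (G0_counit X) idfun (G0_comul X x)) = x.
Proof.
move: x; apply: dsum_induction => [|x y ex ey|n x]; first by rewrite !raddf0.
  by rewrite !raddfB ex ey.
have sumE (F : 'I_n.+1 -> ztens (G0tower T) (G0tower T)) :
  ztens_unitl _ (ztens_map (G0_counit X) idfun (\sum_i F i)) =
  \sum_i ztens_unitl _ (ztens_map (G0_counit X) idfun (F i)) by rewrite !raddf_sum.
rewrite G0_comulE sumE (bigD1 ord0) // counit_l big1 => [|k nk]; first exact: addr0.
by rewrite counit_l ifN.
Qed.

Lemma tower_counitr x :
  ztens_unitr _ (ztens_map idfun (G0_counit X) (G0_comul X x)) = x.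
Proof.
move: x; apply: dsum_induction => [|x y ex ey|n x]; first by rewrite !raddf0.
  by rewrite !raddfB ex ey.
have sumE (F : 'I_n.+1 -> ztens (G0tower T) (G0tower T)) :
  ztens_unitr _ (ztens_map idfun (G0_counit X) (\sum_i F i)) =
  \sum_i ztens_unitr _ (ztens_map idfun (G0_counit X) (F i)) by rewrite !raddf_sum.
rewrite G0_comulE sumE (bigD1 ord_max) // counit_r subnn big1 => [|k nk]; first exact: addr0.
rewrite counit_r ifN // subn_eq0 -ltnNge ltn_neqAle -ltnS ltn_ord andbT.
by apply: contra nk => /eqP e; apply/eqP/val_inj.
Qed.

(** After the injective map to the group of A_a ⊗ (A_b ⊗ A_c), both sides are restrictions along one
    algebra homomorphism to A_n, by associativity of [rho]. *)
Lemma triple_res a b c k k' n (e1 : (k + c = n)%N) (e2 : (a + b = k)%N)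
    (e3 : (a + k' = n)%N) (e4 : (b + c = k')%N) x :
  ztens_assoc _ _ _ (ztens_map (G0_res X e2) idfun (G0_res X e1 x)) =
  ztens_map idfun (G0_res X e4) (G0_res X e3 x).
Proof.
have inj : injective (fun t => G0_prod (A a) (tens (A b) (A c))
    (ztens_map idfun (G0_prod (A b) (A c)) t)).
  move=> t t' /(G0_prod_inj (@tower_split _ T _)).
  move=> /(congr1 (ztens_map idfun (@G0_prod_inv _ T b c))).
  have invK u : ztens_map idfun (@G0_prod_inv _ T b c)
      (ztens_map (@idfun (G0 (A a))) (G0_prod (A b) (A c)) u) = u.
    rewrite ztens_map_comp -[RHS]ztens_map_id; apply: ztens_map_ext => // v /=.
    by apply: (G0_prod_inj (@tower_split _ T _)); rewrite G0_prod_invK.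
  by rewrite !invK.
apply: inj; rewrite G0_prod_assoc !ztens_map_comp.
rewrite (ztens_map_ext (f' := G0_restr (rho_at R e2)) (g' := G0_restr (alghom_id (A c))));
  last 2 first.
- by move=> y; exact: G0_prod_res.
- by move=> y; symmetry; exact: G0_restr_id.
rewrite [in RHS](ztens_map_ext (f' := G0_restr (alghom_id (A a))) (g' := G0_restr (rho_at R e4)));
  last 2 first.
- by move=> y; symmetry; exact: G0_restr_id.
- by move=> y; exact: G0_prod_res.
rewrite !G0_prod_restr !G0_prod_res !G0_restr_comp; apply: G0_restr_ext.
apply: tens3_ext => [d y z|d y z|p q r]; try exact: lfun_linear.
have compE (B1 B2 B3 : fdAlgType K) (f : alghom B2 B3) (g : alghom B1 B2) z :
  alghom_comp f g z = f (g z) by rewrite /= comp_lfunE.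
rewrite !compE tens_assoc_homE !tens_homE !alghom_idE.
(* All indices become sums; the one remaining equality must coincide with [addnA a b c]. *)
case: _ / e2 e1 => e1; case: _ / e4 e3 => e3; case: _ / e1 e3 => e3.
rewrite (rho_atE e3) -[rho_at R erefl (_ ⊗ r)]/(R _ _ _) -[rho_at R erefl (p ⊗ q)]/(R _ _ _).
by rewrite rho_assoc (eq_irrelevance e3 (addnA a b c)).
Qed.

Section Coassociativity.
Variables (n : nat) (x : G0 (A n)).

Let term a b c k (e : (a + k = n)%N) (e' : (b + c = k)%N) :
    ztens (G0tower T) (ztens (G0tower T) (G0tower T)) :=
  ztens_map (G0_in T a) (ztens_map (G0_in T b) (G0_in T c))
    (ztens_map idfun (G0_res X e') (G0_res X e x)).

Let term_eq a b c c' k k' (e : (a + k = n)%N) (e' : (b + c = k)%N)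
  (f : (a + k' = n)%N) (f' : (b + c' = k')%N) : term e e' = term f f'.
Proof.
have kk : k = k' by apply: (@addnI a); rewrite e f.
case: _ / kk f f' => f f'.
have cc : c = c' by apply: (@addnI b); rewrite e' f'.
case: _ / cc f' => f'.
by rewrite (eq_irrelevance f e) (eq_irrelevance f' e').
Qed.

(** Makes the summand a function of two numbers alone, as [sum_triangle] requires, whatever index
    proofs each side produces. The value 0 is a default for a + b > n, outside the range of both
    sums. *)
Let total_term (a b : nat) : ztens (G0tower T) (ztens (G0tower T) (G0tower T)) :=
  match (a <= n)%N =P true, (b <= n - a)%N =P true with
  | ReflectT h, ReflectT h' => term (subnKC h) (subnKC h')
  | _, _ => 0
  end.

Let total_termE a b c k (e : (a + k = n)%N) (e' : (b + c = k)%N) :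
  term e e' = total_term a b.
Proof.
rewrite /total_term; case: eqP => [h|[]]; last by rewrite -e leq_addr.
case: eqP => [h'|[]]; last by rewrite -e addKn -e' leq_addr.
exact: term_eq.
Qed.

Lemma coassoc_in :
  ztens_assoc _ _ _ (ztens_map (G0_comul X) idfun (G0_comul X (G0_in T n x))) =
  ztens_map idfun (G0_comul X) (G0_comul X (G0_in T n x)).
Proof.
have sumL (F : 'I_n.+1 -> ztens (G0tower T) (G0tower T)) :
  ztens_assoc _ _ _ (ztens_map (G0_comul X) idfun (\sum_i F i)) =
  \sum_i ztens_assoc _ _ _ (ztens_map (G0_comul X) idfun (F i)) by rewrite !raddf_sum.
have sumR (F : 'I_n.+1 -> ztens (G0tower T) (G0tower T)) :
  ztens_map idfun (G0_comul X) (\sum_i F i) =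
  \sum_i ztens_map idfun (G0_comul X) (F i) by rewrite raddf_sum.
rewrite G0_comulE sumL sumR.
transitivity (\sum_(k < n.+1) \sum_(j < k.+1) total_term j (k - j)).
  apply: eq_bigr => k _; rewrite ztens_map_comp.
  rewrite (@ztens_map_suml _ _ _ _ _ _ (fun j : 'I_k.+1 =>
    ztens_map (G0_in T j) (G0_in T (k - j)%N) \o G0_res X (subnKC (leq_ord j)))) => [|y];
    last by rewrite /= G0_comulE.
  rewrite raddf_sum; apply: eq_bigr => j _.
  have jn : (j + (n - j) = n)%N by rewrite subnKC // (leq_trans (leq_ord j)) ?leq_ord.
  have kjn : (k - j + (n - k) = n - j)%N.
    by rewrite addnC addnBA ?leq_ord // subnK ?leq_ord.
  rewrite -(total_termE jn kjn) /term -(triple_res (subnKC (leq_ord k)) (subnKC (leq_ord j))).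
  by rewrite -ztens_assoc_nat ztens_map_comp.
rewrite sum_triangle; apply: eq_bigr => i _; rewrite ztens_map_comp.
rewrite (@ztens_map_sumr _ _ _ _ _ _ (fun j : 'I_(n - i).+1 => ztens_map (G0_in T j)
  (G0_in T (n - i - j)%N) \o G0_res X (subnKC (leq_ord j)))) => [|y]; last first.
  by rewrite /= G0_comulE.
apply: eq_bigr => j _.
by rewrite -(total_termE (subnKC (leq_ord i)) (subnKC (leq_ord j))) /term ztens_map_comp.
Qed.
End Coassociativity.

Lemma tower_coalgebra : is_zcoalgebra (G0_comul X) (G0_counit X).
Proof.
split; [|exact: tower_counitl|exact: tower_counitr].
apply: dsum_induction => [|x y ex ey|n x]; last exact: coassoc_in.
  by rewrite !raddf0.
by rewrite !raddfB ex ey.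
Qed.
End AlgebraLaws.

Theorem theorem4p3 (K : fieldType) (T : tensor_tower K)
  (hproj : forall m n : nat, two_sided_projective T m n) :
  inhabited (structure_maps T) /\
  forall X : structure_maps T,
    is_zalgebra (G0_mul X) (G0_unit X) /\ is_zcoalgebra (G0_comul X) (G0_counit X).
Proof.
split; first exact: structure_maps_exist.
by move=> X; split; [exact: tower_algebra | exact: tower_coalgebra].
Qed.
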